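(* Let $\phi$ be a general Bernstein function (not identically zero), let $W_\phi$ be its Bernstein–gamma function and $\phi_*(z)=z/\phi(z)$ for $\mathrm{Re}(z)>0$. Then $$\frac{\Gamma(z)}{W_\phi(z)}=\frac{\phi_*^{1/2}(1)}{\phi_*(z)\,\phi_*^{1/2}(z+1)}\,e^{L_{\phi_*}(z)}e^{-E_{\phi_*}(z)}\qquad\text{for }\mathrm{Re}(z)>0,$$ where, again for $\mathrm{Re}(z)>0$, $$L_{\phi_*}(z-1)=\int_{1\to\mathrm{Re}(z)\to\mathrm{Re}(z)+i\,\mathrm{Im}(z)}\log_0(\phi_*(w))\,\mathrm dw=G_{\phi_*}(\mathrm{Re}(z))-A_{\phi_*}(z)+iU_{\phi_*}(z),$$ with $$G_{\phi_*}(a)=\int_1^a\ln\phi_*(w)\,\mathrm dw,\quad A_{\phi_*}(z)=\int_0^{\mathrm{Im}(z)}\arg\phi_*(\mathrm{Re}(z)+iw)\,\mathrm dw,\quad U_{\phi_*}(z)=\int_0^{\mathrm{Im}(z)}\ln|\phi_*(\mathrm{Re}(z)+iw)|\,\mathrm dw .$$ Moreover, uniformly in $\mathrm{Im}(z)$, $$T_{\phi_*}:=\lim_{\mathrm{Re}(z)\to\infty}E_{\phi_*}(z)=\frac12\int_1^\infty P(u)\left(\frac1{u^2}-\left(\frac{\phi'(u)}{\phi(u)}\right)^2+\frac{\phi''(u)}{\phi(u)}\right)\mathrm du.$$ Finally, $$\frac{\Gamma(z)}{W_\phi(z)}=(1+\mathrm o(1))\,\frac{\phi_*^{1/2}(1)}{\phi_*^{1/2}(z+1)}\,e^{L_{\phi_*}(z-1)}e^{-T_{\phi_*}},$$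 where the asymptotic relation $\mathrm o(1)$ holds uniformly in $\mathrm{Im}(z)$ as $\mathrm{Re}(z)\to\infty$.
   Context: A Bernstein function is $$\phi(z)=q+dz+\int_0^\infty(1-e^{-zy})\,\mu(\mathrm dy),\qquad \mathrm{Re}(z)\ge0,$$ with $q,d\ge0$ and $\mu$ a measure on $(0,\infty)$ satisfying $\int_0^\infty\min\{y,1\}\mu(\mathrm dy)<\infty$. If $\phi\not\equiv0$ then $\mathrm{Re}\,\phi(z)>0$ for $\mathrm{Re}(z)>0$. The Bernstein–gamma function $W_\phi$ is the solution of $W_\phi(z+1)=\phi(z)W_\phi(z)$, $W_\phi(1)=1$, $\mathrm{Re}(z)>0$, which is the Mellin transform of a non-negative random variable, i.e. $W_\phi(z)=\mathbb E[Y_\phi^{z-1}]$ for some random variable $Y_\phi$. For $\phi(z)=z$ this is $\Gamma(z)$. $\log_0 z=\ln|z|+i\arg z$ is the principal branch of the logarithm, $\arg:\mathbb C\to(-\pi,\pi]$, and square roots are taken with the principal branch. Further, $$P(u)=(u-\lfloor u\rfloor)\bigl(1-(u-\lfloor u\rfloor)\bigr).$$ For $f=\phi$ or $f=\phi_*$ and $\mathrm{Re}(z)>0$, $$L_f(z)=\int_{1\to z+1}\log_0(f(w))\,\mathrm dw,\qquad E_f(z)=\frac12\int_1^\infty P(u)\left(\log_0\frac{f(u+z)}{f(u)}\right)''\mathrm du,$$ where the integral defining $L_f$ is along any contour from $1$ to $z+1$ in the domain of analyticity of $\log_0 f$, the derivatives in $E_f$ are in $u$, and $L_{\phi_*}(z-1)$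 for $\mathrm{Re}(z)>0$ is the same contour integral from $1$ to $z$. The contour $1\to\mathrm{Re}(z)\to\mathrm{Re}(z)+i\,\mathrm{Im}(z)$ consists of the two consecutive line segments. *)

(* Defs.v *)
(* MathComp-Analysis, with complex numbers R[i] over R : realType. *)
From HB Require Import structures.
From mathcomp Require Import all_boot all_order all_algebra.
From mathcomp Require Import all_classical all_reals all_analysis.
From mathcomp Require Export complex.

Set Implicit Arguments.
Unset Strict Implicit.
Unset Printing Implicit Defensive.

Import Order.TTheory GRing.Theory Num.Theory.
Import numFieldNormedType.Exports.
Import ComplexField.Normc.

Local Open Scope classical_set_scope.
Local Open Scope ring_scope.
Local Open Scope complex_scope.

Local Notation Re := complex.Re.
Local Notation Im := complex.Im.

Section elementary_functions.
Context {R : realType}.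
Implicit Types z w : R[i].

Definition cexp z : R[i] :=
  (expR (Re z))%:C * (cos (Im z) +i* sin (Im z)).

(* Values in (-pi, pi], with arg = pi on the negative half-axis (acos (-1) = pi).
   The value at 0 is immaterial. *)
Definition arg z : R :=
  if 0 <= Im z then acos (Re z / normc z) else - acos (Re z / normc z).

Definition log0 z : R[i] := ln (normc z) +i* arg z.

Definition csqrt z : R[i] := cexp (log0 z / 2%:R).

(* y ^ w for real y >= 0, with the library's convention for powR at y = 0. *)
Definition rpowc (y : R) w : R[i] :=
  if y == 0 then (w == 0)%:R else cexp (w * (ln y)%:C).

End elementary_functions.

Section complex_valued_calculus.
Context {R : realType}.

Definition cintegrable d (T : measurableType d) (mu : {measure set T -> \bar R})
    (D : set T) (F : T -> R[i]) : Prop :=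
  mu.-integrable D (fun x => (Re (F x))%:E) /\
  mu.-integrable D (fun x => (Im (F x))%:E).

Definition cintegral d (T : measurableType d) (mu : {measure set T -> \bar R})
    (D : set T) (F : T -> R[i]) : R[i] :=
  (\int[mu]_(x in D) Re (F x))%R +i* (\int[mu]_(x in D) Im (F x))%R.

(* Derivative of a complex-valued function of a real variable. *)
Definition cderive1 (F : R -> R[i]) (u : R) : R[i] :=
  derive1 (fun v => Re (F v)) u +i* derive1 (fun v => Im (F v)) u.

(* \int_a^b with the usual sign convention when b < a. *)
Definition oriented_integral (a b : R) (f : R -> R) : R :=
  if a <= b then \int[lebesgue_measure]_(x in `[a, b]) f x
  else - \int[lebesgue_measure]_(x in `[b, a]) f x.

End complex_valued_calculus.

Section contours.
Context {R : realType}.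
Implicit Types (D : set R[i]) (h : R -> R[i]) (g : seq (R -> R[i])).

(* A C^1 arc [0, 1] -> D: the derivative on ]0, 1[ extends continuously to
   [0, 1]. *)
Definition C1_arc D h : Prop :=
  [/\ forall t : R, t \in `[0, 1] -> D (h t),
      {within `[0, 1], continuous (fun t => Re (h t))},
      {within `[0, 1], continuous (fun t => Im (h t))} &
      exists dh : R -> R[i],
        [/\ {within `[0, 1], continuous (fun t => Re (dh t))},
            {within `[0, 1], continuous (fun t => Im (dh t))} &
            forall t : R, t \in `]0, 1[ ->
              is_derive t (1 : R) (fun s => Re (h s)) (Re (dh t)) /\
              is_derive t (1 : R) (fun s => Im (h s)) (Im (dh t))]].

(* Piecewise C^1 contours in D, as lists of consecutive C^1 arcs. *)
Fixpoint contour D (a b : R[i]) g : Prop :=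
  match g with
  | [::] => D a /\ a = b
  | h :: g' => [/\ C1_arc D h, h 0 = a & contour D (h 1) b g']
  end.

Definition contour_integral (F : R[i] -> R[i]) g : R[i] :=
  \sum_(h <- g)
    cintegral lebesgue_measure `[0, 1] (fun t => F (h t) * cderive1 h t).

Definition segmentc (a b : R[i]) (t : R) : R[i] := a + t%:C * (b - a).

Definition via_Re (z : R[i]) : seq (R -> R[i]) :=
  [:: segmentc 1 (Re z)%:C; segmentc (Re z)%:C z].

(* Domain of analyticity of log_0 f, for f given on the right half-plane.
   Differentiability is complex: R[i]^o is the normed space C over C. *)
Definition log_analytic (f : R[i] -> R[i]) : set R[i] :=
  [set w | 0 < Re w /\
     \forall v \near (w : R[i]^o),
       derivable ((fun s => log0 (f s)) : R[i]^o -> R[i]^o) v 1].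

End contours.

Section bernstein_gamma.
Context {R : realType}.
Implicit Types (f phi W : R[i] -> R[i]) (z : R[i]).

(* mu is only ever used on ]0, +oo[. *)
Definition bernstein phi : Prop :=
  exists (q d : R) (mu : {measure set (measurableTypeR R) -> \bar R}),
    [/\ 0 <= q, 0 <= d,
        (\int[mu]_(y in `]0%R, +oo[) (Num.min y 1)%:E < +oo)%E &
        forall z, 0 <= Re z ->
          phi z = q%:C + d%:C * z +
            cintegral mu `]0, +oo[ (fun y => 1 - cexp (- (z * y%:C)))].

(* If Y had an atom at 0, the moments with 0 < Re z < 1 would be infinite; with
   the convention of rpowc at 0 such a Y is excluded by the functional equation,
   as W would then be discontinuous at 1 but continuous at 2. *)
Definition bernstein_gamma phi W : Prop :=
  [/\ forall z, 0 < Re z -> W (z + 1) = phi z * W z,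
      W 1 = 1 &
      exists (d : measure_display) (T : measurableType d)
             (P : probability T R) (Y : {RV P >-> R}),
        (forall t, 0 <= Y t) /\
        forall z, 0 < Re z ->
          cintegrable P setT (fun t => rpowc (Y t) (z - 1)) /\
          W z = cintegral P setT (fun t => rpowc (Y t) (z - 1))].

Definition Gammac z : R[i] :=
  cintegral lebesgue_measure `]0, +oo[
    (fun t => rpowc t (z - 1) * (expR (- t))%:C).

Definition phi_star phi z : R[i] := z / phi z.

Definition Pquad (u : R) : R :=
  (u - (Num.floor u)%:~R) * (1 - (u - (Num.floor u)%:~R)).

(* The common value of the integrals of log_0 f along contours from 1 to z + 1
   in the domain of analyticity of log_0 f. *)
Definition Llog f z : R[i] :=
  xget 0 [set I | exists2 g, contour (log_analytic f) 1 (z + 1) g &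
                             I = contour_integral (fun w => log0 (f w)) g].

Definition Eintegrand f z (u : R) : R[i] :=
  (Pquad u)%:C *
  cderive1 (cderive1 (fun v : R => log0 (f (v%:C + z) / f v%:C))) u.

Definition Elog f z : R[i] :=
  2%:R^-1 * cintegral lebesgue_measure `[1, +oo[ (Eintegrand f z).

(* f is real and positive on ]0, +oo[ when f = phi_star phi. *)
Definition Glog f (a : R) : R :=
  oriented_integral 1 a (fun w => ln (Re (f w%:C))).

Definition Alog f z : R :=
  oriented_integral 0 (Im z) (fun w => arg (f (Re z +i* w))).

Definition Ulog f z : R :=
  oriented_integral 0 (Im z) (fun w => ln (normc (f (Re z +i* w)))).

Definition Tintegrand phi (u : R) : R[i] :=
  let p := fun v : R => phi v%:C in
  (Pquad u)%:C * ((u%:C ^+ 2)^-1 - (cderive1 p u / p u) ^+ 2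
                 + cderive1 (cderive1 p) u / p u).

Definition Tlog phi : R[i] :=
  2%:R^-1 * cintegral lebesgue_measure `[1, +oo[ (Tintegrand phi).

(* F z -> l as Re z -> +oo, uniformly in Im z. *)
Definition cvg_unif_Im (F : R[i] -> R[i]) (l : R[i]) : Prop :=
  forall e : R, 0 < e ->
    \forall x \near +oo, forall y : R, normc (F (x +i* y) - l) < e.

End bernstein_gamma.

(* Main.v *)
Require Import Defs.
From HB Require Import structures.
From mathcomp Require Import all_boot all_order all_algebra.
From mathcomp Require Import all_classical all_reals all_analysis.
From mathcomp Require Import measurable_realfun ring lra.

Set Implicit Arguments.
Unset Strict Implicit.
Unset Printing Implicit Defensive.

Import Order.TTheory GRing.Theory Num.Theory.
Import numFieldNormedType.Exports.
Import ComplexField.Normc.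

(** Gamma and W are Mellin transforms of non-negative weights, normalised by
   W 1 = 1, and they solve W (z + 1) = f z * W z with f = id and f = phi
   respectively.  The proof establishes Stirling's formula for both at once and
   divides.

   The functional equation expresses W (n + z) / W n through W z and the
   products of f (k + z) / f k for k < n, so W z is determined by the behaviour
   of W (n + z) / (W n * f n ^ z) for large n.  This quotient tends to 1 by a
   law of large numbers ([mellin_ratio]): under the probability obtained by
   weighting with Y ^ (n - 1), the variable Y / f n has mean 1 and variance
   f (n + 1) / f n - 1 <= 1 / n, and the first order Taylor polynomial of
   x |-> x ^ z at 1 has integral 1.  The logarithms of the products are summed
   by the Euler-Maclaurin formula, whose periodic kernel is Pquad
   ([euler_maclaurin], [stirling_sum]).  The outcome is [stirling]:
   W z * f z is the exponential of a quantity that is linear in log0 f.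

   What is needed of f is collected in [bernstein_like]: Re (f z) >= f (Re z) > 0,
   which keeps all logarithms on the principal branch, the bounds
   |f' z| <= 2 f (a) / a and |f'' z| <= 4 f (a) / a ^ 2 with a = Re z, and
   f (a + 1) / (a + 1) <= f a / a.  They follow from the Levy-Khintchine
   representation ([bernstein_like_bernstein]) and give |(log f)'| = O(1 / a),
   |(log f)''| = O(1 / a ^ 2), uniformly on vertical lines ([tame]).

   Since log0 (phi_star z) = log0 z - log0 (phi z), subtracting the two
   Stirling exponents produces that of phi_star, which contains exactly
   L_(phi_star), the square roots and E_(phi_star) ([gamma_ratio], [ElogE]).
   The logarithm of phi_star has a primitive on the half-plane
   ([cdiff_primitive]), so its contour integrals only depend on the end points;
   the formula with G, A and U is the horizontal-then-vertical contour.
   Finally E - T is half an Euler-Maclaurin tail, of size O(1 / Re z)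
   ([normc_ElogB]), and replacing the integral of log phi_star over
   [z, z + 1] by its value at z costs O(1 / Re z) as well
   ([normc_primitive_step]). *)

Local Open Scope classical_set_scope.
Local Open Scope ring_scope.
Local Open Scope complex_scope.

Local Notation Re := complex.Re.
Local Notation Im := complex.Im.

(** * Real and imaginary parts, modulus *)

Section complex_numbers.
Context {R : realType}.
Implicit Types (x y : R) (z w : R[i]).

Lemma ReD z w : Re (z + w) = Re z + Re w. Proof. by case: z w => [? ?] []. Qed.
Lemma ImD z w : Im (z + w) = Im z + Im w. Proof. by case: z w => [? ?] []. Qed.
Lemma ReN z : Re (- z) = - Re z. Proof. by case: z. Qed.
Lemma ImN z : Im (- z) = - Im z. Proof. by case: z. Qed.
Lemma ReB z w : Re (z - w) = Re z - Re w. Proof. by rewrite ReD ReN. Qed.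
Lemma ImB z w : Im (z - w) = Im z - Im w. Proof. by rewrite ImD ImN. Qed.
Lemma ReMc z w : Re (z * w) = Re z * Re w - Im z * Im w.
Proof. by case: z w => [? ?] []. Qed.
Lemma ImMc z w : Im (z * w) = Re z * Im w + Im z * Re w.
Proof. by case: z w => [? ?] []. Qed.

Definition RIE := (ReD, ImD, ReN, ImN, ReMc, ImMc).

Lemma complexP z w : Re z = Re w -> Im z = Im w -> z = w.
Proof. by case: z w => [? ?] [? ?] /= -> ->. Qed.

Lemma normc_ge0 z : 0 <= normc z.
Proof. by case: z => a b; exact: sqrtr_ge0. Qed.

Lemma sqr_normcE z : normc z ^+ 2 = Re z ^+ 2 + Im z ^+ 2.
Proof. by case: z => a b /=; rewrite sqr_sqrtr// addr_ge0// sqr_ge0. Qed.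

Lemma ler_Re z : `|Re z| <= normc z.
Proof.
rewrite -ler_sqr ?nnegrE ?normc_ge0// sqr_normcE real_normK ?num_real//.
by rewrite lerDl sqr_ge0.
Qed.

Lemma ler_Im z : `|Im z| <= normc z.
Proof.
rewrite -ler_sqr ?nnegrE ?normc_ge0// sqr_normcE real_normK ?num_real//.
by rewrite lerDr sqr_ge0.
Qed.

Lemma normc_le z : normc z <= `|Re z| + `|Im z|.
Proof.
rewrite -ler_sqr ?nnegrE ?normc_ge0// ?addr_ge0// sqr_normcE sqrrD.
by rewrite !real_normK ?num_real// lerD2r lerDl mulrn_wge0.
Qed.

Lemma normcR x : normc x%:C = `|x|.
Proof. by rewrite /= expr0n/= addr0 sqrtr_sqr. Qed.

Lemma normc_eq0 z : (normc z == 0) = (z == 0).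
Proof.
by apply/eqP/eqP => [/eq0_normc//|->]; rewrite normcR normr0.
Qed.

Lemma normc_gt0 z : (0 < normc z) = (z != 0).
Proof. by rewrite lt0r normc_eq0 normc_ge0 andbT. Qed.

Lemma normcB z w : normc (z - w) = normc (w - z).
Proof. by rewrite -normcN opprB. Qed.

Lemma normc_sum3 z w v : normc (z + w + v) <= normc z + normc w + normc v.
Proof. by rewrite (le_trans (le_normcD _ _))// lerD2r le_normcD. Qed.

Lemma Re_gt0_neq0 z : 0 < Re z -> z != 0.
Proof. by apply: contraTneq => ->; rewrite /= ltxx. Qed.

Lemma RCM x y : (x * y)%:C = x%:C * y%:C. Proof. exact: rmorphM. Qed.
Lemma RCD x y : (x + y)%:C = x%:C + y%:C. Proof. exact: rmorphD. Qed.
Lemma RCB x y : (x - y)%:C = x%:C - y%:C. Proof. exact: rmorphB. Qed.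
Lemma RCV x : (x^-1)%:C = x%:C^-1. Proof. exact: fmorphV. Qed.

End complex_numbers.

(** * Complex-valued functions of a real variable *)

Section curves.
Context {R : realType}.
Implicit Types (c : R -> R[i]) (t x e : R) (l : R[i]).

Lemma is_deriveP (f : R -> R) x (a : R) : is_derive x (1 : R) f a <->
  forall e, 0 < e -> \forall h \near (0 : R), `|f (x + h) - f x - a * h| <= e * `|h|.
Proof.
split=> [/is_derive1_caratheodory[g [fg gc gx]] e e0|fe].
  have {}gc : g z @[z --> x] --> a by rewrite -gx; exact: gc.
  move/cvgrPdist_le : gc => /(_ e e0).
  move=> /nbhs0P gxe; near=> h.
  rewrite fg addrAC subrr add0r -mulrBl normrM distrC.
  rewrite ler_wpM2r//; near: h; exact: gxe.
apply/is_derive1_caratheodory.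
pose g z := if z == x then a else (f z - f x) / (z - x).
have gx : g x = a by rewrite /g eqxx.
exists g; split => //.
  move=> z; rewrite /g; case: eqVneq => [->|zx]; first by rewrite !subrr mulr0.
  by rewrite divfK// subr_eq0.
suff : g z @[z --> x] --> a by rewrite -gx.
apply/cvgrPdist_le => e e0; apply/(nbhs0P (V := R)); near=> h; rewrite /g.
case: eqVneq => [_|hx]; first by rewrite subrr normr0 ltW.
have h0 : h != 0 by apply: contraNneq hx => ->; rewrite addr0.
have -> : x + h - x = h by rewrite addrAC subrr add0r.
rewrite distrC -[a](mulfK h0) -mulrBl normrM normfV ler_pdivrMr ?normr_gt0//.
near: h; exact: fe.
Unshelve. all: by end_near. Qed.

(** The little-o form composes directly with the expansions of [cdiff]. *)
Definition is_cderive1 c t l : Prop := forall e, 0 < e ->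
  \forall h \near (0 : R), normc (c (t + h) - c t - l * h%:C) <= e * `|h|.

Lemma is_cderive1P c t l : is_cderive1 c t l <->
  is_derive t (1 : R) (fun s => Re (c s)) (Re l) /\
  is_derive t (1 : R) (fun s => Im (c s)) (Im l).
Proof.
have ReE h : Re (c (t + h) - c t - l * h%:C) =
    Re (c (t + h)) - Re (c t) - Re l * h.
  by rewrite !RIE/= mulr0 subr0.
have ImE h : Im (c (t + h) - c t - l * h%:C) =
    Im (c (t + h)) - Im (c t) - Im l * h.
  by rewrite !RIE/= mulr0 add0r.
split=> [ce|[/is_deriveP re /is_deriveP im] e e0].
  split; apply/is_deriveP => e e0; near=> h.
    rewrite -ReE (le_trans (ler_Re _))//; near: h; exact: ce.
  rewrite -ImE (le_trans (ler_Im _))//; near: h; exact: ce.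
have e20 : 0 < e / 2 by rewrite divr_gt0.
near=> h; rewrite (le_trans (normc_le _))// ReE ImE.
rewrite [e]splitr mulrDl lerD//; near: h; [exact: re|exact: im].
Unshelve. all: by end_near. Qed.

Lemma is_cderive1_cderive1 c t l : is_cderive1 c t l -> cderive1 c t = l.
Proof.
move=> /is_cderive1P[r i]; rewrite /cderive1 !derive1E.
by rewrite (@derive_val _ _ _ _ _ _ _ r) (@derive_val _ _ _ _ _ _ _ i); case: l {r i}.
Qed.

Lemma is_cderive1_near c1 c2 t l :
  (\forall s \near t, c1 s = c2 s) -> is_cderive1 c1 t l -> is_cderive1 c2 t l.
Proof.
move=> c12 d e e0.
have ct := nbhs_singleton c12.
move/nbhs0P : c12 => c12; near=> h; rewrite -ct.
have <- : c1 (t + h) = c2 (t + h) by near: h; exact: c12.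
near: h; exact: d.
Unshelve. all: by end_near. Qed.

Lemma is_cderive1_continuous c t l : is_cderive1 c t l ->
  {for t, continuous (fun s => Re (c s))} /\
  {for t, continuous (fun s => Im (c s))}.
Proof.
move=> /is_cderive1P[r i]; split; apply/differentiable_continuous.
  by apply/derivable1_diffP; exact: ex_derive.
by apply/derivable1_diffP; exact: ex_derive.
Qed.

(** Mean value inequality; the factor 2 comes from treating the real and the
   imaginary part separately. *)
Lemma cMVT c (dc : R -> R[i]) (M : R) :
  (forall t, 0 <= t <= 1 -> is_cderive1 c t (dc t)) ->
  (forall t, 0 <= t <= 1 -> normc (dc t) <= M) ->
  normc (c 1 - c 0) <= 2 * M.
Proof.
move=> cd cM.
have h (p : R[i] -> R) : (forall z w, p (z - w) = p z - p w) ->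
  (forall z, `|p z| <= normc z) ->
  (forall t, 0 <= t <= 1 -> is_derive t (1 : R) (fun s => p (c s)) (p (dc t))) ->
  `|p (c 1 - c 0)| <= M.
  move=> pB pn pd.
  have [||s] := @MVT R (fun s => p (c s)) (fun s => p (dc s)) 0 1 ltr01.
  - by move=> s; rewrite in_itv/= => /andP[s0 s1]; apply: pd; rewrite !ltW.
  - apply: continuous_in_subspaceT => s; rewrite inE/= in_itv/= => s01.
    apply/differentiable_continuous/derivable1_diffP.
    by apply: ex_derive; exact: pd.
  rewrite in_itv/= => /andP[s0 s1].
  rewrite subr0 mulr1 pB => ->.
  by rewrite (le_trans (pn _))// cM// !ltW.
rewrite (le_trans (normc_le _))// mulrDl mul1r lerD//.
  apply: (h (@complex.Re R)) => //; [exact: ReB|exact: ler_Re|].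
  by move=> t /cd/is_cderive1P[].
apply: (h (@complex.Im R)) => //; [exact: ImB|exact: ler_Im|].
by move=> t /cd/is_cderive1P[].
Qed.

End curves.

(** * The complex exponential *)

Section cexp.
Context {R : realType}.
Implicit Types (x y : R) (z w : R[i]).

Lemma cexpE z : cexp z = (expR (Re z) * cos (Im z)) +i* (expR (Re z) * sin (Im z)).
Proof. by apply: complexP; rewrite /cexp !RIE/= mul0r ?subr0 ?addr0. Qed.

Lemma cexpD z w : cexp (z + w) = cexp z * cexp w.
Proof.
rewrite !cexpE !RIE expRD cosD sinD; apply: complexP; rewrite !RIE/=; ring.
Qed.

Lemma cexpR x : cexp x%:C = (expR x)%:C.
Proof. by rewrite cexpE/= cos0 sin0 mulr1 mulr0. Qed.

Lemma cexp0 : cexp 0 = 1 :> R[i].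
Proof. by rewrite cexpR expR0. Qed.

Lemma normc_cexp z : normc (cexp z) = expR (Re z).
Proof.
rewrite cexpE/= !exprMn -mulrDr cos2Dsin2 mulr1 sqrtr_sqr ger0_norm// expR_ge0.
Qed.

Lemma cexp_neq0 z : cexp z != 0.
Proof. by rewrite -normc_gt0 normc_cexp expR_gt0. Qed.

Lemma cexpN z : cexp (- z) = (cexp z)^-1.
Proof.
by apply: (mulIf (cexp_neq0 z)); rewrite -cexpD addNr cexp0 mulVf// cexp_neq0.
Qed.

Lemma cexpB z w : cexp (z - w) = cexp z / cexp w.
Proof. by rewrite cexpD cexpN. Qed.

Lemma cexp_sum (I : Type) (r : seq I) (F : I -> R[i]) :
  cexp (\sum_(i <- r) F i) = \prod_(i <- r) cexp (F i).
Proof. by apply: (big_morph cexp cexpD cexp0). Qed.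

Lemma is_cderive1_cexp z t :
  is_cderive1 (fun s : R => cexp (s%:C * z)) t (z * cexp (t%:C * z)).
Proof.
apply/is_cderive1P; split.
- have -> : (fun s : R => Re (cexp (s%:C * z))) =
      (fun s => expR (s * Re z) * cos (s * Im z)).
    by apply/funext => s; rewrite cexpE !RIE/= !mul0r subr0 addr0.
  apply: is_derive_eq; rewrite cexpE !RIE/= !mul0r subr0 addr0 /GRing.scale/=.
  ring.
- have -> : (fun s : R => Im (cexp (s%:C * z))) =
      (fun s => expR (s * Re z) * sin (s * Im z)).
    by apply/funext => s; rewrite cexpE !RIE/= !mul0r subr0 addr0.
  apply: is_derive_eq; rewrite cexpE !RIE/= !mul0r subr0 addr0 /GRing.scale/=.
  ring.
Qed.

End cexp.

(** * Estimates for the exponential and the principal logarithm *)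

Section exp_log_bounds.
Context {R : realType}.
Implicit Types (x y t : R) (z w u : R[i]).

Lemma is_cderive1Z (t : R) (w : R[i]) : is_cderive1 (fun s : R => s%:C * w) t w.
Proof.
move=> e e0; near=> h; rewrite [X in normc X](_ : _ = 0) ?normc0 ?mulr_ge0// ?ltW//.
by rewrite RCD; ring.
Unshelve. all: by end_near. Qed.

Lemma is_cderive1B (c1 c2 : R -> R[i]) t (l1 l2 : R[i]) :
  is_cderive1 c1 t l1 -> is_cderive1 c2 t l2 ->
  is_cderive1 (fun s => c1 s - c2 s) t (l1 - l2).
Proof.
move=> d1 d2 e e0; have e20 : 0 < e / 2 by rewrite divr_gt0.
near=> h.
rewrite [X in normc X](_ : _ = (c1 (t + h) - c1 t - l1 * h%:C) -
   (c2 (t + h) - c2 t - l2 * h%:C)); last by ring.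
rewrite (le_trans (le_normcD _ _))// normcN [e]splitr mulrDl lerD//.
  by near: h; exact: d1.
by near: h; exact: d2.
Unshelve. all: by end_near. Qed.

Lemma normcZ t w : 0 <= t -> normc (t%:C * w) = t * normc w.
Proof. by move=> t0; rewrite normcM normcR ger0_norm. Qed.

Lemma normc_cexpB1 w : normc (cexp w - 1) <= 2 * (normc w * expR (normc w)).
Proof.
have := @cMVT R (fun s : R => cexp (s%:C * w)) (fun s => w * cexp (s%:C * w))
  (normc w * expR (normc w)).
rewrite mul0r cexp0 mul1r; apply => [t _|t /andP[t0 t1]].
  exact: is_cderive1_cexp.
rewrite normcM ler_wpM2l ?normc_ge0// normc_cexp ler_expR.
rewrite (le_trans (ler_norm _))// (le_trans (ler_Re _))// normcZ//.
by rewrite ler_piMl// normc_ge0.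
Qed.

Lemma normc_cexpB1B w :
  normc (cexp w - 1 - w) <= 4 * (normc w ^+ 2 * expR (normc w)).
Proof.
have := @cMVT R (fun s : R => cexp (s%:C * w) - s%:C * w)
  (fun s => w * cexp (s%:C * w) - w) (2 * (normc w ^+ 2 * expR (normc w))).
rewrite !mul0r cexp0 !mul1r subr0 addrAC => H; apply: (le_trans (H _ _)) => //.
- move=> t _; apply: is_cderive1B; [exact: is_cderive1_cexp|exact: is_cderive1Z].
- move=> t /andP[t0 t1].
  rewrite -[X in _ - X]mulr1 -mulrBr normcM.
  rewrite (_ : 2 * _ = normc w * (2 * (normc w * expR (normc w)))); last by ring.
  rewrite ler_wpM2l ?normc_ge0// (le_trans (normc_cexpB1 _))//.
  rewrite ler_wpM2l// normcZ// ler_pM ?mulr_ge0 ?expR_ge0 ?normc_ge0//.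
    by rewrite ler_piMl// normc_ge0.
  by rewrite ler_expR ler_piMl// normc_ge0.
- lra.
Qed.

Lemma normr_lnB x : 2^-1 <= x -> `|ln x - (x - 1)| <= 2 * (x - 1) ^+ 2.
Proof.
move=> x2; have x0 : 0 < x by apply: lt_le_trans x2; rewrite invr_gt0.
have ln_le : ln x <= x - 1.
  have := @le_ln1Dx R (x - 1); rewrite subrKC; apply; lra.
have ln_ge : 1 - x^-1 <= ln x.
  have := @le_ln1Dx R (x^-1 - 1); rewrite subrKC lnV ?posrE// => H.
  rewrite lerNl in H; rewrite -opprB; apply: H.
  by rewrite ltrBDr addNr invr_gt0.
rewrite ler0_norm ?subr_le0// opprB.
apply: (@le_trans _ _ (x - 1 - (1 - x^-1))); first lra.
have -> : x - 1 - (1 - x^-1) = x^-1 * (x - 1) ^+ 2 by field; rewrite gt_eqF.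
by rewrite ler_wpM2r ?sqr_ge0// invf_ple ?posrE// invrK.
Qed.

Lemma normr_ln x : 2^-1 <= x <= 3/2 -> `|ln x| <= 2 * `|x - 1|.
Proof.
move=> /andP[x2 x3].
rewrite -[ln x](subrK (x - 1)) (le_trans (ler_normD _ _))//.
rewrite (_ : 2 * `|x - 1| = `|x - 1| + `|x - 1|); last by ring.
rewrite lerD2r (le_trans (normr_lnB x2))// -real_normK ?num_real//.
rewrite expr2 mulrA ler_piMl// -ler_pdivlMl// mulr1.
rewrite ler_norml; apply/andP; split; lra.
Qed.

Lemma normr_atan t : `|atan t| <= `|t|.
Proof.
wlog t0 : t / 0 <= t.
  by move=> H; have [/H//|/ltW t0] := leP 0 t; rewrite -normrN -atanN -[leRHS]normrN H// oppr_ge0.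
have [|s] := @MVT_segment R atan (fun t => (1 + t ^+ 2)^-1) 0 t t0.
  by apply: continuous_in_subspaceT => s _; exact: continuous_atan.
rewrite atan0 !subr0 => _ ->; rewrite normrM ler_piMl//.
rewrite ger0_norm ?invr_ge0 ?addr_ge0 ?sqr_ge0// invf_le1 ?lerDl ?sqr_ge0//.
by rewrite ltr_pwDl ?sqr_ge0.
Qed.

Lemma cos_arg z : z != 0 -> cos (arg z) = Re z / normc z.
Proof.
rewrite -normc_gt0 => z0.
have c1 : -1 <= Re z / normc z <= 1.
  by rewrite -ler_norml normrM normfV (ger0_norm (normc_ge0 z)) ler_pdivrMr// mul1r ler_Re.
by rewrite /arg; case: ifP => _; rewrite ?cosN acosK// in_itv.
Qed.

Lemma sin_arg z : z != 0 -> sin (arg z) = Im z / normc z.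
Proof.
rewrite -normc_gt0 => z0.
have c1 : -1 <= Re z / normc z <= 1.
  by rewrite -ler_norml normrM normfV (ger0_norm (normc_ge0 z)) ler_pdivrMr// mul1r ler_Re.
have E : Num.sqrt (1 - (Re z / normc z) ^+ 2) = `|Im z| / normc z.
  rewrite (_ : 1 - _ = (Im z / normc z) ^+ 2).
    by rewrite sqrtr_sqr normrM normfV (ger0_norm (normc_ge0 z)).
  rewrite !expr_div_n -[1](@mulfV _ (normc z ^+ 2)) ?expf_neq0 ?gt_eqF//.
  by rewrite -mulrBl sqr_normcE; congr (_ / _); ring.
rewrite /arg; case: ifP => i0; rewrite ?sinN sin_acos// E.
  by rewrite ger0_norm.
by rewrite ltr0_norm ?mulNr ?opprK// ltNge i0.
Qed.

Lemma cexp_log0 z : z != 0 -> cexp (log0 z) = z.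
Proof.
move=> z0; have n0 : 0 < normc z by rewrite normc_gt0.
rewrite cexpE/= lnK ?posrE// cos_arg// sin_arg//.
by apply: complexP => /=; rewrite mulrCA mulfV ?mulr1// gt_eqF.
Qed.

(** The strip -pi < Im z <= pi is where cexp is inverted by the principal
   branch; additivity of log0 reduces to staying in it. *)
Lemma log0_cexp z : - pi < Im z <= pi -> log0 (cexp z) = z.
Proof.
move=> /andP[zl zu]; rewrite /log0 normc_cexp expRK; apply: complexP => //=.
rewrite /arg normc_cexp cexpE/= pmulr_rge0 ?expR_gt0//.
rewrite mulrAC mulfV ?mul1r ?gt_eqF ?expR_gt0//.
have [z0|z0] := leP 0 (Im z).
  by rewrite sin_ge0_pi ?z0// cosK// in_itv/= z0.
rewrite leNgt -oppr_gt0 -sinN sin_gt0_pi ?oppr_gt0 ?z0//=; last by rewrite ltrNl.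
by rewrite cosKN ?opprK// (ltW zl) ltW.
Qed.

Lemma arg_pihalf z : 0 < Re z -> - (pi / 2) < arg z < pi / 2.
Proof.
move=> z0; have n0 : 0 < normc z by rewrite normc_gt0 Re_gt0_neq0.
have c1 : -1 <= Re z / normc z <= 1.
  by rewrite -ler_norml normrM normfV (ger0_norm (normc_ge0 z)) ler_pdivrMr// mul1r ler_Re.
have a0 : 0 <= acos (Re z / normc z) by exact: acos_ge0.
have a1 : acos (Re z / normc z) < pi / 2.
  rewrite -ltr_cos ?in_itv/=; last 2 first.
  - by rewrite a0 acos_lepi.
  - by rewrite divr_ge0 ?pi_ge0//= ler_pdivrMr// ler_peMr ?pi_ge0// ler1n.
  by rewrite cos_pihalf acosK ?in_itv//= divr_gt0.
rewrite /arg; case: ifP => _.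
  by rewrite a1 andbT (lt_le_trans _ a0)// oppr_lt0 divr_gt0// pi_gt0.
by rewrite ltrN2 a1/= (le_lt_trans _ (le_lt_trans a0 a1))// oppr_le0.
Qed.

Lemma log0M z w : 0 < Re z -> 0 < Re w -> log0 (z * w) = log0 z + log0 w.
Proof.
move=> z0 w0; rewrite -{1}(cexp_log0 (Re_gt0_neq0 z0)) -{1}(cexp_log0 (Re_gt0_neq0 w0)).
rewrite -cexpD log0_cexp//=.
move: (arg_pihalf z0) (arg_pihalf w0) => /andP[? ?] /andP[? ?].
rewrite (splitr pi); apply/andP; split; lra.
Qed.

Lemma log0V z : 0 < Re z -> log0 z^-1 = - log0 z.
Proof.
move=> z0; rewrite -{1}(cexp_log0 (Re_gt0_neq0 z0)) -cexpN log0_cexp//=.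
move: (arg_pihalf z0) => /andP[? ?]; have := @pi_gt0 R => ?.
rewrite (splitr pi); apply/andP; split; lra.
Qed.

Lemma Re_inv_gt0 z : 0 < Re z -> 0 < Re z^-1.
Proof.
case: z => a b /= a0; rewrite divr_gt0// ltr_pwDl ?exprn_gt0 ?sqr_ge0//.
Qed.

Lemma log0_div z w : 0 < Re z -> 0 < Re w -> log0 (z / w) = log0 z - log0 w.
Proof. by move=> z0 w0; rewrite log0M ?log0V// Re_inv_gt0. Qed.

Lemma arg_atan z : 0 < Re z -> arg z = atan (Im z / Re z).
Proof.
move=> z0; have zn := Re_gt0_neq0 z0.
have n0 : normc z != 0 by rewrite normc_eq0.
rewrite -[LHS]tanK ?in_itv ?arg_pihalf//; congr atan.
rewrite /tan cos_arg// sin_arg//; field; rewrite n0 gt_eqF//.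
Qed.

(** The modulus of 1 + w is within |w| of 1, and its argument is the arctangent
   of Im / Re, of size at most 2 |w|. *)
Lemma log0_1Dw w : normc w <= 2^-1 -> normc (log0 (1 + w)) <= 4 * normc w.
Proof.
move=> w2; have := le_trans (ler_Re w) w2 => /ler_normlP[r1 r2].
have R1 : Re (1 + w) = 1 + Re w by rewrite ReD.
have re : 2^-1 <= Re (1 + w) by rewrite R1; lra.
have re0 : 0 < Re (1 + w) by lra.
rewrite (le_trans (normc_le _))//=.
rewrite (_ : 4 * normc w = 2 * normc w + 2 * normc w); last by ring.
rewrite lerD//.
  have n1 : `|normc (1 + w) - 1| <= normc w.
    rewrite ler_norml; apply/andP; split.
      have := le_normcD (1 + w) (- w); rewrite addrK normcN normc1; lra.
    have := le_normcD 1 w; rewrite normc1; lra.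
  rewrite (le_trans (@normr_ln (normc (1 + w)) _))//; last by rewrite ler_wpM2l.
  move: n1 => /ler_normlP[? ?]; apply/andP; split; lra.
rewrite arg_atan// (le_trans (normr_atan _))// normrM normfV.
rewrite (ger0_norm (ltW re0)) ler_pdivrMr// ImD add0r.
rewrite (le_trans (ler_Im _))// [leRHS]mulrAC ler_peMl ?normc_ge0//.
by rewrite mulrC; lra.
Qed.

End exp_log_bounds.

(** * Complex differentiability *)

Section complex_differentiability.
Context {R : realType}.
Implicit Types (F G : R[i] -> R[i]) (z w l m : R[i]) (K r : R).

(** A holomorphic function has a quadratic remainder at every point.  Requiring
   it in place of a little-o makes differentiation under the integral sign a
   matter of one pointwise bound. *)
Definition cdiff F z l : Prop := exists K r, [/\ 0 <= K, 0 < r &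
  forall w, normc w <= r -> normc (F (z + w) - F z - l * w) <= K * normc w ^+ 2].

Lemma cdiff_lip F z l : cdiff F z l -> exists K r, [/\ 0 < K, 0 < r &
  forall w, normc w <= r -> normc (F (z + w) - F z) <= K * normc w].
Proof.
move=> [K [r [K0 r0 Fz]]]; exists (K * r + normc l + 1), r; split => //.
  by rewrite ltr_wpDl// addr_ge0 ?normc_ge0// mulr_ge0// ltW.
move=> w wr; rewrite -[_ - _](subrK (l * w)) (le_trans (le_normcD _ _))//.
rewrite normcM -[X in _ <= X * _]addrA mulrDl lerD//.
  rewrite (le_trans (Fz _ wr))// expr2 mulrA ler_wpM2r ?normc_ge0//.
  by rewrite ler_wpM2l.
by rewrite mulrDl lerDl mul1r normc_ge0.
Qed.

Lemma cdiff_cst l z : cdiff (fun=> l) z 0.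
Proof.
by exists 0, 1; split => // w _; rewrite subrr mul0r subrr normc0 mul0r.
Qed.

Lemma cdiff_id z : cdiff id z 1.
Proof.
exists 0, 1; split => // w _; rewrite [X in normc X](_ : _ = 0) ?normc0 ?mul0r//.
by rewrite /=; ring.
Qed.

Lemma cdiffD F G z l m : cdiff F z l -> cdiff G z m ->
  cdiff (fun s => F s + G s) z (l + m).
Proof.
move=> [K [r [K0 r0 Fz]]] [K' [r' [K0' r0' Gz]]].
exists (K + K'), (Num.min r r'); split; rewrite ?addr_ge0 ?lt_min ?r0//.
move=> w; rewrite le_min => /andP[wr wr'].
rewrite [X in normc X](_ : _ = (F (z + w) - F z - l * w) +
  (G (z + w) - G z - m * w)); last by ring.
by rewrite (le_trans (le_normcD _ _))// mulrDl lerD// ?Fz ?Gz.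
Qed.

Lemma cdiffM F G z l m : cdiff F z l -> cdiff G z m ->
  cdiff (fun s => F s * G s) z (l * G z + F z * m).
Proof.
move=> dF dG; have [LF [rF [LF0 rF0 LFz]]] := cdiff_lip dF.
have [LG [rG [LG0 rG0 LGz]]] := cdiff_lip dG.
case: dF dG => [K [r [K0 r0 Fz]]] [K' [r' [K0' r0' Gz]]].
exists (K * normc (G z) + normc (F z) * K' + LF * LG),
  (Num.min (Num.min r r') (Num.min rF rG)).
split; rewrite ?lt_min ?r0 ?r0' ?rF0//.
  by rewrite !addr_ge0 ?mulr_ge0 ?normc_ge0// ltW.
move=> w; rewrite !le_min => /andP[/andP[wr wr'] /andP[wF wG]].
rewrite [X in normc X](_ : _ = (F (z + w) - F z - l * w) * G z +
  F z * (G (z + w) - G z - m * w) + (F (z + w) - F z) * (G (z + w) - G z));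
  last by ring.
rewrite (le_trans (normc_sum3 _ _ _))// !normcM !mulrDl !lerD//.
- by rewrite [leRHS]mulrAC ler_wpM2r ?normc_ge0 ?Fz.
- by rewrite -mulrA ler_wpM2l ?normc_ge0 ?Gz.
- by rewrite expr2 mulrACA ler_pM ?normc_ge0 ?LFz ?LGz.
Qed.

Lemma cdiffZ F z l k : cdiff F z l -> cdiff (fun s => k * F s) z (k * l).
Proof.
by move=> /(cdiffM (cdiff_cst k z)); rewrite mul0r add0r.
Qed.

Lemma cdiffN F z l : cdiff F z l -> cdiff (fun s => - F s) z (- l).
Proof.
move=> /(cdiffZ (-1)); rewrite mulN1r.
by under eq_fun do rewrite mulN1r.
Qed.

Lemma cdiffB F G z l m : cdiff F z l -> cdiff G z m ->
  cdiff (fun s => F s - G s) z (l - m).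
Proof. by move=> dF /cdiffN; exact: cdiffD. Qed.

Lemma cdiff_comp F G z l m : cdiff F z l -> cdiff G (F z) m ->
  cdiff (G \o F) z (m * l).
Proof.
move=> dF; have [L [rF [L0 rF0 LFz]]] := cdiff_lip dF.
case: dF => [K [r [K0 r0 Fz]]] [K' [r' [K0' r0' Gz]]].
exists (K' * L ^+ 2 + normc m * K), (Num.min (Num.min r rF) (r' / L)).
split; rewrite ?lt_min ?r0 ?rF0 ?divr_gt0//.
  by rewrite addr_ge0// mulr_ge0 ?normc_ge0 ?sqr_ge0.
move=> w; rewrite !le_min => /andP[/andP[wr wF]].
rewrite ler_pdivlMr// mulrC => wr' /=.
have := LFz w wF; set d := F (z + w) - F z => dw.
have -> : F (z + w) = F z + d by rewrite /d; ring.
rewrite [X in normc X](_ : _ = (G (F z + d) - G (F z) - m * d) +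
  m * (F (z + w) - F z - l * w)); last by rewrite /d; ring.
rewrite (le_trans (le_normcD _ _))// mulrDl lerD//.
  rewrite (le_trans (Gz _ _))//; first exact: le_trans wr'.
  by rewrite -mulrA ler_wpM2l// -exprMn lerXn2r// nnegrE ?normc_ge0 ?mulr_ge0 ?normc_ge0// ltW.
by rewrite normcM -mulrA ler_wpM2l ?normc_ge0 ?Fz.
Qed.

Lemma cdiffV z : z != 0 -> cdiff (fun s => s^-1) z (- (z ^+ 2)^-1).
Proof.
move=> z0; have n0 : 0 < normc z by rewrite normc_gt0.
exists (2 * (normc z ^+ 3)^-1), (normc z / 2); split.
- by rewrite mulr_ge0 ?invr_ge0 ?exprn_ge0 ?normc_ge0.
- by rewrite divr_gt0.
move=> w wz.
have zw2 : normc z / 2 <= normc (z + w).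
  have := le_normcD (z + w) (- w); rewrite addrK normcN; lra.
have zw : z + w != 0 by rewrite -normc_gt0 (lt_le_trans _ zw2)// divr_gt0.
rewrite [X in normc X](_ : _ = w ^+ 2 * ((z ^+ 2)^-1 * (z + w)^-1)); last first.
  by field; rewrite z0 zw.
rewrite !expr2 !normcM !normcV normcM mulrC ler_wpM2r// ?mulr_ge0 ?normc_ge0//.
have -> : 2 / normc z ^+ 3 = (normc z * normc z)^-1 * (normc z / 2)^-1.
  by field; rewrite gt_eqF.
rewrite ler_wpM2l ?invr_ge0 ?mulr_ge0 ?normc_ge0//.
by rewrite lef_pV2 ?posrE ?normc_gt0 ?divr_gt0.
Qed.

Lemma cdiff_div F G z l m : G z != 0 -> cdiff F z l -> cdiff G z m ->
  cdiff (fun s => F s / G s) z (l / G z - F z * m / G z ^+ 2).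
Proof.
move=> Gz dF dG; have := cdiffM dF (cdiff_comp dG (cdiffV Gz)).
by rewrite mulrA mulrN !mulNr [F z * m * _]mulrAC.
Qed.

Lemma cdiff_Re_gt0 F G z l : 0 < Re z ->
  (forall s, 0 < Re s -> F s = G s) -> cdiff F z l -> cdiff G z l.
Proof.
move=> z0 FG [K [r [K0 r0 Fz]]]; exists K, (Num.min r (Re z / 2)).
split => //; first by rewrite lt_min r0 divr_gt0.
move=> w; rewrite le_min => /andP[wr wz].
rewrite -!FG// ?Fz// ReD.
have /ler_normlP[? ?] := le_trans (ler_Re w) wz; lra.
Qed.

Lemma cdiff_cexp z : cdiff cexp z (cexp z).
Proof.
exists (normc (cexp z) * (4 * expR 1)), 1; split => //.
  by rewrite mulr_ge0 ?normc_ge0// mulr_ge0// expR_ge0.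
move=> w w1; rewrite cexpD [X in normc X](_ : _ = cexp z * (cexp w - 1 - w)); last by ring.
rewrite normcM -mulrA ler_wpM2l ?normc_ge0// (le_trans (normc_cexpB1B _))//.
rewrite -mulrA ler_wpM2l// mulrC ler_wpM2r ?sqr_ge0//.
by rewrite ler_expR.
Qed.

(** Inverting the quadratic expansion of the exponential: log0 (1 + w) is
   already known to be O(w), hence differs from w by O(w^2). *)
Lemma cdiff_log0 z : 0 < Re z -> cdiff log0 z z^-1.
Proof.
move=> z0; have zn := Re_gt0_neq0 z0.
have n0 : 0 < normc z by rewrite normc_gt0.
exists (64 * expR 2 * (normc z ^+ 2)^-1), (Num.min (normc z / 2) (Re z / 2)); split.
- by rewrite !mulr_ge0 ?expR_ge0 ?invr_ge0 ?sqr_ge0.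
- by rewrite lt_min !divr_gt0.
move=> w; rewrite le_min => /andP[wz wRe].
pose u := w / z.
have nu : normc u = normc w / normc z by rewrite normcM normcV.
have u2 : normc u <= 2^-1 by rewrite nu ler_pdivrMr// mulrC.
have /ler_normlP[ur _] := le_trans (ler_Re u) u2.
have u0 : 0 < Re (1 + u) by rewrite ReD/=; lra.
have -> : z + w = z * (1 + u) by rewrite mulrDr mulr1 /u mulrC divfK.
rewrite log0M// [X in normc X](_ : _ = log0 (1 + u) - u); last first.
  by rewrite /u; ring.
have -> : 64 * expR 2 / normc z ^+ 2 * normc w ^+ 2 = normc u ^+ 2 * (64 * expR 2).
  by rewrite nu; field; rewrite gt_eqF.
set s := log0 _.
have s4 : normc s <= 4 * normc u by exact: log0_1Dw.
have us : cexp s = 1 + u by rewrite cexp_log0// Re_gt0_neq0.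
rewrite normcB (_ : u - s = cexp s - 1 - s); last by rewrite us; ring.
rewrite (le_trans (normc_cexpB1B _))//.
have -> : normc u ^+ 2 * (64 * expR 2) = 4 * ((4 * normc u) ^+ 2 * expR 2) by ring.
rewrite ler_wpM2l// ler_pM ?sqr_ge0 ?expR_ge0//.
  by rewrite lerXn2r// nnegrE ?mulr_ge0 ?normc_ge0.
rewrite ler_expR (le_trans s4)//; lra.
Qed.

Lemma cdiff_curve F (c : R -> R[i]) t l m :
  cdiff F (c t) l -> is_cderive1 c t m -> is_cderive1 (F \o c) t (l * m).
Proof.
move=> [K [r [K0 r0 Fz]]] cd e e0.
pose L := normc m + 1.
have L0 : 0 < L by rewrite ltr_wpDl ?normc_ge0.
pose e1 := e / 2 / (normc l + 1).
have l0 : 0 < normc l + 1 by rewrite ltr_wpDl ?normc_ge0.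
have e10 : 0 < e1 by rewrite !divr_gt0.
pose d := Num.min (r / L) (e / 2 / (K * L ^+ 2 + 1)).
have KL0 : 0 < K * L ^+ 2 + 1 by rewrite ltr_wpDl// mulr_ge0// sqr_ge0.
have d0 : 0 < d by rewrite lt_min !divr_gt0.
near=> h.
have hd : `|h| <= d by near: h; exact: (nbhs0_le (V := R)).
have H1 : normc (c (t + h) - c t - m * h%:C) <= e1 * `|h| by near: h; exact: cd.
have H2 : normc (c (t + h) - c t - m * h%:C) <= 1 * `|h| by near: h; exact: cd.
pose w := c (t + h) - c t.
have wL : normc w <= L * `|h|.
  rewrite -[w](subrK (m * h%:C)) (le_trans (le_normcD _ _))//.
  by rewrite normcM normcR /L mulrDl addrC lerD2l.
move: hd; rewrite le_min => /andP[]; rewrite ler_pdivlMr// => hr; rewrite ler_pdivlMr// => hK.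
have wr : normc w <= r by rewrite (le_trans wL)// mulrC.
have -> : (F \o c) (t + h) = F (c t + w) by rewrite /= /w; congr F; ring.
rewrite [X in normc X](_ : _ = (F (c t + w) - F (c t) - l * w) +
  l * (c (t + h) - c t - m * h%:C)); last by rewrite /w/=; ring.
rewrite (le_trans (le_normcD _ _))// [X in _ <= X * _]splitr mulrDl lerD//.
  rewrite (le_trans (Fz _ wr))//.
  apply: (@le_trans _ _ (K * (L * `|h|) ^+ 2)).
    by rewrite ler_wpM2l// lerXn2r// nnegrE ?normc_ge0// mulr_ge0// ltW.
  rewrite exprMn [`|h| ^+ 2]expr2 !mulrA ler_wpM2r//.
  by rewrite (le_trans _ hK)//; have := normr_ge0 h; lra.
rewrite normcM (le_trans (ler_wpM2l (normc_ge0 _) H1))// mulrA ler_wpM2r//.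
rewrite /e1 mulrCA ger_pMr ?divr_gt0// ler_pdivrMr// mul1r lerDl//.
Unshelve. all: by end_near. Qed.

End complex_differentiability.

(** * Mean value and Taylor inequalities on half-planes *)

Section topology_link.
Context {R : realType}.
Implicit Types (F : R[i] -> R[i]) (z w l : R[i]).

Lemma normC_def z : `|z| = (normc z)%:C. Proof. by []. Qed.

Lemma cdiff_derivable F z l : cdiff F z l ->
  derivable (F : R[i]^o -> R[i]^o) z 1.
Proof.
move=> [K [r [K0 r0 Fz]]]; apply/cvg_ex; exists l; apply/cvgrPdist_le => e e0.
have [Re0 Ee] : 0 < Re e /\ e = (Re e)%:C.
  move: e0; rewrite ltcE => /andP[/eqP/= i0 re0]; split=> //.
  by apply: complexP.
pose d := Num.min r (Re e / (K + 1)).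
have K1 : 0 < K + 1 by rewrite ltr_wpDl.
have d0 : 0 < d by rewrite lt_min r0 divr_gt0.
near=> h.
have h0 : h != 0 by near: h; exact: nbhs_dnbhs_neq.
have hd : normc h <= d.
  rewrite -lecR -normC_def; near: h.
  by apply: (dnbhs0_le (V := R[i]^o)); rewrite ltcR.
move: hd; rewrite le_min => /andP[hr]; rewrite ler_pdivlMr// => hK.
rewrite Ee normC_def lecR /GRing.scale/= mulr1 [h + z]addrC.
rewrite normcB [X in normc X](_ : _ = h^-1 * (F (z + h) - F z - l * h)); last first.
  by field.
rewrite normcM normcV mulrC ler_pdivrMr ?normc_gt0//.
rewrite (le_trans (Fz _ hr))// expr2 mulrA ler_wpM2r ?normc_ge0//.
by rewrite (le_trans _ hK)// mulrDr mulr1 mulrC lerDl normc_ge0.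
Unshelve. all: by end_near. Qed.

Lemma near_Re_gt0 z : 0 < Re z -> \forall v \near (z : R[i]^o), 0 < Re v.
Proof.
move=> z0; apply/(nbhs0P (V := R[i]^o)); near=> h.
have : normc h <= Re z / 2.
  rewrite -lecR -normC_def; near: h.
  by apply: (nbhs0_le (V := R[i]^o)); rewrite ltcR divr_gt0.
rewrite ReD => /(le_trans (ler_Re h))/ler_normlP[? ?]; lra.
Unshelve. all: by end_near. Qed.

End topology_link.

Section half_plane.
Context {R : realType}.
Implicit Types (F : R[i] -> R[i]) (z w l : R[i]) (a M t : R).

Lemma is_cderive1_segment F z w t l : cdiff F (z + t%:C * w) l ->
  is_cderive1 (fun s : R => F (z + s%:C * w)) t (l * w).
Proof.
move=> dF; apply: (@cdiff_curve _ F (fun s => z + s%:C * w)) => //.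
move=> e e0; near=> h; rewrite [X in normc X](_ : _ = 0).
  by rewrite normc0 mulr_ge0// ltW.
by rewrite RCD; ring.
Unshelve. all: by end_near. Qed.

Lemma half_plane_segment a z w t : a <= Re z -> a <= Re (z + w) ->
  0 <= t <= 1 -> a <= Re (z + t%:C * w).
Proof. by rewrite !RIE/= mul0r subr0 => ? ? /andP[? ?]; nra. Qed.

Lemma half_plane_MVT F F1 a M z w :
  (forall s, a <= Re s -> cdiff F s (F1 s)) ->
  (forall s, a <= Re s -> normc (F1 s) <= M) ->
  a <= Re z -> a <= Re (z + w) ->
  normc (F (z + w) - F z) <= 2 * (M * normc w).
Proof.
move=> dF FM az azw.
have := @cMVT R (fun s : R => F (z + s%:C * w)) (fun s : R => F1 (z + s%:C * w) * w)
  (M * normc w).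
rewrite mul1r mul0r addr0; apply => t t01.
  by apply: is_cderive1_segment; apply/dF/half_plane_segment.
by rewrite normcM ler_wpM2r ?normc_ge0// FM// half_plane_segment.
Qed.

Lemma half_plane_taylor F F1 F2 a M z w :
  (forall s, a <= Re s -> cdiff F s (F1 s)) ->
  (forall s, a <= Re s -> cdiff F1 s (F2 s)) ->
  (forall s, a <= Re s -> normc (F2 s) <= M) ->
  a <= Re z -> a <= Re (z + w) ->
  normc (F (z + w) - F z - F1 z * w) <= 4 * (M * normc w ^+ 2).
Proof.
move=> dF dF1 FM az azw.
have M0 : 0 <= M by rewrite (le_trans (normc_ge0 _) (FM _ az)).
have := @cMVT R (fun s : R => F (z + s%:C * w) - s%:C * (F1 z * w))
  (fun s : R => F1 (z + s%:C * w) * w - F1 z * w) (2 * (M * normc w ^+ 2)).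
rewrite !mul1r !mul0r addr0 subr0 addrAC => H; apply: le_trans (H _ _) _; last lra.
- move=> t t01; apply: is_cderive1B; last exact: is_cderive1Z.
  by apply: is_cderive1_segment; apply/dF/half_plane_segment.
move=> t t01; rewrite -mulrBl normcM.
rewrite (_ : 2 * _ = 2 * (M * normc w) * normc w); last by ring.
rewrite ler_wpM2r ?normc_ge0// (le_trans (half_plane_MVT dF1 FM _ _))//.
  exact: half_plane_segment.
case/andP: t01 => t0 t1.
by rewrite normcZ// ler_wpM2l// ler_wpM2l// ler_piMl// normc_ge0.
Qed.

End half_plane.

(** * Integration of complex-valued functions *)

Section complex_integral.
Context {R : realType} d (T : measurableType d) (mu : {measure set T -> \bar R}).
Variables (D : set T) (mD : measurable D).
Implicit Types (F G : T -> R[i]) (g : T -> R).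

Lemma integrableRZ (k : R) g : mu.-integrable D (EFin \o g) ->
  mu.-integrable D (EFin \o (fun x => k * g x)).
Proof.
by move=> /(integrableZl mD k); apply: eq_integrable => // x _ /=; rewrite EFinM.
Qed.

Lemma cintegrable_le F g :
  measurable_fun D (fun x => Re (F x)) -> measurable_fun D (fun x => Im (F x)) ->
  mu.-integrable D (EFin \o g) -> (forall x, D x -> normc (F x) <= g x) ->
  cintegrable mu D F.
Proof.
move=> mr mi ig Fg.
have le (p : R[i] -> R) : (forall z, `|p z| <= normc z) ->
    measurable_fun D (fun x => p (F x)) ->
    mu.-integrable D (fun x => (p (F x))%:E).
  move=> pn mp; apply: (le_integrable mD _ _ ig).
    exact/measurable_EFinP.
  move=> x Dx /=; rewrite lee_fin (le_trans (pn _))// (le_trans (Fg _ Dx))//.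
  exact: ler_norm.
by split; [apply: (le (@complex.Re R)) => //; exact: ler_Re|
           apply: (le (@complex.Im R)) => //; exact: ler_Im].
Qed.

Lemma eq_cintegral F G : (forall x, D x -> F x = G x) ->
  cintegral mu D F = cintegral mu D G.
Proof.
move=> FG; rewrite /cintegral; congr (_ +i* _); apply: eq_Rintegral => x;
by rewrite inE => /FG ->.
Qed.

Lemma eq_cintegrable F G : (forall x, D x -> F x = G x) ->
  cintegrable mu D F -> cintegrable mu D G.
Proof.
move=> FG [r i]; split; [move: r|move: i]; apply: eq_integrable => // x;
by rewrite inE => /FG ->.
Qed.

Lemma cintegrableD F G : cintegrable mu D F -> cintegrable mu D G ->
  cintegrable mu D (fun x => F x + G x).
Proof.
move=> [fr fi] [gr gi]; split.
  rewrite (_ : (fun x => _) = (fun x => (Re (F x))%:E) \+ (fun x => (Re (G x))%:E))%E.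
    exact: integrableD.
  by apply/funext => x; rewrite ReD EFinD.
rewrite (_ : (fun x => _) = (fun x => (Im (F x))%:E) \+ (fun x => (Im (G x))%:E))%E.
  exact: integrableD.
by apply/funext => x; rewrite ImD EFinD.
Qed.

Lemma cintegralD F G : cintegrable mu D F -> cintegrable mu D G ->
  cintegral mu D (fun x => F x + G x) = cintegral mu D F + cintegral mu D G.
Proof.
move=> [fr fi] [gr gi]; rewrite /cintegral; apply: complexP; rewrite RIE/=.
  by under eq_Rintegral do rewrite ReD; exact: RintegralD.
by under eq_Rintegral do rewrite ImD; exact: RintegralD.
Qed.

Lemma cintegrableZ (k : R[i]) F : cintegrable mu D F ->
  cintegrable mu D (fun x => k * F x).
Proof.
move=> [fr fi]; split.
  rewrite (_ : (fun x => _) = (fun x => (Re k)%:E * (Re (F x))%:E) \-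
     (fun x => (Im k)%:E * (Im (F x))%:E))%E.
    by apply: integrableB => //; exact: integrableZl.
  by apply/funext => x; rewrite ReMc EFinB !EFinM.
rewrite (_ : (fun x => _) = (fun x => (Re k)%:E * (Im (F x))%:E) \+
   (fun x => (Im k)%:E * (Re (F x))%:E))%E.
  by apply: integrableD => //; exact: integrableZl.
by apply/funext => x; rewrite ImMc EFinD !EFinM.
Qed.

Lemma cintegralZ (k : R[i]) F : cintegrable mu D F ->
  cintegral mu D (fun x => k * F x) = k * cintegral mu D F.
Proof.
move=> [fr fi]; rewrite /cintegral; apply: complexP; rewrite ?RIE/=.
  under eq_Rintegral do rewrite ReMc.
  by rewrite RintegralB ?RintegralZl//; exact: integrableRZ.
under eq_Rintegral do rewrite ImMc.
by rewrite RintegralD ?RintegralZl//; exact: integrableRZ.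
Qed.

Lemma cintegrableB F G : cintegrable mu D F -> cintegrable mu D G ->
  cintegrable mu D (fun x => F x - G x).
Proof.
move=> iF /(cintegrableZ (-1)); under eq_fun do rewrite mulN1r.
exact: cintegrableD.
Qed.

Lemma cintegralB F G : cintegrable mu D F -> cintegrable mu D G ->
  cintegral mu D (fun x => F x - G x) = cintegral mu D F - cintegral mu D G.
Proof.
move=> iF iG; have := cintegralD iF (cintegrableZ (-1) iG).
by rewrite cintegralZ// mulN1r; under eq_fun do rewrite mulN1r.
Qed.

Lemma normc_cintegral_le F g : cintegrable mu D F ->
  mu.-integrable D (EFin \o g) -> (forall x, D x -> normc (F x) <= g x) ->
  normc (cintegral mu D F) <= 2 * \int[mu]_(x in D) g x.
Proof.
move=> [fr fi] ig Fg; rewrite (le_trans (normc_le _))// mulrDl mul1r lerD//=.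
  rewrite (le_trans (le_normr_Rintegral mD fr))// le_Rintegral//.
    exact: integrable_norm.
  by move=> x Dx; rewrite (le_trans (ler_Re _))// Fg.
rewrite (le_trans (le_normr_Rintegral mD fi))// le_Rintegral//.
  exact: integrable_norm.
by move=> x Dx; rewrite (le_trans (ler_Im _))// Fg.
Qed.

End complex_integral.

Section complex_FTC.
Context {R : realType}.
Notation mu := (@lebesgue_measure R).
Implicit Types (a b t : R) (F f : R -> R[i]).

Lemma Rintegral_FTC (F f : R -> R) a b : a < b ->
  {within `[a, b], continuous F} -> {within `[a, b], continuous f} ->
  (forall t, a < t < b -> is_derive t (1 : R) F (f t)) ->
  \int[mu]_(x in `[a, b]) f x = F b - F a.
Proof.
move=> ab cF cf dF; rewrite /Rintegral (continuous_FTC2 ab cf (F := F))//.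
  have [_ cFa cFb] := (continuous_within_itvP _ ab).1 cF.
  split => // t; rewrite in_itv/= => tab; exact: (@ex_derive _ _ _ _ _ _ _ (dF t tab)).
move=> t; rewrite in_itv/= => tab; rewrite derive1E.
exact: (@derive_val _ _ _ _ _ _ _ (dF t tab)).
Qed.

Lemma cintegral_FTC F f a b : a < b ->
  {within `[a, b], continuous (fun t => Re (F t))} ->
  {within `[a, b], continuous (fun t => Im (F t))} ->
  {within `[a, b], continuous (fun t => Re (f t))} ->
  {within `[a, b], continuous (fun t => Im (f t))} ->
  (forall t, a < t < b -> is_cderive1 F t (f t)) ->
  cintegral mu `[a, b] f = F b - F a.
Proof.
move=> ab rF iF rf jf dF; apply: complexP; rewrite ?RIE/=.
  by apply: (Rintegral_FTC ab rF) => // t /dF/is_cderive1P[].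
by apply: (Rintegral_FTC ab iF) => // t /dF/is_cderive1P[].
Qed.

Lemma cintegrable_continuous f a b :
  {within `[a, b], continuous (fun t => Re (f t))} ->
  {within `[a, b], continuous (fun t => Im (f t))} ->
  cintegrable mu `[a, b] f.
Proof.
by move=> cr ci; split; apply: continuous_compact_integrable => //;
  exact: segment_compact.
Qed.

Lemma is_cderive1_within f a b :
  (forall t, a <= t <= b -> exists l, is_cderive1 f t l) ->
  {within `[a, b], continuous (fun t => Re (f t))} /\
  {within `[a, b], continuous (fun t => Im (f t))}.
Proof.
by move=> df; split; apply: continuous_in_subspaceT => t; rewrite inE/= in_itv/= =>
  /df[l /is_cderive1_continuous[]].
Qed.

Lemma cintegral_FTC_closed F f a b : a <= b ->
  (forall t, a <= t <= b -> is_cderive1 F t (f t)) ->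
  (forall t, a <= t <= b -> exists l, is_cderive1 f t l) ->
  cintegrable mu `[a, b] f /\ cintegral mu `[a, b] f = F b - F a.
Proof.
move=> ab dF df.
have [rF iF] : {within `[a, b], continuous (fun t => Re (F t))} /\
  {within `[a, b], continuous (fun t => Im (F t))}.
  by apply: is_cderive1_within => t /dF ?; exists (f t).
have [rf jf] := is_cderive1_within df.
split; first exact: cintegrable_continuous.
move: ab; rewrite le_eqVlt => /predU1P[<-|ab].
  rewrite subrr /cintegral set_itv1; apply: complexP => /=; exact: Rintegral_set1.
apply: cintegral_FTC => // t /andP[at0 tb]; apply: dF; lra.
Qed.

End complex_FTC.

#[local] Arguments cexp : simpl never.
#[local] Arguments normc : simpl never.
#[local] Arguments log0 : simpl never.

(** * Bernstein functions on the right half-plane *)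

Section bernstein_like.
Context {R : realType}.
Implicit Types (f : R[i] -> R[i]) (z : R[i]) (a : R).

(** The properties of f and of its derivatives f1, f2 on which Stirling's
   formula rests; they hold for the identity and for nonzero Bernstein
   functions.  The last one, a consequence of concavity, bounds a variance. *)
Record bernstein_like f f1 f2 : Prop := BernsteinLike {
  bl_real : forall a, 0 < a -> Im (f a%:C) = 0;
  bl_gt0 : forall a, 0 < a -> 0 < Re (f a%:C);
  bl_Re : forall z, 0 < Re z -> Re (f (Re z)%:C) <= Re (f z);
  bl_cdiff : forall z, 0 < Re z -> cdiff f z (f1 z);
  bl_cdiff1 : forall z, 0 < Re z -> cdiff f1 z (f2 z);
  bl_cdiff2 : forall z, 0 < Re z -> exists l, cdiff f2 z l;
  bl_bound1 : forall z, 0 < Re z ->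
    Re z * normc (f1 z) <= 2 * Re (f (Re z)%:C);
  bl_bound2 : forall z, 0 < Re z ->
    Re z ^+ 2 * normc (f2 z) <= 4 * Re (f (Re z)%:C);
  bl_step : forall a, 0 < a -> a * Re (f (a + 1)%:C) <= (a + 1) * Re (f a%:C) }.

Lemma bernstein_like_id : bernstein_like id (fun=> 1) (fun=> 0).
Proof.
split => //.
- by move=> z _; exact: cdiff_id.
- by move=> z _; exact: cdiff_cst.
- by move=> z _; exists 0; exact: cdiff_cst.
- by move=> z z0; rewrite normc1 mulr1 ler_peMl ?ler1n// ltW.
- by move=> z z0; rewrite normc0 mulr0 mulr_ge0// ltW.
- by move=> a a0; rewrite /= mulrC.
Qed.

End bernstein_like.

Section laplace_kernel.
Context {R : realType}.
Variable mu : {measure set (measurableTypeR R) -> \bar R}.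
Hypothesis mu_fin : (\int[mu]_(y in `]0%R, +oo[) (Num.min y 1)%:E < +oo)%E.
Notation D := (`]0%R, +oo[%classic : set (measurableTypeR R)).
Implicit Types (z w : R[i]) (y a b : R) (k : nat).

Let mD : measurable D. Proof. exact: measurable_itv. Qed.

Let D_gt0 y : D y -> 0 < y. Proof. by rewrite /= in_itv/= andbT. Qed.

(** Up to the sign (-1) ^ k, the k-th derivative of exp (- z y) in z. *)
Definition laplace_ker k z y : R[i] := (y ^+ k)%:C * cexp (- (z * y%:C)).

Lemma normc_laplace_ker k z y : 0 <= y ->
  normc (laplace_ker k z y) = y ^+ k * expR (- (Re z * y)).
Proof.
move=> y0; rewrite normcM normcR normc_cexp ger0_norm ?exprn_ge0//.
by rewrite !RIE/= mulr0 subr0.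
Qed.

Lemma laplace_ker_real k a y : laplace_ker k a%:C y = (y ^+ k * expR (- (a * y)))%:C.
Proof. by rewrite /laplace_ker -RCM -(rmorphN (real_complex R)) cexpR -RCM. Qed.

Lemma measurable_laplace_ker k z :
  measurable_fun D (fun y => Re (laplace_ker k z y)) /\
  measurable_fun D (fun y => Im (laplace_ker k z y)).
Proof.
have E y : cexp (- (z * y%:C)) = cexp (y%:C * - z) by congr cexp; ring.
have cd y := is_cderive1_continuous (is_cderive1_cexp (- z) y).
have mk : measurable_fun D (fun y : R => y ^+ k) by exact: measurable_funX.
have mcexp p : (forall y : R, {for y, continuous (fun s : R => p (cexp (s%:C * - z)))}) ->
    measurable_fun D (fun y : R => y ^+ k * p (cexp (y%:C * - z))).
  move=> cp; apply: measurable_funM => //.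
  by apply: measurable_funS (continuous_measurable_fun _) => // y; exact: cp.
split.
  have -> : (fun y : R => Re (laplace_ker k z y)) =
      (fun y => y ^+ k * Re (cexp (y%:C * - z))).
    by apply/funext => y; rewrite /laplace_ker ReMc mul0r subr0 E.
  by apply: mcexp => y; exact: (cd y).1.
have -> : (fun y : R => Im (laplace_ker k z y)) =
    (fun y => y ^+ k * Im (cexp (y%:C * - z))).
  by apply/funext => y; rewrite /laplace_ker ImMc mul0r addr0 E.
by apply: mcexp => y; exact: (cd y).2.
Qed.

Lemma integrable_min : mu.-integrable D (EFin \o (fun y => Num.min y 1)).
Proof.
apply/integrableP; split.
  by apply/measurable_EFinP; apply: measurable_minr.
under eq_integral => y.
  rewrite inE/= in_itv/= andbT => y0.
  rewrite ger0_norm; last by rewrite le_min ler01 ltW.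
  over.
exact: mu_fin.
Qed.

(** min (y, 1) is the only weight that the Levy measure is assumed to integrate. *)
Lemma pow_exp_le k b : 0 < b ->
  exists2 C, 0 <= C & forall y, 0 < y ->
    y ^+ k.+1 * expR (- (b * y)) <= C * Num.min y 1.
Proof.
move=> b0; pose C0 := (k.+1)`!%:R / b ^+ k.+1.
have C00 : 0 <= C0 by rewrite divr_ge0// exprn_ge0// ltW.
exists (1 + C0); first by rewrite addr_ge0.
move=> y y0; have by0 : 0 < b * y by rewrite mulr_gt0.
have [y1|y1] := leP y 1.
  apply: (@le_trans _ _ y); last by rewrite ler_peMl ?(ltW y0)// lerDl.
  rewrite exprS -mulrA ler_piMr ?(ltW y0)//.
  rewrite mulr_ile1 ?exprn_ge0 ?expR_ge0 ?exprn_ile1 ?(ltW y0)//.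
  by rewrite expR_le1 oppr_le0 ltW.
rewrite mulr1; apply: (@le_trans _ _ C0); last by rewrite lerDr.
rewrite expRN ler_pdivrMr ?expR_gt0//.
have := @expR_ge1Dxn R (b * y) k (ltW by0).
rewrite /C0 => H; rewrite mulrAC ler_pdivlMr ?exprn_gt0//.
rewrite -exprMn [y * b]mulrC [leRHS]mulrC -ler_pdivrMr ?ltr0n ?fact_gt0//.
by rewrite (le_trans _ H)// lerDr.
Qed.

Lemma integrable_pow_exp k b : 0 < b ->
  mu.-integrable D (EFin \o (fun y => y ^+ k.+1 * expR (- (b * y)))).
Proof.
move=> b0; have [C C0 HC] := pow_exp_le k b0.
apply: (le_integrable mD _ _ (integrableRZ mD C integrable_min)).
  apply/measurable_EFinP; have [+ _] := measurable_laplace_ker k.+1 b%:C.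
  apply: eq_measurable_fun => y _; by rewrite laplace_ker_real.
move=> y /D_gt0 y0; rewrite lee_fin/=.
rewrite ger0_norm ?mulr_ge0 ?exprn_ge0 ?expR_ge0 ?(ltW y0)//.
by rewrite (le_trans (HC _ y0))// ler_norm.
Qed.

Lemma cintegrable_laplace_ker k z : 0 < Re z ->
  cintegrable mu D (laplace_ker k.+1 z).
Proof.
move=> z0; have [mr mi] := measurable_laplace_ker k.+1 z.
apply: (cintegrable_le mD mr mi (integrable_pow_exp k z0)).
move=> y /D_gt0 y0.
by rewrite normc_laplace_ker// ltW.
Qed.

Lemma cintegrable_levy z : 0 <= Re z ->
  cintegrable mu D (fun y => 1 - cexp (- (z * y%:C))).
Proof.
move=> z0; have [mr mi] := measurable_laplace_ker 0 z.
have E y : 1 - cexp (- (z * y%:C)) = 1 - laplace_ker 0 z y.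
  by rewrite /laplace_ker expr0 mul1r.
pose C := 2 * (normc z * expR (normc z)) + 2.
apply: (cintegrable_le mD _ _ (integrableRZ mD C integrable_min)).
- apply: (eq_measurable_fun (fun y => 1 - Re (laplace_ker 0 z y))).
    by move=> y _; rewrite E ReB.
  exact: measurable_funB.
- apply: (eq_measurable_fun (fun y => 0 - Im (laplace_ker 0 z y))).
    by move=> y _; rewrite E ImB.
  exact: measurable_funB.
move=> y /D_gt0 y0; have y0' := ltW y0.
have C1 : 0 <= 2 * (normc z * expR (normc z)).
  by rewrite !mulr_ge0 ?expR_ge0 ?normc_ge0.
have [y1|y1] := leP y 1.
  rewrite normcB (le_trans (normc_cexpB1 _))// normcN normcM normcR ger0_norm//.
  apply: (@le_trans _ _ (2 * (normc z * expR (normc z)) * y)).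
    rewrite -!mulrA ler_wpM2l// ler_wpM2l ?normc_ge0// mulrC ler_wpM2r//.
    by rewrite ler_expR ler_piMr ?normc_ge0.
  by rewrite ler_wpM2r// /C lerDl.
rewrite mulr1 (le_trans (le_normcD _ _))// normc1 normcN normc_cexp.
rewrite /C (_ : 1 + _ <= _ = (expR (Re (- (z * y%:C))) <= 2 * (normc z * expR (normc z)) + 1)); last first.
  by rewrite -[RHS](lerD2l 1); congr (_ <= _); ring.
rewrite (@le_trans _ _ 1) ?lerDr// expR_le1 !RIE/= mulr0 subr0 oppr_le0.
by rewrite mulr_ge0.
Qed.

(** Half of the exponential decay absorbs the factor exp (|w| y) coming from
   the Taylor remainder. *)
Lemma laplace_ker_taylor k z w y : 0 < y -> normc w <= Re z / 2 ->
  normc (laplace_ker k (z + w) y - laplace_ker k z y + w * laplace_ker k.+1 z y)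
  <= 4 * normc w ^+ 2 * (y ^+ k.+2 * expR (- (Re z / 2 * y))).
Proof.
move=> y0 wz; have y0' := ltW y0.
rewrite [X in normc X](_ : _ = laplace_ker k z y *
  (cexp (- (w * y%:C)) - 1 - - (w * y%:C))); last first.
  rewrite /laplace_ker mulrDl opprD cexpD exprS RCM; ring.
rewrite normcM normc_laplace_ker//.
apply: (le_trans (ler_wpM2l _ (normc_cexpB1B _))).
  by rewrite mulr_ge0 ?exprn_ge0 ?expR_ge0.
rewrite normcN normcM normcR ger0_norm//.
rewrite (_ : _ * (4 * _) = 4 * normc w ^+ 2 * (y ^+ k.+2 *
  (expR (- (Re z * y)) * expR (normc w * y)))); last by rewrite !exprS; ring.
apply: ler_wpM2l; first by rewrite mulr_ge0// sqr_ge0.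
apply: ler_wpM2l; first by rewrite exprn_ge0.
rewrite -expRD ler_expR; nra.
Qed.

(** Differentiation under the integral sign: the remainder of
   [laplace_ker_taylor] is integrable in y. *)
Lemma cdiff_laplace k z : 0 < Re z ->
  cdiff (fun s => cintegral mu D (laplace_ker k.+1 s)) z
        (- cintegral mu D (laplace_ker k.+2 z)).
Proof.
move=> z0; have z20 : 0 < Re z / 2 by rewrite divr_gt0.
pose I := \int[mu]_(y in D) (y ^+ k.+3 * expR (- (Re z / 2 * y))).
exists (8 * I), (Re z / 2); split => //.
  rewrite mulr_ge0// Rintegral_ge0// => y /D_gt0 y0.
  by rewrite mulr_ge0 ?exprn_ge0 ?expR_ge0 ?(ltW y0).
move=> w wz.
have zw0 : 0 < Re (z + w).
  by have /ler_normlP[? ?] := le_trans (ler_Re w) wz; rewrite ReD; lra.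
have i1 := cintegrable_laplace_ker k zw0.
have i2 := cintegrable_laplace_ker k z0.
have i3 := cintegrable_laplace_ker k.+1 z0.
rewrite mulNr opprK [_ * w]mulrC -cintegralB// -cintegralZ//.
rewrite -cintegralD//; last 2 first.
- exact: cintegrableB.
- exact: cintegrableZ.
rewrite (_ : 8 * I * _ = 2 * (4 * normc w ^+ 2 * I)); last by ring.
rewrite -RintegralZl//; last exact: integrable_pow_exp.
apply: normc_cintegral_le => //.
- by apply: cintegrableD => //; [exact: cintegrableB|exact: cintegrableZ].
- by apply: integrableRZ => //; exact: integrable_pow_exp.
- move=> y /D_gt0 y0; exact: laplace_ker_taylor.
Qed.

Lemma cdiff_levy z : 0 < Re z ->
  cdiff (fun s => cintegral mu D (fun y => 1 - cexp (- (s * y%:C)))) z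
        (cintegral mu D (laplace_ker 1 z)).
Proof.
move=> z0; have z20 : 0 < Re z / 2 by rewrite divr_gt0.
pose I := \int[mu]_(y in D) (y ^+ 2 * expR (- (Re z / 2 * y))).
exists (8 * I), (Re z / 2); split => //.
  rewrite mulr_ge0// Rintegral_ge0// => y /D_gt0 y0.
  by rewrite mulr_ge0 ?exprn_ge0 ?expR_ge0 ?(ltW y0).
move=> w wz.
have zw0 : 0 < Re (z + w).
  by have /ler_normlP[? ?] := le_trans (ler_Re w) wz; rewrite ReD; lra.
have i1 := cintegrable_levy (ltW zw0).
have i2 := cintegrable_levy (ltW z0).
have i3 := cintegrable_laplace_ker 0 z0.
rewrite [_ * w]mulrC -cintegralB// -cintegralZ//.
rewrite -cintegralB//; last 2 first.
- exact: cintegrableB.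
- exact: cintegrableZ.
rewrite (_ : 8 * I * _ = 2 * (4 * normc w ^+ 2 * I)); last by ring.
rewrite -RintegralZl//; last exact: integrable_pow_exp.
apply: normc_cintegral_le => //.
- by apply: cintegrableB => //; [exact: cintegrableB|exact: cintegrableZ].
- by apply: integrableRZ => //; exact: integrable_pow_exp.
- move=> y /D_gt0 y0.
  have := @laplace_ker_taylor 0 z w y y0 wz.
  rewrite -normcN; congr (_ <= _); congr normc.
  by rewrite /laplace_ker expr0; ring.
Qed.

End laplace_kernel.

Section bernstein_functions.
Context {R : realType}.
Variables (q d : R) (mu : {measure set (measurableTypeR R) -> \bar R}).
Hypotheses (q_ge0 : 0 <= q) (d_ge0 : 0 <= d).
Hypothesis mu_fin : (\int[mu]_(y in `]0%R, +oo[) (Num.min y 1)%:E < +oo)%E.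
Variable phi : R[i] -> R[i].
Notation D := (`]0%R, +oo[%classic : set (measurableTypeR R)).
Hypothesis phiE : forall z, 0 <= Re z -> phi z = q%:C + d%:C * z +
  cintegral mu D (fun y => 1 - cexp (- (z * y%:C))).
Hypothesis phi_neq0 : exists2 z : R[i], 0 <= Re z & phi z != 0.
Implicit Types (z : R[i]) (y a : R).

Let mD : measurable D. Proof. exact: measurable_itv. Qed.

Let D_gt0 y : D y -> 0 < y. Proof. by rewrite /= in_itv/= andbT. Qed.

Let levy a : R := \int[mu]_(y in D) (1 - expR (- (a * y))).

Let levy_integrand a y : 1 - cexp (- (a%:C * y%:C)) = (1 - expR (- (a * y)))%:C.
Proof. by rewrite -RCM -(rmorphN (real_complex R)) cexpR RCB. Qed.

Let integrable_levy a : 0 <= a ->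
  mu.-integrable D (EFin \o (fun y => 1 - expR (- (a * y)))).
Proof.
move=> a0; have [+ _] := cintegrable_levy mu_fin (z := a%:C) a0.
by apply: eq_integrable => // y _; rewrite [in RHS]/= -[RHS]/(_%:E) -[1 - expR _]/(Re (1 - expR (- (a * y)))%:C) -levy_integrand.
Qed.

Let phi_real a : 0 <= a -> phi a%:C = (q + d * a + levy a)%:C.
Proof.
move=> a0; rewrite phiE// !RCD RCM; congr (_ + _).
rewrite /cintegral /levy; apply: complexP.
  by apply: eq_Rintegral => y _; rewrite levy_integrand.
transitivity (\int[mu]_(y in D) (0 : R)); last by rewrite /Rintegral integral0.
by apply: eq_Rintegral => y _; rewrite levy_integrand.
Qed.

Let levy_ge0 a : 0 <= a -> 0 <= levy a.
Proof.
move=> a0; apply: Rintegral_ge0 => y /D_gt0 y0.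
by rewrite subr_ge0 expR_le1 oppr_le0 mulr_ge0// ltW.
Qed.

(** A Bernstein function vanishing at one point of the positive half-line has
   a null triple (q, d, mu), hence vanishes identically. *)
Let phi_gt0 a : 0 < a -> 0 < q + d * a + levy a.
Proof.
move=> a0; rewrite lt_neqAle !addr_ge0 ?levy_ge0 ?mulr_ge0 ?(ltW a0)// andbT.
apply/eqP => /esym/eqP.
rewrite paddr_eq0 ?addr_ge0 ?mulr_ge0 ?levy_ge0 ?(ltW a0)// paddr_eq0 ?mulr_ge0 ?(ltW a0)//.
move=> /andP[/andP[/eqP q0]]; rewrite mulf_eq0 (gt_eqF a0) orbF => /eqP d0 /eqP l0.
have [z0 z00 /negP] := phi_neq0; apply; apply/eqP; rewrite phiE// q0 d0 mul0r !add0r.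
have il := integrable_levy (ltW a0).
have int0 : (\int[mu]_(y in D) `|(1 - expR (- (a * y)))%:E| = 0)%E.
  under eq_integral => y.
    rewrite inE => /D_gt0 y0; rewrite gee0_abs; last first.
      by rewrite lee_fin subr_ge0 expR_le1 oppr_le0 mulr_ge0// ltW.
    over.
  by rewrite -[LHS]fineK ?(integrable_fin_num mD il)//; congr EFin.
have /(ae_eq_integral_abs mu mD (measurable_int _ il))[N [mN N0 DN]] := int0.
have muD0 : mu D = 0%E.
  apply/eqP; rewrite eq_le measure_ge0 andbT -N0; apply: le_measure => //; rewrite ?inE//.
  move=> y Dy; apply: DN => /= /(_ Dy) /= [] /eqP.
  rewrite subr_eq0 eq_sym => /eqP/(congr1 (@ln R)); rewrite expRK ln1 => /eqP.
  by rewrite oppr_eq0 mulf_eq0 (gt_eqF a0) (gt_eqF (D_gt0 Dy)).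
have [ir ii] := cintegrable_levy mu_fin z00.
by apply: complexP; rewrite /cintegral /= /Rintegral null_set_integral//;
  [exact: measurable_int ir|exact: measurable_int ii].
Qed.

(** Integrates x exp (- x) <= 1 - exp (- x). *)
Let pow1_bound a : 0 < a ->
  a * (\int[mu]_(y in D) (y ^+ 1 * expR (- (a * y)))) <= levy a.
Proof.
move=> a0; have ip := integrable_pow_exp mu_fin 0 a0.
rewrite -RintegralZl//; apply: le_Rintegral => //.
- exact: integrableRZ.
- exact: integrable_levy (ltW a0).
move=> y /D_gt0 y0; rewrite expr1 mulrA lerBrDr.
rewrite -[X in _ + X]mul1r -mulrDl addrC expRN ler_pdivrMr ?expR_gt0// mul1r.
exact: expR_ge1Dx.
Qed.

(** Integrates x ^ 2 exp (- x) <= 2 (1 - exp (- x)). *)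
Let pow2_bound a : 0 < a ->
  a ^+ 2 * (\int[mu]_(y in D) (y ^+ 2 * expR (- (a * y)))) <= 2 * levy a.
Proof.
move=> a0; have ip := integrable_pow_exp mu_fin 1 a0.
rewrite -!RintegralZl//; last exact: integrable_levy (ltW a0).
apply: le_Rintegral => //.
- exact: integrableRZ.
- by apply: integrableRZ => //; exact: integrable_levy (ltW a0).
move=> y /D_gt0 y0; rewrite mulrA -exprMn expRN.
have e0 := expR_gt0 (a * y); have ay0 : 0 <= a * y by rewrite mulr_ge0 ?ltW.
rewrite ler_pdivrMr// -mulrA mulrBl mul1r mulVf ?gt_eqF//.
have := expR_ge1Dxn 1 ay0; have -> : (2`!)%:R = 2 :> R by []; move=> ?; lra.
Qed.

(** Each bound reduces to a pointwise inequality between integrands, as the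
   terms q and d z satisfy it separately. *)
Lemma bernstein_like_bernstein : exists f1 f2, bernstein_like phi f1 f2.
Proof.
exists (fun z => d%:C + cintegral mu D (laplace_ker 1 z)),
       (fun z => - cintegral mu D (laplace_ker 2 z)).
have E a (a0 : 0 < a) : Re (phi a%:C) = q + d * a + levy a.
  by rewrite phi_real// ltW.
have Kb k z (z0 : 0 < Re z) : normc (cintegral mu D (laplace_ker k.+1 z)) <=
    2 * \int[mu]_(y in D) (y ^+ k.+1 * expR (- (Re z * y))).
  apply: normc_cintegral_le => //.
  - exact: cintegrable_laplace_ker.
  - exact: integrable_pow_exp.
  - by move=> y /D_gt0 y0; rewrite normc_laplace_ker// ltW.
split.
- by move=> a a0; rewrite phi_real// ltW.
- by move=> a a0; rewrite E// phi_gt0.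
- move=> z z0; rewrite E// phiE ?(ltW z0)// 2!ReD ReMc mul0r subr0 lerD2l.
  have [ir ii] := cintegrable_levy mu_fin (ltW z0).
  apply: (@le_Rintegral _ _ _ mu D (fun y => 1 - expR (- (Re z * y)))
    (fun y => Re (1 - cexp (- (z * y%:C)))) mD (integrable_levy (ltW z0)) ir).
  move=> y /D_gt0 y0; rewrite ReB lerB//.
  rewrite (le_trans (ler_norm _))// (le_trans (ler_Re _))// normc_cexp.
  by rewrite !RIE/= mulr0 subr0.
- move=> z z0; apply: (cdiff_Re_gt0 z0 (F := fun z => q%:C + d%:C * z +
    cintegral mu D (fun y => 1 - cexp (- (z * y%:C))))).
    by move=> s s0; rewrite phiE// ltW.
  have := cdiffD (cdiff_cst q%:C z) (cdiffZ d%:C (cdiff_id z)).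
  by rewrite mulr1 add0r => dl; apply: cdiffD dl _; exact: cdiff_levy.
- move=> z z0; rewrite -[X in cdiff _ _ X]add0r.
  by apply: cdiffD; [exact: cdiff_cst|exact: cdiff_laplace].
- by move=> z z0; eexists; apply: cdiffN; exact: cdiff_laplace.
- move=> z z0; rewrite E//.
  have H2 : normc (cintegral mu D (laplace_ker 1 z)) <=
    2 * \int[mu]_(y in D) (y ^+ 1 * expR (- (Re z * y))) := Kb 0%N z z0.
  have H1 := pow1_bound z0.
  have I0 : 0 <= Re z * normc (cintegral mu D (laplace_ker 1 z)) <= 2 * levy (Re z).
    rewrite mulr_ge0 ?normc_ge0 ?(ltW z0)//=.
    apply: (le_trans (ler_wpM2l (ltW z0) H2)); rewrite mulrCA; lra.
  apply: (le_trans (ler_wpM2l (ltW z0) (le_normcD _ _))).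
  rewrite normcR ger0_norm// mulrDr; move: I0 => /andP[_ I0].
  apply: (le_trans (lerD (lexx _) I0)).
  rewrite mulrDr lerD2r mulrC [leRHS]mulrDr.
  have := mulr_ge0 d_ge0 (ltW z0); set X := d * Re z => X0; move: q_ge0 => ?; lra.
- move=> z z0; rewrite E// normcN.
  have H2 : normc (cintegral mu D (laplace_ker 2 z)) <=
    2 * \int[mu]_(y in D) (y ^+ 2 * expR (- (Re z * y))) := Kb 1%N z z0.
  have H1 := pow2_bound z0.
  apply: (le_trans (ler_wpM2l (sqr_ge0 _) H2)); rewrite mulrCA.
  have := mulr_ge0 d_ge0 (ltW z0); move: q_ge0 => ? ?; lra.
- move=> a a0; have a1 : 0 < a + 1 by rewrite addr_gt0.
  rewrite !E//.
  suff : a * levy (a + 1) <= (a + 1) * levy a by move: q_ge0 => ? ?; lra.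
  have i1 := integrable_levy (ltW a1); have i0 := integrable_levy (ltW a0).
  rewrite /levy -!RintegralZl//; apply: le_Rintegral => //; [exact: integrableRZ|exact: integrableRZ|].
  move=> y /D_gt0 y0; rewrite mulrDl mul1r opprD expRD.
  have e0 := expR_gt0 (- (a * y)); have := expR_ge1Dx (- y).
  have ay1 : 1 + a * y <= expR (a * y) by exact: expR_ge1Dx.
  have : a * y * expR (- (a * y)) <= 1 - expR (- (a * y)).
    rewrite lerBrDr -[X in _ + X]mul1r -mulrDl addrC expRN.
    by rewrite ler_pdivrMr ?expR_gt0// mul1r.
  set e := expR (- (a * y)); set s := expR (- y) => h1 h2.
  have : a * e * (1 - y) <= a * e * s by rewrite ler_wpM2l ?mulr_ge0// ltW.
  lra.
Qed.

End bernstein_functions.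

(** * Logarithms of Bernstein functions and their primitives *)

Section tame.
Context {R : realType}.
Implicit Types (h f : R[i] -> R[i]) (z w : R[i]) (a K : R).

(** The decay of the first two derivatives that makes the Euler-Maclaurin
   remainders converge, uniformly on vertical lines; it passes to differences,
   hence from log0 and log0 o phi to log0 o phi_star. *)
Record tame h h1 h2 K : Prop := Tame {
  tame_ge0 : 0 <= K;
  tame_cdiff : forall z, 0 < Re z -> cdiff h z (h1 z);
  tame_cdiff1 : forall z, 0 < Re z -> cdiff h1 z (h2 z);
  tame_cdiff2 : forall z, 0 < Re z -> exists l, cdiff h2 z l;
  tame_bound1 : forall z, 0 < Re z -> normc (h1 z) <= K / Re z;
  tame_bound2 : forall z, 0 < Re z -> normc (h2 z) <= K / Re z ^+ 2 }.

Lemma tameB h h1 h2 K k k1 k2 K' : tame h h1 h2 K -> tame k k1 k2 K' ->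
  tame (fun z => h z - k z) (fun z => h1 z - k1 z) (fun z => h2 z - k2 z) (K + K').
Proof.
move=> [K0 dh dh1 dh2 b1 b2] [K0' dk dk1 dk2 b1' b2']; split.
- exact: addr_ge0.
- by move=> z z0; apply: cdiffB; [exact: dh|exact: dk].
- by move=> z z0; apply: cdiffB; [exact: dh1|exact: dk1].
- move=> z z0; have [l Hl] := dh2 z z0; have [m Hm] := dk2 z z0.
  by exists (l - m); exact: cdiffB.
- move=> z z0; rewrite (le_trans (le_normcD _ _))// normcN mulrDl lerD//.
    exact: b1.
  exact: b1'.
- move=> z z0; rewrite (le_trans (le_normcD _ _))// normcN mulrDl lerD//.
    exact: b2.
  exact: b2'.
Qed.

Section log_bernstein.
Variables f f1 f2 : R[i] -> R[i].
Hypothesis bl : bernstein_like f f1 f2.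

Lemma bl_Re_gt0 z : 0 < Re z -> 0 < Re (f z).
Proof.
by move=> z0; apply: lt_le_trans (bl_Re bl z0); exact: (bl_gt0 bl).
Qed.

Lemma bl_normc z : 0 < Re z -> Re (f (Re z)%:C) <= normc (f z).
Proof.
move=> z0; rewrite (le_trans (bl_Re bl z0))// (le_trans (ler_norm _))//.
exact: ler_Re.
Qed.

(** Quotients by f z are controlled because |f z| >= f (Re z), the quantity that
   bounds the derivatives of f. *)
Lemma tame_log_bernstein : tame (fun z => log0 (f z)) (fun z => f1 z / f z)
  (fun z => f2 z / f z - (f1 z / f z) ^+ 2) 8.
Proof.
have fn0 z (z0 : 0 < Re z) : f z != 0 by exact: Re_gt0_neq0 (bl_Re_gt0 z0).
have d1 z (z0 : 0 < Re z) : cdiff (fun z => f1 z / f z) z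
    (f2 z / f z - (f1 z / f z) ^+ 2).
  have := cdiff_div (fn0 z z0) (bl_cdiff1 bl z0) (bl_cdiff bl z0).
  by rewrite expr_div_n [f1 z ^+ 2]expr2.
have b1 z (z0 : 0 < Re z) : normc (f1 z / f z) <= 2 / Re z.
  have p0 := bl_gt0 bl z0.
  have n0 : 0 < normc (f z) by rewrite normc_gt0 fn0.
  rewrite normcM normcV ler_pdivrMr// mulrAC ler_pdivlMr// mulrC.
  rewrite (le_trans (bl_bound1 bl z0))// ler_wpM2l// bl_normc//.
split => //.
- move=> z z0; rewrite mulrC.
  by apply: (cdiff_comp (bl_cdiff bl z0)); exact: cdiff_log0 (bl_Re_gt0 z0).
- move=> z z0; have [l Hl] := bl_cdiff2 bl z0; eexists; apply: cdiffB.
    exact: cdiff_div (fn0 z z0) Hl (bl_cdiff bl z0).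
  exact: cdiffM (d1 z z0) (d1 z z0).
- move=> z z0; rewrite (le_trans (b1 z z0))// ler_wpM2r ?invr_ge0 ?(ltW z0)//.
  by rewrite ler_nat.
- move=> z z0; have p0 := bl_gt0 bl z0.
  have n0 : 0 < normc (f z) by rewrite normc_gt0 fn0.
  have z20 : 0 < Re z ^+ 2 by rewrite exprn_gt0.
  rewrite [leRHS](_ : _ = 4 / Re z ^+ 2 + 4 / Re z ^+ 2); last by ring.
  rewrite (le_trans (le_normcD _ _))// normcN lerD//.
    rewrite normcM normcV ler_pdivrMr// mulrAC ler_pdivlMr// mulrC.
    by rewrite (le_trans (bl_bound2 bl z0))// ler_wpM2l// bl_normc.
  rewrite (_ : 4 / Re z ^+ 2 = (2 / Re z) ^+ 2); last by rewrite expr_div_n; congr (_ / _); ring.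
  rewrite expr2 normcM -expr2 lerXn2r// ?nnegrE ?normc_ge0 ?b1//.
  by rewrite divr_ge0// ltW.
Qed.

End log_bernstein.

End tame.

Section primitive.
Context {R : realType}.
Notation mu := (@lebesgue_measure R).
Implicit Types (h : R[i] -> R[i]) (z w : R[i]) (t K : R).

Lemma ReZ t w : Re (t%:C * w) = t * Re w.
Proof. by rewrite ReMc mul0r subr0. Qed.

(** The integral of h along the segment from 1 to z. *)
Definition primitive h z : R[i] :=
  (z - 1) * cintegral mu `[0, 1] (fun t : R => h (1 + t%:C * (z - 1))).

Lemma primitive1 h : primitive h 1 = 0.
Proof. by rewrite /primitive subrr mul0r. Qed.

Lemma cdiff_real (F : R[i] -> R[i]) t l : cdiff F t%:C l ->
  is_cderive1 (fun s : R => F s%:C) t l.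
Proof.
move=> dF; rewrite -[l]mulr1; apply: (@cdiff_curve _ F (fun s : R => s%:C)) => //.
move=> e e0; near=> x; rewrite [X in normc X](_ : _ = 0).
  by rewrite normc0 mulr_ge0// ltW.
by rewrite RCD; ring.
Unshelve. all: by end_near. Qed.

Lemma cdiff_affine (F : R[i] -> R[i]) a s u l : cdiff F (a + u * s) l ->
  cdiff (fun v => F (a + v * s)) u (l * s).
Proof.
move=> dF; apply: (@cdiff_comp _ (fun v => a + v * s) F) => //.
have := cdiffD (cdiff_cst a u) (cdiffM (cdiff_id u) (cdiff_cst s u)).
by rewrite mulr0 addr0 mul1r add0r.
Qed.

Lemma segment1_Re z t : 0 < Re z -> 0 <= t <= 1 ->
  Num.min 1 (Re z) <= Re (1 + t%:C * (z - 1)).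
Proof.
move=> z0 /andP[t0 t1].
rewrite ReD ReZ ReB [Re 1]/=.
by rewrite ge_min; apply/orP; have [z1|z1] := leP 1 (Re z); [left|right]; nra.
Qed.

Lemma segment1_Re_gt0 z t : 0 < Re z -> 0 <= t <= 1 -> 0 < Re (1 + t%:C * (z - 1)).
Proof.
by move=> z0 t01; apply: lt_le_trans (segment1_Re z0 t01); rewrite lt_min ltr01.
Qed.

Lemma cintegrable_segment1 h h1 z : (forall s, 0 < Re s -> cdiff h s (h1 s)) ->
  0 < Re z -> cintegrable mu `[0, 1] (fun t : R => h (1 + t%:C * (z - 1))).
Proof.
move=> dh z0; have [|r i] := @is_cderive1_within _
  (fun t : R => h (1 + t%:C * (z - 1))) 0 1.
  move=> t t01; exists (h1 (1 + t%:C * (z - 1)) * (z - 1)).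
  by apply: is_cderive1_segment; exact/dh/segment1_Re_gt0.
exact: cintegrable_continuous.
Qed.

Lemma primitiveB h h1 k k1 z : (forall s, 0 < Re s -> cdiff h s (h1 s)) ->
  (forall s, 0 < Re s -> cdiff k s (k1 s)) -> 0 < Re z ->
  primitive (fun s => h s - k s) z = primitive h z - primitive k z.
Proof.
move=> dh dk z0; rewrite /primitive -mulrBr -cintegralB//.
  exact: cintegrable_segment1 dh z0.
exact: cintegrable_segment1 dk z0.
Qed.

(** Differentiating under the integral sign produces h + t (z - 1) h' at the
   point 1 + t (z - 1), which is the t-derivative of t h (1 + t (z - 1)). *)
Lemma cdiff_primitive h h1 h2 K z : tame h h1 h2 K -> 0 < Re z ->
  cdiff (primitive h) z (h z).
Proof.
move=> [K0 dh dh1 dh2 b1 b2] z0.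
pose s := z - 1.
pose a := Num.min 1 (Re z) / 2.
have m0 : 0 < Num.min 1 (Re z) by rewrite lt_min ltr01.
have a0 : 0 < a by rewrite divr_gt0.
pose M1 := K / a; pose M2 := K / a ^+ 2.
have M10 : 0 <= M1 by rewrite divr_ge0// ltW.
have M20 : 0 <= M2 by rewrite divr_ge0// sqr_ge0.
have Bd1 v : a <= Re v -> normc (h1 v) <= M1.
  move=> av; have v0 := lt_le_trans a0 av.
  by rewrite (le_trans (b1 _ v0))// ler_wpM2l// lef_pV2.
have Bd2 v : a <= Re v -> normc (h2 v) <= M2.
  move=> av; have v0 := lt_le_trans a0 av.
  rewrite (le_trans (b2 _ v0))// ler_wpM2l// lef_pV2 ?posrE ?exprn_gt0//.
  by rewrite lerXn2r// nnegrE ltW.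
have dha v : a <= Re v -> cdiff h v (h1 v) by move=> /(lt_le_trans a0)/dh.
have dh1a v : a <= Re v -> cdiff h1 v (h2 v) by move=> /(lt_le_trans a0)/dh1.
pose A := 4 * M2 * normc s + 2 * M1.
have A0 : 0 <= A by apply: addr_ge0; apply: mulr_ge0 => //; [apply: mulr_ge0|exact: normc_ge0].
exists (2 * A), a; split => //; first by rewrite mulr_ge0.
move=> w wa.
have zt t : 0 <= t <= 1 -> 2 * a <= Re (1 + t%:C * s).
  by move=> t01; rewrite /a mulrC divfK// segment1_Re.
have ztw t : 0 <= t <= 1 -> a <= Re (1 + t%:C * s + t%:C * w).
  move=> t01; have /andP[t0 t1] := t01; have := zt t t01.
  rewrite [Re (_ + t%:C * w)]ReD [Re (t%:C * w)]ReZ.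
  have /ler_normlP[? ?] := le_trans (ler_Re w) wa; nra.
have zt' t : 0 <= t <= 1 -> a <= Re (1 + t%:C * s).
  by move=> /zt; lra.
have zw0 : 0 < Re (z + w).
  have := ztw 1; rewrite lexx ler01 !mul1r => /(_ isT).
  by rewrite /s subrKC => /(lt_le_trans a0).
have Ih := cintegrable_segment1 dh z0.
have Ihw := cintegrable_segment1 dh zw0.
have [Ig Eg] : cintegrable mu `[0, 1]
      (fun t : R => h (1 + t%:C * s) + t%:C * (s * h1 (1 + t%:C * s))) /\
    cintegral mu `[0, 1]
      (fun t : R => h (1 + t%:C * s) + t%:C * (s * h1 (1 + t%:C * s))) = h z.
  have [||] := @cintegral_FTC_closed _ (fun t : R => t%:C * h (1 + t%:C * s))
    (fun t : R => h (1 + t%:C * s) + t%:C * (s * h1 (1 + t%:C * s))) 0 1 ler01.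
  - move=> t /zt' at0.
    have := @cdiff_real (fun u => u * h (1 + u * s)) t _
      (cdiffM (cdiff_id t%:C) (cdiff_affine (dha _ at0))).
    by rewrite mul1r [h1 _ * s]mulrC.
  - move=> t /zt' at0; eexists.
    apply: (@cdiff_real (fun u => h (1 + u * s) + u * (s * h1 (1 + u * s)))).
    apply: cdiffD; first exact: cdiff_affine (dha _ at0).
    apply: cdiffM; first exact: cdiff_id.
    by apply: cdiffZ; exact: cdiff_affine (dh1a _ at0).
  - by rewrite mul0r subr0 !mul1r /s subrKC.
have Ew t : 1 + t%:C * (z + w - 1) = 1 + t%:C * s + t%:C * w by rewrite /s; ring.
rewrite /primitive -Eg -!cintegralZ// [_ * w]mulrC -cintegralZ//.
have I1 : cintegrable mu `[0, 1]
    (fun t : R => (z + w - 1) * h (1 + t%:C * (z + w - 1))) by exact: cintegrableZ.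
have I2 : cintegrable mu `[0, 1]
    (fun t : R => (z - 1) * h (1 + t%:C * (z - 1))) by exact: cintegrableZ.
have I3 : cintegrable mu `[0, 1] (fun t : R =>
    w * (h (1 + t%:C * s) + t%:C * (s * h1 (1 + t%:C * s)))) by exact: cintegrableZ.
rewrite -cintegralB// -cintegralB//; last exact: cintegrableB.
have -> : 2 * A * normc w ^+ 2 =
    2 * \int[mu]_(t in `[0, 1]) (A * normc w ^+ 2).
  have m1 : fine (lebesgue_measure (`[0, 1]%classic : set R)) = 1.
    by rewrite lebesgue_measure_itv/= lte_fin ltr01 oppr0 adde0.
  rewrite Rintegral_cst//; transitivity (2 * (A * normc w ^+ 2 * 1)); first by ring.
  congr (2 * (_ * _)); exact: esym m1.
apply: normc_cintegral_le => //.
- by apply: cintegrableB => //; exact: cintegrableB.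
- apply: continuous_compact_integrable; first exact: segment_compact.
  by apply: continuous_subspaceT => x; exact: cvg_cst.
move=> t; rewrite /= in_itv/= => t01; have /andP[t0 t1] := t01.
rewrite Ew -/s.
have ntw : normc (t%:C * w) <= normc w.
  by rewrite normcZ// ler_piMl// normc_ge0.
set p := 1 + t%:C * s; set q := t%:C * w in ntw *.
rewrite [X in normc X](_ : _ = s * (h (p + q) - h p - h1 p * q) + w * (h (p + q) - h p));
  last by rewrite /q /s; ring.
have -> : A * normc w ^+ 2 =
    normc s * (4 * (M2 * normc w ^+ 2)) + normc w * (2 * (M1 * normc w)).
  by rewrite /A; ring.
apply: (le_trans (le_normcD _ _)); rewrite !normcM.
apply: lerD; apply: ler_wpM2l; rewrite ?normc_ge0//.
  apply: (le_trans (half_plane_taylor dha dh1a Bd2 (zt' _ t01) (ztw _ t01))).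
  apply: ler_wpM2l => //; apply: ler_wpM2l => //.
  by rewrite lerXn2r// nnegrE normc_ge0.
apply: (le_trans (half_plane_MVT dha Bd1 (zt' _ t01) (ztw _ t01))).
by apply: ler_wpM2l => //; apply: ler_wpM2l.
Qed.

End primitive.

(** * Contour integrals *)

Section within_continuity.
Context {R : realType}.
Implicit Types (c : R -> R[i]) (A : set R) (F : R[i] -> R[i]).

Lemma within_continuous_comp c A F :
  {within A, continuous (fun t => Re (c t))} ->
  {within A, continuous (fun t => Im (c t))} ->
  (forall t, A t -> exists l, cdiff F (c t) l) ->
  {within A, continuous (fun t => Re (F (c t)))} /\
  {within A, continuous (fun t => Im (F (c t)))}.
Proof.
move=> /subspace_continuousP cr /subspace_continuousP ci dF.
have H t : A t -> forall e, 0 < e ->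
    \forall s \near within A (nbhs t), normc (F (c s) - F (c t)) <= e.
  move=> At e e0; have [l /cdiff_lip[K [r [K0 r0 Fc]]]] := dF t At.
  pose d := Num.min r (e / K) / 2.
  have m0 : 0 < Num.min r (e / K) by rewrite lt_min r0 divr_gt0.
  have d0 : 0 < d by rewrite divr_gt0.
  have := cr t At => /cvgrPdist_le/(_ d d0) Hr.
  have := ci t At => /cvgrPdist_le/(_ d d0) Hi.
  near=> s.
  have : normc (c s - c t) <= Num.min r (e / K).
    rewrite (le_trans (normc_le _))// ReB ImB [leRHS]splitr lerD// distrC.
      by near: s; exact: Hr.
    by near: s; exact: Hi.
  rewrite le_min => /andP[sr se].
  have := Fc (c s - c t) sr; rewrite subrKC => /le_trans; apply.
  by rewrite mulrC -ler_pdivlMr.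
split; apply/subspace_continuousP => t At; apply/cvgrPdist_le => e e0; near=> s.
  rewrite distrC -ReB (le_trans (ler_Re _))//; near: s; exact: H.
rewrite distrC -ImB (le_trans (ler_Im _))//; near: s; exact: H.
Unshelve. all: by end_near. Qed.

Lemma within_continuousM c c' A :
  {within A, continuous (fun t => Re (c t))} ->
  {within A, continuous (fun t => Im (c t))} ->
  {within A, continuous (fun t => Re (c' t))} ->
  {within A, continuous (fun t => Im (c' t))} ->
  {within A, continuous (fun t => Re (c t * c' t))} /\
  {within A, continuous (fun t => Im (c t * c' t))}.
Proof.
move=> cr ci cr' ci'; split => t.
  under eq_fun do rewrite ReMc.
  by apply: cvgB; apply: cvgM; [exact: cr|exact: cr'|exact: ci|exact: ci'].
under eq_fun do rewrite ImMc.
by apply: cvgD; apply: cvgM; [exact: cr|exact: ci'|exact: ci|exact: cr'].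
Qed.

End within_continuity.

Section oriented.
Context {R : realType}.
Notation mu := (@lebesgue_measure R).

Lemma oriented_FTC (a b : R) (F k : R -> R) :
  (forall t, Num.min a b <= t <= Num.max a b -> is_derive t (1 : R) F (k t)) ->
  (forall t, Num.min a b <= t <= Num.max a b -> {for t, continuous k}) ->
  oriented_integral a b k = F b - F a.
Proof.
have main (x y : R) : x < y -> (forall t, x <= t <= y -> is_derive t (1 : R) F (k t)) ->
    (forall t, x <= t <= y -> {for t, continuous k}) ->
    \int[mu]_(t in `[x, y]) k t = F y - F x.
  move=> xy dF ck; apply: Rintegral_FTC => //.
  - apply: continuous_in_subspaceT => t; rewrite inE/= in_itv/= => xty.
    by apply/differentiable_continuous/derivable1_diffP; exact: (@ex_derive _ _ _ _ _ _ _ (dF t xty)).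
  - by apply: continuous_in_subspaceT => t; rewrite inE/= in_itv/=; exact: ck.
  - by move=> t /andP[xt ty]; apply: dF; rewrite !ltW.
move=> dF ck; rewrite /oriented_integral; have [ab|ba] := leP a b.
  move: ab; rewrite le_eqVlt => /predU1P[<-|ab].
    by rewrite set_itv1 Rintegral_set1 subrr.
  move: dF ck; rewrite (min_idPl (ltW ab)) (max_idPr (ltW ab)); exact: main.
move: dF ck; rewrite (min_idPr (ltW ba)) (max_idPl (ltW ba)) => dF ck.
by rewrite main// opprB.
Qed.

Lemma eq_oriented_integral (a b : R) (k k' : R -> R) :
  (forall t, Num.min a b <= t -> k t = k' t) ->
  oriented_integral a b k = oriented_integral a b k'.
Proof.
rewrite /oriented_integral; have [ab|ba] := leP a b => kk'.
  by apply: eq_Rintegral => t; rewrite inE/= in_itv/= => /andP[at0 _]; apply: kk'.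
congr (- _).
by apply: eq_Rintegral => t; rewrite inE/= in_itv/= => /andP[bt0 _]; apply: kk'.
Qed.

Lemma oriented_cFTC (a b : R) (F k : R -> R[i]) :
  (forall t, Num.min a b <= t -> is_cderive1 F t (k t)) ->
  (forall t, Num.min a b <= t -> exists l, is_cderive1 k t l) ->
  oriented_integral a b (fun t => Re (k t)) = Re (F b) - Re (F a) /\
  oriented_integral a b (fun t => Im (k t)) = Im (F b) - Im (F a).
Proof.
move=> dF dk; split.
  apply: (@oriented_FTC a b (fun t => Re (F t))) => // t /andP[abt _].
    by have /is_cderive1P[] := dF t abt.
  by have [l /is_cderive1_continuous[]] := dk t abt.
apply: (@oriented_FTC a b (fun t => Im (F t))) => // t /andP[abt _].
  by have /is_cderive1P[] := dF t abt.
by have [l /is_cderive1_continuous[]] := dk t abt.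
Qed.

End oriented.

Section contour_integrals.
Context {R : realType}.
Notation mu := (@lebesgue_measure R).
Implicit Types (z w : R[i]) (a t : R) (c : R -> R[i]).

Lemma log0_real a : 0 < a -> log0 a%:C = (ln a)%:C.
Proof.
move=> a0; rewrite /log0 normcR gtr0_norm//; apply: complexP => //.
by rewrite [LHS]/= /arg normcR gtr0_norm// lexx mulfV ?gt_eqF// acos1.
Qed.

Variables (f h h1 h2 : R[i] -> R[i]) (K : R).
Hypothesis th : tame h h1 h2 K.
Hypothesis fh : forall z, 0 < Re z -> log0 (f z) = h z.
Notation G := (primitive h).

(** On the right half-plane log0 o f coincides with the differentiable function
   h, so the branch cut is never met. *)
Lemma log_analyticE w : log_analytic f w <-> 0 < Re w.
Proof.
split=> [[]//|w0]; split => //.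
apply: filterS (near_Re_gt0 w0) => v v0.
apply: (cdiff_derivable (l := h1 v)).
apply: (cdiff_Re_gt0 v0 _ (tame_cdiff th v0)).
by move=> s s0; rewrite fh.
Qed.

(** The integrand involves the derivative of the arc, about which nothing is
   known at the two endpoints, a null set. *)
Lemma arc_integral c : C1_arc (log_analytic f) c ->
  cintegral mu `[0, 1] (fun t => log0 (f (c t)) * cderive1 c t) = G (c 1) - G (c 0).
Proof.
move=> [cD cr ci [dc [dr di dcE]]].
have c0 t : `[0, 1]%classic t -> 0 < Re (c t).
  by move=> t01; apply/log_analyticE/cD.
have [hr hi] := within_continuous_comp cr ci
  (fun t At => ex_intro _ _ (tame_cdiff th (c0 t At))).
have [Gr Gi] := within_continuous_comp cr ci
  (fun t At => ex_intro _ _ (cdiff_primitive th (c0 t At))).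
have [mr mi] := within_continuousM hr hi dr di.
rewrite -(@cintegral_FTC _ (G \o c) (fun t => h (c t) * dc t) 0 1)//.
  have oo (p q : R -> R) : {within `[0, 1], continuous q} ->
      (forall t, 0 < t < 1 -> p t = q t) ->
      \int[mu]_(t in `[0, 1]) p t = \int[mu]_(t in `[0, 1]) q t.
    move=> cq pq.
    have mq : measurable_fun (`]0, 1[%classic : set R) q.
      have m1 : measurable_fun (`[0, 1]%classic : set R) q.
        exact: subspace_continuous_measurable_fun.
      by apply: measurable_funS m1 => //; exact: subset_itv_oo_cc.
    have mp : measurable_fun (`]0, 1[%classic : set R) p.
      by apply: eq_measurable_fun mq => t; rewrite inE/= in_itv/= => /pq ->.
    rewrite /Rintegral; congr fine; apply: (eq_integral_itv_bounded true false mp mq).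
    by move=> t; rewrite in_itv; exact: pq.
  have E t : 0 < t < 1 -> log0 (f (c t)) * cderive1 c t = h (c t) * dc t.
    move=> /andP[t0 t1]; rewrite fh; last by apply: c0; rewrite /= in_itv/= !ltW.
    congr (_ * _); apply: is_cderive1_cderive1; apply/is_cderive1P.
    by apply: dcE; rewrite in_itv/= t0.
  by congr (_ +i* _); apply: oo => // t /E ->.
move=> t /andP[t0 t1]; apply: cdiff_curve.
  by apply: (cdiff_primitive th); apply: c0; rewrite /= in_itv/= !ltW.
by apply/is_cderive1P; apply: dcE; rewrite in_itv/= t0.
Qed.

(** The increments of the primitive telescope along the arcs. *)
Lemma contour_integral_primitive g z w : contour (log_analytic f) z w g ->
  contour_integral (fun w => log0 (f w)) g = G w - G z.
Proof.
elim: g z => [|c g IHg] z /=.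
  by move=> [_ ->]; rewrite /contour_integral big_nil subrr.
move=> [carc <- /IHg]; rewrite /contour_integral big_cons => ->.
by rewrite arc_integral// addrC subrKA.
Qed.

Lemma segment_arc z w : 0 < Re z -> 0 < Re w -> C1_arc (log_analytic f) (segmentc z w).
Proof.
move=> z0 w0.
have d t : is_cderive1 (segmentc z w) t (w - z).
  move=> e e0; near=> x; rewrite [X in normc X](_ : _ = 0) ?normc0 ?mulr_ge0 ?(ltW e0)//.
  by rewrite /segmentc RCD; ring.
have [|cr ci] := @is_cderive1_within _ (segmentc z w) 0 1.
  by move=> t _; exists (w - z).
split => //.
  move=> t; rewrite in_itv/= => t01; apply/log_analyticE.
  have /andP[t0 t1] := t01.
  rewrite /segmentc ReD ReZ ReB; nra.
exists (fun=> w - z); split.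
- by move=> x; exact: cvg_cst.
- by move=> x; exact: cvg_cst.
- by move=> t _; apply/is_cderive1P.
Unshelve. all: by end_near. Qed.

Lemma contour_via_Re z : 0 < Re z -> contour (log_analytic f) 1 z (via_Re z).
Proof.
move=> z0; split; first by apply: segment_arc.
  by rewrite /segmentc mul0r addr0.
split; first by apply: segment_arc.
  by rewrite /segmentc mul0r mul1r addr0 subrKC.
by split; rewrite /segmentc mul1r subrKC//; apply/log_analyticE.
Qed.

Lemma LlogE z : 0 < Re (z + 1) -> Llog f z = G (z + 1).
Proof.
move=> z0; rewrite /Llog; case: xgetP => [I _ [g cg ->]|].
  by rewrite (contour_integral_primitive cg) primitive1 subr0.
move=> /(_ (contour_integral (fun w => log0 (f w)) (via_Re (z + 1))))[].
by exists (via_Re (z + 1)) => //; exact: contour_via_Re.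
Qed.

Hypothesis f_real : forall a, 0 < a -> Im (f a%:C) = 0.
Hypothesis f_gt0 : forall a, 0 < a -> 0 < Re (f a%:C).

Let fE a : 0 < a -> f a%:C = (Re (f a%:C))%:C.
Proof. by move=> a0; apply: complexP => //=; exact: f_real. Qed.

Let hE a : 0 < a -> h a%:C = (ln (Re (f a%:C)))%:C.
Proof. by move=> a0; rewrite -fh// fE// log0_real// f_gt0. Qed.

Lemma Im_primitive_real a : 0 < a -> Im (G a%:C) = 0.
Proof.
move=> a0; rewrite /primitive ImMc ImB/= subr0 mul0r addr0.
rewrite (_ : (\int[mu]_(x in _) _) = 0) ?mulr0//.
transitivity (\int[mu]_(x in `[0, 1]) (0 : R)); last by rewrite /Rintegral integral0.
apply: eq_Rintegral => t; rewrite inE/= in_itv/= => t01.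
rewrite (_ : 1 + _ = (1 + t * (a - 1))%:C); last by rewrite RCD RCM RCB.
rewrite hE//; have /andP[? ?] := t01; nra.
Qed.

Let h_ln w : 0 < Re w -> ln (normc (f w)) = Re (h w).
Proof. by move=> w0; rewrite -fh. Qed.

Let h_arg w : 0 < Re w -> arg (f w) = Im (h w).
Proof. by move=> w0; rewrite -fh. Qed.

Lemma GlogE a : 0 < a -> Glog f a = Re (G a%:C).
Proof.
move=> a0; rewrite /Glog.
have pos t : Num.min 1 a <= t -> 0 < t.
  by apply: lt_le_trans; rewrite lt_min ltr01.
rewrite (eq_oriented_integral (k' := fun t => Re (h t%:C))); last first.
  by move=> t /pos t0; rewrite hE.
have [||-> _] := @oriented_cFTC _ 1 a (fun t => G t%:C) (fun t => h t%:C).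
- by move=> t /pos t0; apply: cdiff_real; exact: cdiff_primitive th _.
- move=> t /pos t0; exists (h1 t%:C); apply: cdiff_real; exact: (tame_cdiff th).
- by rewrite primitive1 subr0.
Qed.

Lemma AUlogE z : 0 < Re z ->
  Alog f z = Re (G (Re z)%:C) - Re (G z) /\ Ulog f z = Im (G z).
Proof.
move=> z0; pose c t := Re z +i* t.
have dc t : is_cderive1 c t 'i.
  move=> e e0; near=> x; rewrite [X in normc X](_ : _ = 0) ?normc0 ?mulr_ge0 ?(ltW e0)//.
  by apply: complexP; rewrite !RIE/=; ring.
(* The vertical segment has velocity i, hence the factor - i in the primitive. *)
have [||r i] := @oriented_cFTC _ 0 (Im z) (fun t => - 'i * G (c t)) (fun t => h (c t)).
- move=> t _.
  have := cdiff_curve (cdiffZ (- 'i) (cdiff_primitive th (z := c t) z0)) (dc t).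
  by rewrite mulrAC mulNr -expr2 sqr_i opprK mul1r.
- move=> t _; exists (h1 (c t) * 'i).
  exact: cdiff_curve (tame_cdiff th (z := c t) z0) (dc t).
have ImiG w : Im (- 'i * G w) = - Re (G w) by rewrite ImMc/= oppr0 mul0r add0r mulN1r.
have ReiG w : Re (- 'i * G w) = Im (G w).
  by rewrite ReMc/= oppr0 mul0r add0r mulN1r opprK.
have cz : c (Im z) = z by rewrite /c; case: (z).
split.
  rewrite /Alog (eq_oriented_integral (k' := fun t => Im (h (c t)))); last first.
    by move=> t _; rewrite h_arg.
  by rewrite i !ImiG cz opprK addrC.
rewrite /Ulog (eq_oriented_integral (k' := fun t => Re (h (c t)))); last first.
  by move=> t _; rewrite h_ln.
by rewrite r !ReiG cz [c 0]/(_%:C) Im_primitive_real// subr0.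
Unshelve. all: by end_near. Qed.

End contour_integrals.

(** * The Euler-Maclaurin formula *)

Section integrals_on_half_lines.
Context {R : realType}.
Notation mu := (@lebesgue_measure R).
Implicit Types (a b x : R) (F : R -> R[i]).

Lemma inv_sqr_integral a b : 0 <= a -> 0 < b ->
  mu.-integrable `[b, +oo[ (EFin \o (fun u => ((u + a) ^+ 2)^-1)) /\
  \int[mu]_(u in `[b, +oo[) ((u + a) ^+ 2)^-1 = (b + a)^-1.
Proof.
move=> a0 b0.
have pos u : b <= u -> 0 < u + a by move=> bu; rewrite ltr_pwDl// (lt_le_trans b0).
have dI u : b <= u -> is_derive u (1 : R) (fun v => - (v + a)^-1) ((u + a) ^+ 2)^-1.
  move=> bu; have un : (u%:C + a%:C : R[i]) != 0.
    by apply: Re_gt0_neq0; rewrite /= pos.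
  have := cdiff_real (cdiffN (cdiff_comp (cdiffD (cdiff_id u%:C) (cdiff_cst a%:C u%:C)) (cdiffV un))).
  move=> /is_cderive1P[+ _].
  have -> : (fun s => Re (- (id s%:C + a%:C)^-1)) = (fun v : R => - (v + a)^-1).
    by apply/funext => s; rewrite ReN -RCD -RCV.
  by rewrite addr0 mulr1 opprK -RCD -(rmorphXn (real_complex R)) -RCV.
have cI u : b <= u -> {for u, continuous (fun v => ((v + a) ^+ 2)^-1)}.
  move=> bu; suff : {for u, continuous (fun v : R => ((v + a) * (v + a))^-1)} by [].
  apply: cvgV; first by rewrite mulf_neq0// gt_eqF// pos.
  by apply: cvgM; apply: cvgD; [exact: cvg_id|exact: cvg_cst|exact: cvg_id|exact: cvg_cst].
have I0 : (\int[mu]_(u in `[b, +oo[) (((u + a) ^+ 2)^-1)%:E = (b + a)^-1%:E)%E.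
  rewrite (@ge0_continuous_FTC2y _ _ (fun u => - (u + a)^-1) b 0).
  - by rewrite sub0e -EFinN opprK.
  - by move=> x _; rewrite invr_ge0 sqr_ge0.
  - by apply: continuous_in_subspaceT => x; rewrite inE/= in_itv/= andbT; exact: cI.
  - apply/cvgrPdist_le => e e0; near=> u.
    have u0 : 0 < u by near: u; exact: nbhs_pinfty_gt.
    rewrite sub0r opprK ger0_norm ?invr_ge0 ?addr_ge0 ?(ltW u0)//.
    rewrite invf_ple ?posrE ?ltr_pwDl//.
    apply: (@le_trans _ _ u); last by rewrite lerDl.
    by near: u; apply: nbhs_pinfty_ge; exact: num_real.
  - by move=> x bx; exact: (@ex_derive _ _ _ _ _ _ _ (dI x (ltW bx))).
  - apply: cvg_at_right_filter; apply: cvgN; apply: cvgV.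
      by rewrite gt_eqF// pos.
    by apply: cvgD; [exact: cvg_id|exact: cvg_cst].
  - move=> x; rewrite in_itv/= andbT => bx.
    by rewrite derive1E; exact: (@derive_val _ _ _ _ _ _ _ (dI x (ltW bx))).
split; last by rewrite /Rintegral I0.
apply/integrableP; split.
  apply/measurable_EFinP; apply: subspace_continuous_measurable_fun => //.
  by apply: continuous_in_subspaceT => x; rewrite inE/= in_itv/= andbT; exact: cI.
under eq_integral => u _ do rewrite /= ger0_norm ?invr_ge0 ?sqr_ge0//.
by rewrite I0 ltry.
Unshelve. all: by end_near. Qed.

Lemma cintegral_split F a x (b : itv_bound R) :
  (BLeft a <= BRight x)%O -> (BRight x <= b)%O -> a <= x ->
  cintegrable mu [set` Interval (BLeft a) b] F ->
  cintegral mu [set` Interval (BLeft a) b] F =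
  cintegral mu `[a, x] F + cintegral mu [set` Interval (BLeft x) b] F.
Proof.
move=> ax xb ax' [Fr Fi].
have H (p : R -> R) : mu.-integrable [set` Interval (BLeft a) b] (EFin \o p) ->
    \int[mu]_(t in [set` Interval (BLeft a) b]) p t =
    \int[mu]_(t in `[a, x]) p t + \int[mu]_(t in [set` Interval (BLeft x) b]) p t.
  move=> ip; have := Rintegral_itvB ip ax xb.
  rewrite Rintegral_itv_obnd_cbnd.
    by move=> <-; rewrite subrKC.
  apply: integrableS ip => //; apply: subset_itvr.
  by rewrite bnd_simp.
by apply: complexP; [rewrite ReD; exact: H|rewrite ImD; exact: H].
Qed.

End integrals_on_half_lines.

Section euler_maclaurin.
Context {R : realType}.
Notation mu := (@lebesgue_measure R).
Implicit Types (z w : R[i]) (u : R) (n k : nat).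

Lemma Pquad_itv01 u : 0 <= Pquad u <= 1.
Proof.
rewrite /Pquad; have /andP := floor_itv u.
rewrite rmorphD/= => -[]; set v := (_%:~R) => vu uv.
by apply/andP; split; nra.
Qed.

Lemma Pquad_itv k u : k%:R <= u <= k.+1%:R -> Pquad u = (u - k%:R) * (k.+1%:R - u).
Proof.
move=> /andP[ku]; rewrite le_eqVlt => /predU1P[->|uk].
  rewrite /Pquad (_ : Num.floor _ = k.+1%:Z); last first.
    by apply: floor_def; rewrite !intrD lexx/= ltrDl.
  by rewrite subrr mul0r mulr0.
rewrite /Pquad (_ : Num.floor _ = k%:Z).
  by rewrite -natr1; congr (_ * _); ring.
by apply: floor_def; rewrite ku/= intrD -natr1 in uk *.
Qed.

Lemma measurable_Pquad (D : set R) : measurable D -> measurable_fun D (@Pquad R).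
Proof.
move=> mD; have mf : measurable_fun D (fun u : R => ((Num.floor u)%:~R : R)).
  by apply: nondecreasing_measurable => // x y xy; rewrite ler_int le_floor.
have mfr : measurable_fun D (fun u : R => u - (Num.floor u)%:~R).
  by apply: measurable_funB => //; exact: measurable_id.
by apply: measurable_funM => //; apply: measurable_funB.
Qed.

Variables (h h1 h2 : R[i] -> R[i]) (K : R).
Hypothesis th : tame h h1 h2 K.
Notation G := (primitive h).
Notation ray n := [set` Interval (BLeft (n : R)) (BInfty R false)].

Definition tail_integrand z u : R[i] := (Pquad u)%:C * h2 (u%:C + z).

Let Re_shift u z : 0 < u -> 0 <= Re z -> 0 < Re (u%:C + z).
Proof. by move=> u0 z0; rewrite ReD/= ltr_pwDl. Qed.

Let ge1_gt0 (b u : R) : 0 < b -> `[b, +oo[%classic u -> 0 < u.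
Proof. by move=> b0; rewrite /= in_itv/= andbT; exact: lt_le_trans. Qed.

Lemma normc_tail_integrand z u : 0 <= Re z -> 0 < u ->
  normc (tail_integrand z u) <= K * ((u + Re z) ^+ 2)^-1.
Proof.
move=> z0 u0; have /andP[P0 P1] := Pquad_itv01 u.
rewrite normcZ// -[leRHS]mul1r ler_pM ?normc_ge0//.
by have := tame_bound2 th (Re_shift u0 z0); rewrite ReD.
Qed.

Let integrable_dom a b : 0 <= a -> 0 < b ->
  mu.-integrable `[b, +oo[ (EFin \o (fun u : R => K * ((u + a) ^+ 2)^-1)).
Proof.
by move=> a0 b0; apply: integrableRZ => //; exact: (inv_sqr_integral a0 b0).1.
Qed.

Lemma cintegrable_tail b z : 0 < b -> 0 <= Re z ->
  cintegrable mu `[b, +oo[ (tail_integrand z).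
Proof.
move=> b0 z0.
have mD : measurable (`[b, +oo[%classic : set R) by exact: measurable_itv.
have cd u : `[b, +oo[%classic u -> exists l, is_cderive1 (fun v : R => h2 (v%:C + z)) u l.
  move=> /(ge1_gt0 b0) u0; have [l Hl] := tame_cdiff2 th (Re_shift u0 z0).
  exists (l * 1).
  have := cdiff_comp (cdiffD (cdiff_id u%:C) (cdiff_cst z u%:C)) Hl.
  by rewrite addr0; exact: (@cdiff_real _ (fun v => h2 (v + z))).
have mp (p : R[i] -> R) :
    (forall u : R, `[b, +oo[%classic u -> {for u, continuous (fun v : R => p (h2 (v%:C + z)))}) ->
    measurable_fun (`[b, +oo[%classic : set R) (fun u : R => Pquad u * p (h2 (u%:C + z))).
  move=> cp; apply: measurable_funM; first exact: measurable_Pquad.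
  apply: subspace_continuous_measurable_fun => //.
  by apply: continuous_in_subspaceT => u; rewrite inE; exact: cp.
apply: (cintegrable_le _ _ _ (integrable_dom z0 b0)) => //.
- apply: eq_measurable_fun (mp (@complex.Re R) _).
    by move=> u _; rewrite ReZ.
  by move=> u /cd[l /is_cderive1_continuous[]].
- apply: eq_measurable_fun (mp (@complex.Im R) _).
    by move=> u _; rewrite ImMc mul0r addr0.
  by move=> u /cd[l /is_cderive1_continuous[]].
- by move=> u /(ge1_gt0 b0) u0; exact: normc_tail_integrand.
Qed.

Definition tail z : R[i] := cintegral mu `[1, +oo[ (tail_integrand z).

Lemma normc_tail b z : 0 < b -> 0 <= Re z ->
  normc (cintegral mu `[b, +oo[ (tail_integrand z)) <= 2 * (K / (b + Re z)).
Proof.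
move=> b0 z0; rewrite -(inv_sqr_integral z0 b0).2 -RintegralZl//; last first.
  exact: (inv_sqr_integral z0 b0).1.
apply: normc_cintegral_le => //.
- exact: cintegrable_tail.
- exact: integrable_dom.
- by move=> u /(ge1_gt0 b0) u0; exact: normc_tail_integrand.
Qed.

(** Integration by parts twice on [k, k + 1], where Pquad is the polynomial
   (u - k) (k + 1 - u), in the form of an explicit primitive. *)
Lemma cintegral_tail_step k z : (0 < k)%N -> 0 <= Re z ->
  cintegral mu `[k%:R, k.+1%:R] (tail_integrand z) =
  h (k.+1%:R%:C + z) + h (k%:R%:C + z) -
  2 * (G (k.+1%:R%:C + z) - G (k%:R%:C + z)).
Proof.
move=> k0 z0.
pose a : R[i] := (k%:R : R)%:C; pose b : R[i] := (k.+1%:R : R)%:C.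
have kR0 : 0 < (k%:R : R) by rewrite ltr0n.
have ba : b = a + 1 by rewrite /b -natr1 RCD.
pose Phi (u : R[i]) := (u - a) * (b - u) * h1 (u + z) - (a + b - 2 * u) * h (u + z) - 2 * G (u + z).
pose phi (u : R[i]) := (u - a) * (b - u) * h2 (u + z).
have Dlin (c0 c1 u : R[i]) : cdiff (fun v => c0 + c1 * v) u c1.
  by have := cdiffD (cdiff_cst c0 u) (cdiffZ c1 (cdiff_id u)); rewrite mulr1 add0r.
have Dsh (F : R[i] -> R[i]) (l u : R[i]) : cdiff F (u + z) l -> cdiff (fun v => F (v + z)) u l.
  move=> dF; rewrite -[l]mulr1; apply: (@cdiff_comp _ (fun v => v + z) F) => //.
  by have := cdiffD (cdiff_id u) (cdiff_cst z u); rewrite addr0.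
have Dpol (u : R[i]) : cdiff (fun v => (v - a) * (b - v)) u (a + b - 2 * u).
  have := cdiffM (Dlin (- a) 1 u) (Dlin b (- 1) u).
  rewrite (_ : 1 * _ + _ = a + b - 2 * u); last by ring.
  rewrite (_ : (fun s => _) = (fun v => (v - a) * (b - v)))//.
  by apply/funext => v; ring.
have ba0 u : k%:R <= u -> 0 < Re (u%:C + z).
  by move=> ku; apply: Re_shift => //; exact: lt_le_trans ku.
have [|||_ E] := @cintegral_FTC_closed _ (fun u : R => Phi u%:C) (fun u : R => phi u%:C)
    k%:R k.+1%:R.
- by rewrite ler_nat.
- move=> u /andP[/ba0 u0 _]; apply: (@cdiff_real _ Phi).
  have := cdiffB (cdiffB (cdiffM (Dpol u%:C) (Dsh _ _ _ (tame_cdiff1 th u0)))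
    (cdiffM (Dlin (a + b) (- 2) u%:C) (Dsh _ _ _ (tame_cdiff th u0))))
    (cdiffZ 2 (Dsh _ _ _ (cdiff_primitive th u0))).
  rewrite (_ : (fun s => _) = Phi); last by apply/funext => v; rewrite /Phi; ring.
  by rewrite (_ : _ - _ = phi u%:C)//; rewrite /phi; ring.
- move=> u /andP[/ba0 u0 _]; have [l Hl] := tame_cdiff2 th u0.
  eexists; apply: (@cdiff_real _ phi).
  exact: cdiffM (Dpol u%:C) (Dsh _ _ _ Hl).
transitivity (cintegral mu `[k%:R, k.+1%:R] (fun u : R => phi u%:C)).
  apply: eq_cintegral => u; rewrite /= in_itv/= => ku.
  by rewrite /tail_integrand (Pquad_itv ku) /phi RCM !RCB.
by rewrite E /Phi -/a -/b ba; ring.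
Qed.

Lemma euler_maclaurin n z : 0 <= Re z ->
  \sum_(1 <= k < n.+1) h (k%:R%:C + z) =
  G (n.+1%:R%:C + z) - G (1 + z) - 2^-1 * (h (n.+1%:R%:C + z) - h (1 + z)) +
  2^-1 * cintegral mu `[1, n.+1%:R] (tail_integrand z).
Proof.
move=> z0; elim: n => [|n IHn].
  rewrite big_geq// set_itv1 /cintegral !Rintegral_set1.
  by rewrite (_ : 0 +i* 0 = 0 :> R[i])//; ring.
have n0 : (1 : R) <= n.+1%:R by rewrite ler1n.
rewrite big_nat_recr//= IHn.
rewrite (@cintegral_split _ _ 1 n.+1%:R (BRight n.+2%:R)) ?bnd_simp//; last 2 first.
- by rewrite ler_nat.
- have [r i] := cintegrable_tail (b := 1) ltr01 z0.
  by split; [apply: integrableS r|apply: integrableS i] => //; apply: subset_itvl.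
by rewrite cintegral_tail_step//; field.
Qed.

(** The limit of \sum_(1 <= k < n) (h (k + z) - h k) - z * h n as n grows, by
   [stirling_sum]. *)
Definition stirling_exponent z : R[i] :=
  - G (1 + z) + 2^-1 * (h (1 + z) - h 1) + 2^-1 * (tail z - tail 0).

(** Once the Euler-Maclaurin formulas for z and 0 are subtracted, what depends
   on n is a Taylor remainder of G at n, an increment of h at n and the tails
   beyond n, each of them O(1 / n). *)
Lemma stirling_sum z : 0 < Re z -> exists C, forall n, (0 < n)%N ->
  normc (\sum_(1 <= k < n) (h (k%:R%:C + z) - h k%:R%:C) - z * h n%:R%:C -
         stirling_exponent z) <= C / n%:R.
Proof.
move=> z0; have z0' := ltW z0.
have K0 := tame_ge0 th.
exists (4 * K * normc z ^+ 2 + K * normc z + 2 * K) => -[//|n] _.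
pose N : R := n.+1%:R.
have N0 : 0 < N by rewrite ltr0n.
have N1 : 1 <= N by rewrite ler1n.
have reg (s : R[i]) : N <= Re s -> 0 < Re s by exact: lt_le_trans.
have b1 (s : R[i]) : N <= Re s -> normc (h1 s) <= K / N.
  move=> Ns; rewrite (le_trans (tame_bound1 th (reg s Ns)))// ler_wpM2l//.
  by rewrite lef_pV2 ?posrE// reg.
have NRe : N <= Re N%:C by [].
have NzRe : N <= Re (N%:C + z) by rewrite ReD/= lerDl.
have T1 := half_plane_taylor (fun s Ns => cdiff_primitive th (reg s Ns))
  (fun s Ns => tame_cdiff th (reg s Ns)) b1 NRe NzRe.
have T2 := half_plane_MVT (fun s Ns => tame_cdiff th (reg s Ns)) b1 NRe NzRe.
have split_tail s : 0 <= Re s -> tail s = cintegral mu `[1, N] (tail_integrand s) +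
    cintegral mu `[N, +oo[ (tail_integrand s).
  by move=> s0; apply: cintegral_split => //; exact: cintegrable_tail.
have t0 s : 0 <= Re s -> normc (cintegral mu `[N, +oo[ (tail_integrand s)) <= 2 * (K / N).
  move=> s0; rewrite (le_trans (normc_tail N0 s0))// ler_wpM2l// ler_wpM2l//.
  by rewrite lef_pV2 ?posrE ?lerDl// ltr_wpDr.
have r0 : 0 <= Re (0 : R[i]) by [].
rewrite sumrB (euler_maclaurin n z0').
have := euler_maclaurin n r0; rewrite addr0.
under eq_bigr do rewrite addr0.
move=> ->; rewrite /stirling_exponent !split_tail// !addr0 primitive1 -/N.
set A := cintegral mu `[1, N] (tail_integrand z).
set B := cintegral mu `[1, N] (tail_integrand 0).
have := t0 z z0'; have := t0 0 r0.
set a := cintegral _ _ _; set b := cintegral _ _ _ => ta tb.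
rewrite [X in normc X](_ : _ = (G (N%:C + z) - G N%:C - h N%:C * z) -
  2^-1 * (h (N%:C + z) - h N%:C) - 2^-1 * (b - a)); last by field.
rewrite (le_trans (normc_sum3 _ _ _))// !normcN !normcM normcV.
have -> : normc (2 : R[i]) = 2.
  by rewrite -(rmorph_nat (real_complex R)) normcR ger0_norm.
have := le_normcD b (- a); rewrite normcN => tba.
have -> : (4 * K * normc z ^+ 2 + K * normc z + 2 * K) / N =
  4 * (K / N * normc z ^+ 2) + 2^-1 * (2 * (K / N * normc z)) + 2^-1 * (2 * (2 * (K / N))).
  by field; rewrite gt_eqF.
apply: lerD; first apply: lerD => //.
  by rewrite ler_wpM2l// invr_ge0.
apply: ler_wpM2l; first by rewrite invr_ge0.
apply: (le_trans tba); rewrite [leRHS](_ : _ = 2 * (K / N) + 2 * (K / N)); last by ring.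
exact: lerD.
Qed.

End euler_maclaurin.

(** * Stirling's formula for Mellin transforms *)

Section near1.
Context {R : realType}.
Implicit Types (u v : nat -> R[i]) (n : nat).

(** Convergence to 1 is used with its rate 1 / n, which every estimate provides
   and which is stable under products. *)
Definition near1 u : Prop := exists C : R, forall n, (0 < n)%N ->
  normc (u n - 1) <= C / n%:R.

Lemma near1_ge0 u : near1 u -> exists2 C : R, 0 <= C &
  forall n, (0 < n)%N -> normc (u n - 1) <= C / n%:R.
Proof.
move=> [C HC]; exists C => //.
by have := le_trans (normc_ge0 _) (HC 1%N isT); rewrite divr1.
Qed.

Lemma near1M u v : near1 u -> near1 v -> near1 (fun n => u n * v n).
Proof.
move=> /near1_ge0[C C0 HC] /near1_ge0[C' C0' HC'].
exists (C * C' + C + C') => n n0.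
have nR : 0 < (n%:R : R) by rewrite ltr0n.
have n1 : (n%:R : R)^-1 <= 1 by rewrite invf_le1// ler1n.
rewrite [X in normc X](_ : _ = (u n - 1) * (v n - 1) + (u n - 1) + (v n - 1)); last by ring.
have -> : (C * C' + C + C') / n%:R = C * C' / n%:R + C / n%:R + C' / n%:R by ring.
rewrite (le_trans (normc_sum3 _ _ _))// !lerD ?HC ?HC'//.
rewrite normcM; apply: (le_trans (ler_pM (normc_ge0 _) (normc_ge0 _) (HC _ n0) (HC' _ n0))).
have -> : C / n%:R * (C' / n%:R) = C * C' / n%:R * n%:R^-1 by ring.
by rewrite ler_piMr// divr_ge0 ?mulr_ge0// ltW.
Qed.

Lemma near1_cexp u (C : R) : (forall n, (0 < n)%N -> normc (u n) <= C / n%:R) ->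
  near1 (fun n => cexp (u n)).
Proof.
move=> HC; have C0 : 0 <= C.
  by have := le_trans (normc_ge0 _) (HC 1%N isT); rewrite divr1.
exists (2 * (C * expR C)) => n n0; rewrite (le_trans (normc_cexpB1 _))//.
have nR : 0 < (n%:R : R) by rewrite ltr0n.
rewrite -mulrA ler_wpM2l// mulrAC ler_pM ?normc_ge0 ?expR_ge0 ?HC//.
rewrite ler_expR (le_trans (HC _ n0))// ler_pdivrMr// ler_peMr// ler1n//.
Qed.

Lemma near1_cst (a : R[i]) : near1 (fun=> a) -> a = 1.
Proof.
move=> /near1_ge0[C C0 HC]; apply/eqP; rewrite -subr_eq0 -normc_eq0.
apply: contraT => a1; have d0 : 0 < normc (a - 1) by rewrite lt0r a1 normc_ge0.
have Cd0 : 0 <= C / normc (a - 1) by rewrite divr_ge0// ltW.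
pose n := Num.bound (C / normc (a - 1)).
have Cn' : C / normc (a - 1) < n%:R by exact: archi_boundP.
have n0 : (0 < n)%N.
  rewrite -(ltr0n R); apply: le_lt_trans Cn'.
  exact: Cd0.
have := HC n n0; rewrite ler_pdivlMr ?ltr0n// mulrC -ler_pdivlMr//.
by rewrite leNgt Cn'.
Qed.

End near1.

Section complex_powers.
Context {R : realType}.
Implicit Types (x y c : R) (z w : R[i]) (n : nat).

Lemma rpowc_gt0 y w : 0 < y -> rpowc y w = cexp (w * (ln y)%:C).
Proof. by move=> y0; rewrite /rpowc gt_eqF. Qed.

Lemma rpowc_nat y n : 0 <= y -> rpowc y n%:R = (y ^+ n)%:C.
Proof.
rewrite le_eqVlt => /predU1P[<-|y0].
  by rewrite /rpowc eqxx pnatr_eq0 expr0n (rmorph_nat (real_complex R)).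
rewrite rpowc_gt0// -(rmorph_nat (real_complex R)) -RCM cexpR expRM_natl.
by rewrite lnK.
Qed.

Lemma rpowc_0l z : 0 < Re z -> rpowc 0 z = 0.
Proof. by move=> z0; rewrite /rpowc eqxx (negbTE (Re_gt0_neq0 z0)). Qed.

Lemma rpowcD_nat y z n : 0 <= y -> 0 < Re z ->
  rpowc y (z + n%:R) = (y ^+ n)%:C * rpowc y z.
Proof.
move=> + z0; rewrite le_eqVlt => /predU1P[<-|y0].
  rewrite !rpowc_0l ?mulr0// ReD -(rmorph_nat (real_complex R)).
  by rewrite ltr_pwDl//= ler0n.
by rewrite -rpowc_nat ?ltW// !rpowc_gt0// mulrDl cexpD mulrC.
Qed.

Lemma rpowc_div y c z : 0 <= y -> 0 < c -> 0 < Re z ->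
  rpowc y z = rpowc c z * rpowc (y / c) z.
Proof.
move=> + c0 z0; rewrite le_eqVlt => /predU1P[<-|y0].
  by rewrite mul0r !rpowc_0l// mulr0.
rewrite !rpowc_gt0 ?divr_gt0// -cexpD ln_div ?posrE// RCB; congr cexp; ring.
Qed.

Lemma normc_rpowc_le x z : 0 <= x -> 0 < Re z <= 2 -> normc (rpowc x z) <= 1 + x ^+ 2.
Proof.
move=> + /andP[z0 z2]; rewrite le_eqVlt => /predU1P[<-|x0].
  by rewrite rpowc_0l// normc0 addr_ge0 ?sqr_ge0.
rewrite rpowc_gt0// normc_cexp mulrC ReZ.
have [x1|x1] := leP x 1.
  rewrite (@le_trans _ _ 1) ?lerDl ?sqr_ge0// expR_le1.
  by rewrite mulr_le0_ge0 ?ln_le0// ltW.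
apply: (@le_trans _ _ (x ^+ 2)); last by rewrite lerDr.
rewrite -[x ^+ 2]lnK ?posrE ?exprn_gt0// ler_expR lnXn// -mulr_natr.
by rewrite ler_wpM2l// ln_ge0// ltW.
Qed.

(** Near 1 this is the expansion of exp (z ln x); away from 1 the right-hand
   side is at least C / 4 and grows like x ^ 2, which dominates x ^ z because
   Re z <= 2. *)
Lemma rpowc_taylor z : 0 < Re z <= 2 -> exists2 C, 0 <= C &
  forall x, 0 <= x -> normc (rpowc x z - 1 - z * (x - 1)%:C) <= C * (x - 1) ^+ 2.
Proof.
move=> z02.
pose A := 16 * (normc z ^+ 2 * expR (normc z)); pose Z := normc z.
have Z0 : 0 <= Z by exact: normc_ge0.
have A0 : 0 <= A by rewrite mulr_ge0// mulr_ge0 ?sqr_ge0 ?expR_ge0.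
exists (A + 2 * Z + 18).
  by rewrite addr_ge0// addr_ge0// mulr_ge0.
move=> x x0; have q0 : 0 <= (x - 1) ^+ 2 by exact: sqr_ge0.
have [/andP[x1 x2]|/negP far] := boolP (2^-1 <= x <= 3 / 2).
  have xp : 0 < x by lra.
  have L1 : `|ln x| <= 2 * `|x - 1| by apply: normr_ln; rewrite x1.
  have L2 : `|ln x - (x - 1)| <= 2 * (x - 1) ^+ 2 by apply: normr_lnB.
  have xx : `|x - 1| <= 2^-1 by rewrite ler_norml; apply/andP; split; lra.
  rewrite rpowc_gt0// [X in normc X](_ : _ =
    (cexp (z * (ln x)%:C) - 1 - z * (ln x)%:C) + z * (ln x - (x - 1))%:C); last first.
    by rewrite RCB; ring.
  rewrite (le_trans (le_normcD _ _))// -[X in _ <= X * _]addrA mulrDl lerD//.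
    rewrite (le_trans (normc_cexpB1B _))// normcM normcR exprMn.
    have -> : A * (x - 1) ^+ 2 = 4 * (normc z ^+ 2 * (2 * `|x - 1|) ^+ 2 * expR (normc z)).
      by rewrite exprMn real_normK ?num_real// /A; ring.
    rewrite ler_wpM2l// ler_pM ?mulr_ge0 ?sqr_ge0 ?expR_ge0//.
      by rewrite ler_wpM2l ?sqr_ge0// lerXn2r// nnegrE mulr_ge0.
    by rewrite ler_expR ler_piMr// (le_trans L1)//; lra.
  rewrite normcM normcR (le_trans (ler_wpM2l (normc_ge0 z) L2))//.
  rewrite mulrA ler_wpM2r// -/Z; lra.
have q4 : 4^-1 <= (x - 1) ^+ 2.
  have [x1|x1] := leP 2^-1 x.
    have : 3 / 2 < x by rewrite ltNge; apply/negP => x2; apply: far; rewrite x1.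
    nra.
  nra.
have xq : `|x - 1| <= 2 * (x - 1) ^+ 2.
  rewrite -real_normK ?num_real//; move: q4; rewrite -real_normK ?num_real//.
  have := normr_ge0 (x - 1); set r := `|x - 1|; nra.
apply: (le_trans (le_normcD _ _)); rewrite normcN normcM normcR.
apply: (le_trans (lerD (le_normcD _ _) (lexx _))); rewrite normcN normc1.
have := normc_rpowc_le x0 z02 => H.
have H2 : normc z * `|x - 1| <= Z * (2 * (x - 1) ^+ 2) by rewrite ler_wpM2l.
have : A * (x - 1) ^+ 2 >= 0 by rewrite mulr_ge0.
move: H H2; rewrite -/Z; set N := normc (rpowc x z); set M := Z * `|_|.
nra.
Qed.

End complex_powers.

Section mellin_ratio.
Context {R : realType} d (T : measurableType d) (m : {measure set T -> \bar R}).
Variables (D : set T) (Y g : T -> R) (f f1 f2 W : R[i] -> R[i]).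
Hypothesis mD : measurable D.
Hypothesis Y_ge0 : forall t, D t -> 0 <= Y t.
Hypothesis g_ge0 : forall t, D t -> 0 <= g t.
Hypothesis bl : bernstein_like f f1 f2.
Hypothesis W_int : forall z, 0 < Re z ->
  cintegrable m D (fun t => rpowc (Y t) (z - 1) * (g t)%:C).
Hypothesis WE : forall z, 0 < Re z ->
  W z = cintegral m D (fun t => rpowc (Y t) (z - 1) * (g t)%:C).
Hypothesis WS : forall z, 0 < Re z -> W (z + 1) = f z * W z.
Hypothesis W1 : W 1 = 1.
Implicit Types (z : R[i]) (n k : nat).

Let p (n : nat) : R := Re (f n%:R%:C).

Let w (n : nat) : R := \prod_(1 <= k < n) p k.

Let p_gt0 n : (0 < n)%N -> 0 < p n.
Proof. by move=> n0; rewrite /p (bl_gt0 bl)// ltr0n. Qed.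

Let fE n : (0 < n)%N -> f n%:R%:C = (p n)%:C.
Proof. by move=> n0; apply: complexP => //; rewrite (bl_real bl)// ltr0n. Qed.

Let w_gt0 n : 0 < w n.
Proof. by rewrite /w big_nat_cond prodr_gt0// => k /andP[/andP[k1 _] _]; exact: p_gt0. Qed.

Let wS n : (0 < n)%N -> w n.+1 = w n * p n.
Proof. by move=> n0; rewrite /w big_nat_recr. Qed.

Let W_nat n : W n.+1%:R%:C = (w n.+1)%:C.
Proof.
elim: n => [|n IHn]; first by rewrite /w big_geq// W1.
rewrite -natr1 RCD WS ?IHn; last by rewrite /= ltr0n.
by rewrite fE// -RCM [w n.+2]wS// mulrC.
Qed.

Let moment n t := Y t ^+ n * g t.

Let momentE n t : D t -> rpowc (Y t) (n.+1%:R%:C - 1) * (g t)%:C = (moment n t)%:C.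
Proof.
move=> Dt; rewrite -natr1 RCD addrK (rmorph_nat (real_complex R)).
by rewrite rpowc_nat ?Y_ge0// -RCM.
Qed.

Let integrable_moment n : m.-integrable D (EFin \o moment n).
Proof.
have [+ _] := W_int (z := n.+1%:R%:C) (ltr0Sn _ _).
by apply: eq_integrable => // t; rewrite inE => Dt; rewrite momentE.
Qed.

Let Rintegral_moment n : \int[m]_(t in D) moment n t = w n.+1.
Proof.
have := WE (z := n.+1%:R%:C) (ltr0Sn _ _).
rewrite W_nat => /(congr1 (@complex.Re R)) /= ->.
by apply: eq_Rintegral => t; rewrite inE => Dt; rewrite momentE.
Qed.

Let cintegrable_moment n : cintegrable m D (fun t => (moment n t)%:C).
Proof.
apply: eq_cintegrable (W_int (z := n.+1%:R%:C) (ltr0Sn _ _)) => //.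
exact: momentE.
Qed.

Let cintegral_moment n : cintegral m D (fun t => (moment n t)%:C) = (w n.+1)%:C.
Proof.
rewrite -W_nat (WE (z := n.+1%:R%:C) (ltr0Sn _ _)).
by apply: eq_cintegral => // t Dt; rewrite momentE.
Qed.

(** Under the probability with density proportional to Y ^ n * g, the variable
   Y / f (n + 1) has mean 1 and variance at most 1 / (n + 1); the first order
   Taylor polynomial of x |-> x ^ z at 1 integrates to 1. *)
Let mellin_ratio_strip z : 0 < Re z <= 2 -> exists C, forall n, (0 < n)%N ->
  normc (W (n%:R%:C + z) / (W n%:R%:C * cexp (z * log0 (f n%:R%:C))) - 1) <= C / n%:R.
Proof.
move=> z02; have /andP[z0 _] := z02; have [C C0 HC] := rpowc_taylor z02.
exists (2 * C) => -[//|n] _.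
set c := p n.+1; have c0 : 0 < c by exact: p_gt0.
have n0 : 0 < (n.+1%:R : R) by rewrite ltr0n.
rewrite fE// -/c log0_real// W_nat -rpowc_gt0//.
set cz := rpowc c z; have cz0 : cz != 0 by rewrite /cz rpowc_gt0// cexp_neq0.
have wn0 := w_gt0 n.+1.
have wC0 : ((w n.+1)%:C : R[i]) != 0 by apply: Re_gt0_neq0.
have cC0 : (c%:C : R[i]) != 0 by apply: Re_gt0_neq0.
have nz0 : 0 < Re (n.+1%:R%:C + z) by rewrite ReD/= addr_gt0.
pose F t := rpowc (Y t) (n.+1%:R%:C + z - 1) * (g t)%:C -
  (cz * (moment n t)%:C + z * cz / c%:C * ((moment n.+1 t)%:C - c%:C * (moment n t)%:C)).
have I0 := W_int nz0.
have I1 := cintegrableZ mD cz (cintegrable_moment n).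
have I2 := cintegrableB mD (cintegrable_moment n.+1) (cintegrableZ mD c%:C (cintegrable_moment n)).
have I3 := cintegrableZ mD (z * cz / c%:C) I2.
have IF : cintegrable m D F by apply: cintegrableB => //; exact: cintegrableD.
have EF : cintegral m D F = W (n.+1%:R%:C + z) - cz * (w n.+1)%:C.
  rewrite cintegralB//; last exact: cintegrableD.
  rewrite -WE// cintegralD// !cintegralZ// cintegralB//; last first.
    by apply: cintegrableZ.
  rewrite cintegralZ// !cintegral_moment [w n.+2]wS// -/c RCM.
  by field.
pose G t := normc cz * C * ((c ^+ 2)^-1 * moment n.+2 t - 2 / c * moment n.+1 t + moment n t).
have IG0 : m.-integrable D (EFin \o (fun t =>
    (c ^+ 2)^-1 * moment n.+2 t - 2 / c * moment n.+1 t)).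
  have := integrableB mD (integrableRZ mD (c ^+ 2)^-1 (integrable_moment n.+2))
    (integrableRZ mD (2 / c) (integrable_moment n.+1)).
  by apply: eq_integrable.
have IG1 : m.-integrable D (EFin \o (fun t =>
    (c ^+ 2)^-1 * moment n.+2 t - 2 / c * moment n.+1 t + moment n t)).
  by have := integrableD mD IG0 (integrable_moment n); apply: eq_integrable.
have IG : m.-integrable D (EFin \o G) by exact: integrableRZ.
have EG : \int[m]_(t in D) G t = normc cz * C * (w n.+1 * (p n.+2 / c - 1)).
  rewrite RintegralZl// RintegralD// RintegralB//; last 2 first.
  - exact: integrableRZ.
  - exact: integrableRZ.
  rewrite !RintegralZl// !Rintegral_moment (wS (n := n.+2))// (wS (n := n.+1))// -/c.
  by congr (_ * _); field; rewrite gt_eqF.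
have FG t : D t -> normc (F t) <= G t.
  move=> Dt; have Y0 := Y_ge0 Dt; have g0 := g_ge0 Dt.
  rewrite [X in normc X](_ : _ = (moment n t)%:C * (cz *
      (rpowc (Y t / c) z - 1 - z * (Y t / c - 1)%:C))); last first.
    rewrite /F (_ : n.+1%:R%:C + z - 1 = z + n%:R); last first.
      by rewrite -natr1 RCD (rmorph_nat (real_complex R)); ring.
    rewrite rpowcD_nat// (rpowc_div _ c0)// -/cz /moment exprS RCB RCM RCM !RCM RCV.
    by field.
  rewrite normcZ ?mulr_ge0 ?exprn_ge0// normcM.
  have -> : G t = moment n t * (normc cz * (C * (Y t / c - 1) ^+ 2)).
    by rewrite /G /moment !exprS; field; rewrite gt_eqF.
  rewrite ler_wpM2l ?mulr_ge0 ?exprn_ge0// ler_wpM2l ?normc_ge0//.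
  by rewrite HC// divr_ge0// ltW.
have := normc_cintegral_le mD IF IG FG; rewrite EF EG => H.
rewrite [X in normc X](_ : _ = (W (n.+1%:R%:C + z) - cz * (w n.+1)%:C) / (cz * (w n.+1)%:C)); last first.
  by field; rewrite cz0 wC0.
rewrite normcM normcV ler_pdivrMr ?normc_gt0 ?mulf_neq0// (le_trans H)//.
rewrite normcM normcR gtr0_norm//.
have step : p n.+2 / c - 1 <= n.+1%:R^-1.
  have := bl_step bl n0; rewrite {1}natr1 => st.
  rewrite lerBlDr ler_pdivrMr// -(ler_pM2l n0) (le_trans st)// -/(p n.+1) -/c.
  by rewrite le_eqVlt; apply/orP; left; apply/eqP; field; rewrite gt_eqF.
rewrite [leRHS](_ : _ = 2 * (normc cz * C * (w n.+1 * n.+1%:R^-1))); last by ring.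
by rewrite ler_wpM2l// ler_wpM2l ?mulr_ge0 ?normc_ge0// ler_wpM2l// ltW.
Qed.

Let f_near1 z : 0 < Re z -> near1 (fun n => f (n%:R%:C + z) / f n%:R%:C).
Proof.
move=> z0; have th := tame_log_bernstein bl.
have [C HC] : exists C, forall n, (0 < n)%N ->
    normc (log0 (f (n%:R%:C + z)) - log0 (f n%:R%:C)) <= C / n%:R.
  exists (2 * (8 * normc z)) => n n0; have nR : 0 < (n%:R : R) by rewrite ltr0n.
  have reg (s : R[i]) : n%:R <= Re s -> 0 < Re s by exact: lt_le_trans.
  have b1 (s : R[i]) : n%:R <= Re s -> normc (f1 s / f s) <= 8 / n%:R.
    move=> ns; rewrite (le_trans (tame_bound1 th (reg s ns)))// ler_wpM2l//.
    by rewrite lef_pV2 ?posrE// reg.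
  have := half_plane_MVT (z := n%:R%:C) (w := z)
    (fun s ns => tame_cdiff th (reg s ns)) b1.
  rewrite /= lexx ReD/= lerDl ltW// => /(_ isT isT) H.
  by rewrite (le_trans H)// -!mulrA ler_wpM2l// ler_wpM2l// mulrC.
have [K HK] := near1_cexp HC; exists K => n n0.
rewrite -[f _ / _](_ : cexp (log0 (f (n%:R%:C + z)) - log0 (f n%:R%:C)) = _) ?HK//.
have nR : 0 < (n%:R : R) by rewrite ltr0n.
rewrite cexpB !cexp_log0// Re_gt0_neq0// (bl_Re_gt0 bl)// ?ReD/= ?addr_gt0//.
Qed.

(** Beyond the strip, a shift of z by 1 multiplies the quotient by
   f (n + z) / f n, which also tends to 1. *)
Lemma mellin_ratio z : 0 < Re z ->
  near1 (fun n => W (n%:R%:C + z) / (W n%:R%:C * cexp (z * log0 (f n%:R%:C)))).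
Proof.
have [N] : exists N, Re z <= (N.+2)%:R.
  exists (Num.bound (Re z)); have [z0|z0] := leP 0 (Re z).
    by rewrite (le_trans (ltW (archi_boundP z0)))// ler_nat leqW.
  by rewrite (le_trans (ltW z0)).
elim: N z => [|N IHN] z zN z0; first by apply: mellin_ratio_strip; rewrite z0.
have [z2|z2] := leP (Re z) 2; first by apply: mellin_ratio_strip; rewrite z0.
pose s := z - 1.
have s0 : 0 < Re s by rewrite ReB/=; lra.
have sN : Re s <= N.+2%:R by rewrite ReB/= lerBlDr natr1.
have [C HC] := near1M (IHN s sN s0) (f_near1 s0).
exists C => n n0; have nR : 0 < (n%:R : R) by rewrite ltr0n.
have fn0 : f n%:R%:C != 0 by rewrite Re_gt0_neq0// (bl_Re_gt0 bl).
have := HC n n0; congr (normc (_ - 1) <= _).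
have -> : z = s + 1 by rewrite /s subrK.
rewrite (addrA _ s 1) WS; last by rewrite ReD/= addr_gt0.
rewrite [(s + 1) * _]mulrDl mul1r cexpD (cexp_log0 fn0) !invfM; ring.
Qed.

(** Stirling's formula for W: the functional equation turns the quotient of
   the previous lemma into the exponential of the sum controlled by the
   Euler-Maclaurin formula. *)
Lemma stirling z : 0 < Re z ->
  W z * f z * cexp (stirling_exponent (fun z => log0 (f z))
    (fun z => f2 z / f z - (f1 z / f z) ^+ 2) z) = 1.
Proof.
move=> z0; set X := stirling_exponent _ _ z.
pose l s := log0 (f s).
have fn0 s : 0 < Re s -> f s != 0 by move=> s0; rewrite Re_gt0_neq0// (bl_Re_gt0 bl).
pose S n := \sum_(1 <= k < n) (l (k%:R%:C + z) - l k%:R%:C) - z * l n%:R%:C.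
have WzE n : W (n.+1%:R%:C + z) = W z * f z * \prod_(1 <= k < n.+1) f (k%:R%:C + z).
  elim: n => [|n IHn].
    by rewrite big_geq// mulr1 addrC WS// mulrC.
  rewrite big_nat_recr//= mulrA -IHn -natr1 RCD -addrA [1%:C + z]addrC addrA WS.
    by rewrite mulrC.
  by rewrite ReD/= addr_gt0// ltr0n.
have WnE n : W n.+1%:R%:C = \prod_(1 <= k < n.+1) f k%:R%:C.
  elim: n => [|n IHn]; first by rewrite big_geq.
  rewrite big_nat_recr//= -IHn -natr1 RCD WS; first by rewrite mulrC.
  by rewrite /= ltr0n.
have RE n : (0 < n)%N -> W (n%:R%:C + z) / (W n%:R%:C * cexp (z * log0 (f n%:R%:C))) =
    W z * f z * cexp (S n).
  case: n => // n _; rewrite WzE WnE /S cexpB sumrB cexpB !cexp_sum.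
  rewrite (@eq_big_nat _ _ _ 1 n.+1 (fun k => cexp (l (k%:R%:C + z)))
    (fun k => f (k%:R%:C + z))); last first.
    by move=> k /andP[k1 _]; rewrite cexp_log0// fn0// ReD/= addr_gt0// ltr0n.
  rewrite (@eq_big_nat _ _ _ 1 n.+1 (fun k => cexp (l k%:R%:C)) (fun k => f k%:R%:C)); last first.
    by move=> k /andP[k1 _]; rewrite cexp_log0// fn0//= ltr0n.
  by rewrite invfM !mulrA.
have [C HC] := stirling_sum (tame_log_bernstein bl) z0.
have HC' n : (0 < n)%N -> normc (X - S n) <= C / n%:R.
  by move=> n0; rewrite normcB; exact: HC.
have [K HK] := near1M (mellin_ratio z0) (near1_cexp HC').
apply: near1_cst; exists K => n n0; have := HK n n0.
by rewrite RE// -mulrA -cexpD subrKC.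
Qed.

End mellin_ratio.

(** * The Gamma function *)

Section half_line_FTC.
Context {R : realType}.
Notation mu := (@lebesgue_measure R).
Notation D := (`]0%R, +oo[%classic : set R).
Implicit Types (t e : R) (n : nat).

Let E n : set R := `[n.+1%:R^-1, n.+1%:R]%classic.

Let E_gt0 n t : E n t -> 0 < t.
Proof.
by rewrite /E/= in_itv/= => /andP[+ _]; apply: lt_le_trans; rewrite invr_gt0.
Qed.

Let E_le n : (n.+1%:R : R)^-1 <= n.+1%:R.
Proof. by rewrite (@le_trans _ _ 1)// ?invf_le1// ler1n. Qed.

Let nondecreasing_E : nondecreasing_seq E.
Proof.
move=> n k nk; apply/subsetPset; apply: subset_itv; rewrite bnd_simp.
  by rewrite lef_pV2 ?posrE// ler_nat.
by rewrite ler_nat.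
Qed.

Let mE n : measurable (E n). Proof. exact: measurable_itv. Qed.

Let bigcup_E : \bigcup_n E n = D.
Proof.
apply/seteqP; split=> [t [n _ /E_gt0 t0]|t]; rewrite /= in_itv/= andbT// => t0.
exists (Num.bound (Num.max t t^-1)) => //; rewrite /E/= in_itv/=.
have : Num.max t t^-1 < (Num.bound (Num.max t t^-1))%:R.
  by apply: archi_boundP; rewrite le_max ltW.
set N := Num.bound _; rewrite gt_max => /andP[tN tVN].
have NS : (N%:R : R) <= N.+1%:R by rewrite ler_nat.
by rewrite invf_ple ?posrE// (le_trans (ltW tVN))//= (le_trans (ltW tN)).
Qed.

(** Monotone convergence along the exhaustion by the segments [1 / n, n], on
   which the integral is an increment of the bounded function F. *)
Lemma integrable_half_line (F k : R -> R) (M : R) :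
  (forall t, 0 < t -> is_derive t (1 : R) F (k t)) ->
  (forall t, 0 < t -> {for t, continuous k}) ->
  (forall t, 0 < t -> 0 <= k t) -> (forall t, 0 < t -> 0 <= F t <= M) ->
  mu.-integrable D (EFin \o k).
Proof.
move=> dF ck k0 FM.
have mk n : measurable_fun (E n) k.
  apply: subspace_continuous_measurable_fun => //.
  by apply: continuous_in_subspaceT => t; rewrite inE => /E_gt0; exact: ck.
have In n : (\int[mu]_(t in E n) (k t)%:E <= M%:E)%E.
  have [En|] := eqVneq (n.+1%:R^-1 : R) n.+1%:R.
    rewrite /E En set_itv1 integral_set1 lee_fin.
    by have /andP[h1 h2] := FM 1 ltr01; exact: le_trans h2.
  move=> En; have lt : (n.+1%:R : R)^-1 < n.+1%:R by rewrite lt_neqAle En E_le.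
  rewrite (continuous_FTC2 lt (F := F)).
  - rewrite -EFinB lee_fin.
    have /andP[h1 h2] := FM n.+1%:R (ltr0Sn _ _).
    have /andP[h3 h4] : 0 <= F n.+1%:R^-1 <= M by apply: FM; rewrite invr_gt0.
    lra.
  - by apply: continuous_in_subspaceT => t; rewrite inE => /E_gt0; exact: ck.
  - have cF t : 0 < t -> {for t, continuous F}.
      move=> t0; apply/differentiable_continuous/derivable1_diffP.
      exact: (@ex_derive _ _ _ _ _ _ _ (dF t t0)).
    split.
    + move=> t; rewrite in_itv/= => /andP[tl _].
      by apply: (@ex_derive _ _ _ _ _ _ _ (dF t _));
        rewrite (lt_trans _ tl)// invr_gt0.
    + by apply: cvg_at_right_filter; apply: cF; rewrite invr_gt0.
    + by apply: cvg_at_left_filter; exact: cF.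
  - move=> t; rewrite in_itv/= => /andP[tl _]; rewrite derive1E.
    by apply: (@derive_val _ _ _ _ _ _ _ (dF t _)); rewrite (lt_trans _ tl)// invr_gt0.
have mkD : measurable_fun D k.
  by rewrite -bigcup_E; apply/measurable_fun_bigcup.
apply/integrableP; split; first exact/measurable_EFinP.
under eq_integral => t.
  rewrite inE/= in_itv/= andbT => t0; rewrite /= ger0_norm ?k0//.
  over.
rewrite -bigcup_E.
have H : (\int[mu]_(t in E i) (k t)%:E)%E @[i --> \oo] -->
    (\int[mu]_(t in \bigcup_i E i) (k t)%:E)%E.
  apply: ge0_nondecreasing_set_cvg_integral => //.
    by move=> i; apply/measurable_EFinP; exact: mk.
  by move=> i t /E_gt0 t0; rewrite lee_fin k0.
apply: (@le_lt_trans _ _ M%:E); last exact: ltry.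
by rewrite -(cvg_lim _ H)//; apply: lime_le; [apply/cvg_ex; eexists; exact: H|exact: nearW].
Qed.

Let Rintegral_exhaust (k : R -> R) e : mu.-integrable D (EFin \o k) -> 0 < e ->
  exists N, forall n, (N <= n)%N ->
    `|\int[mu]_(t in D) k t - \int[mu]_(t in E n) k t| <= e.
Proof.
move=> ik e0.
have ED n : E n `<=` D by move=> t /E_gt0 t0; rewrite /= in_itv/= t0.
have ia : mu.-integrable D (EFin \o (fun t => `|k t|)) by exact: integrable_norm.
have iaE n : mu.-integrable (E n) (EFin \o (fun t => `|k t|)).
  by apply: integrableS ia => //; exact: mE.
have H : (\int[mu]_(t in E i) (`|k t|)%:E)%E @[i --> \oo] -->
    (\int[mu]_(t in D) (`|k t|)%:E)%E.
  rewrite -bigcup_E; apply: ge0_nondecreasing_set_cvg_integral => //.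
  by move=> i; exact: measurable_int (iaE i).
have Hf : \int[mu]_(t in E i) `|k t| @[i --> \oo] --> \int[mu]_(t in D) `|k t|.
  rewrite /Rintegral; apply: fine_cvg; rewrite fineK//; exact: integrable_fin_num ia.
move/cvgrPdist_le : Hf => /(_ e e0)[N _ HN]; exists N => n Nn.
have := HN n Nn; rewrite /= => Hn.
have split p : mu.-integrable D (EFin \o p) -> \int[mu]_(t in D) p t =
    \int[mu]_(t in E n) p t + \int[mu]_(t in D `\` E n) p t.
  move=> ip; have DE : D = E n `|` (D `\` E n) by rewrite setDUK.
  rewrite {1}DE Rintegral_setU//.
  - exact: mE.
  - by apply: measurableD => //; exact: mE.
  - by rewrite -DE.
  - by apply/disj_setPS => t [? []].
rewrite (split k)// addrAC subrr add0r.
have iB : mu.-integrable (D `\` E n) (EFin \o k).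
  by apply: integrableS ik => //; apply: measurableD => //; exact: mE.
apply: le_trans (le_normr_Rintegral _ iB) _; first by apply: measurableD => //; exact: mE.
apply: le_trans Hn; rewrite [X in _ <= `|X - _|](split (fun t => `|k t|))//.
by rewrite addrAC subrr add0r ler_norm.
Qed.

Lemma cintegral_half_line (F k : R -> R[i]) (A B : R[i]) :
  (forall t, 0 < t -> is_cderive1 F t (k t)) ->
  (forall t, 0 < t -> exists l, is_cderive1 k t l) ->
  cintegrable mu D k ->
  (forall e, 0 < e -> exists2 d, 0 < d & forall t, 0 < t <= d -> normc (F t - A) <= e) ->
  (forall e, 0 < e -> exists M, forall t, 0 < t -> M <= t -> normc (F t - B) <= e) ->
  cintegral mu D k = B - A.
Proof.
move=> dF dk [ir ii] FA FB.
apply/eqP; rewrite -subr_eq0 -normc_eq0 eq_le normc_ge0 andbT.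
apply/ler_addgt0Pr => e e0; rewrite add0r.
have e40 : 0 < e / 4 by rewrite divr_gt0.
have [N1 HN1] := Rintegral_exhaust ir e40.
have [N2 HN2] := Rintegral_exhaust ii e40.
have [dl dl0 Hd] := FA _ e40; have [M HM] := FB _ e40.
pose b := Num.max 0 (Num.max M dl^-1).
pose n := maxn (maxn N1 N2) (Num.bound b).
have n1 : (N1 <= n)%N by rewrite /n !leq_max leqnn.
have n2 : (N2 <= n)%N by rewrite /n !leq_max leqnn orbT.
have bn : b <= n.+1%:R.
  rewrite (le_trans (ltW (archi_boundP _)))// ?le_max ?lexx//.
  by rewrite ler_nat leqW// /n leq_max leqnn orbT.
move: bn; rewrite /b !ge_max => /andP[_ /andP[Mn dn]].
have [||_ En] := @cintegral_FTC_closed _ F k n.+1%:R^-1 n.+1%:R (E_le n).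
- move=> t /andP[tl _]; apply: dF; apply: lt_le_trans tl; by rewrite invr_gt0.
- move=> t /andP[tl _]; apply: dk; apply: lt_le_trans tl; by rewrite invr_gt0.
rewrite [X in normc X](_ : _ = (cintegral mu D k - cintegral mu (E n) k) +
  (F n.+1%:R - B) + - (F n.+1%:R^-1 - A)); last by rewrite En; ring.
rewrite (le_trans (normc_sum3 _ _ _))// normcN.
have H1 : normc (F n.+1%:R - B) <= e / 4 by apply: HM.
have H2 : normc (F n.+1%:R^-1 - A) <= e / 4.
  by apply: Hd; rewrite invr_gt0 ltr0n/= invf_ple// posrE.
have H3 : normc (cintegral mu D k - cintegral mu (E n) k) <= e / 4 + e / 4.
  by rewrite (le_trans (normc_le _))// lerD// ?ReB ?ImB; [exact: HN1|exact: HN2].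
lra.
Qed.

End half_line_FTC.

Section gamma_function.
Context {R : realType}.
Notation mu := (@lebesgue_measure R).
Notation D := (`]0%R, +oo[%classic : set R).
Implicit Types (t a : R) (z : R[i]).

Let kernel z t : R[i] := rpowc t (z - 1) * (expR (- t))%:C.

Let kernelE z t : 0 < t -> kernel z t = cexp ((z - 1) * log0 t%:C - t%:C).
Proof.
by move=> t0; rewrite /kernel rpowc_gt0// log0_real// cexpB cexpR expRN RCV.
Qed.

Let cdiff_kernel z t : 0 < t -> cdiff (fun v => cexp (z * log0 v - v)) t%:C
  (cexp (z * log0 t%:C - t%:C) * (z / t%:C - 1)).
Proof.
move=> t0; apply: (cdiff_comp _ (cdiff_cexp _)) => //.
by apply: cdiffB (cdiff_id _); apply: cdiffZ; exact: cdiff_log0.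
Qed.

Let kernel_deriv z t : 0 < t -> exists l, is_cderive1 (kernel z) t l.
Proof.
move=> t0; eexists; apply: is_cderive1_near; last first.
  exact: cdiff_real (cdiff_kernel (z - 1) t0).
have tI : t \in `]0, +oo[ by rewrite in_itv/= t0.
apply: filterS (near_in_itvoy tI) => s; rewrite in_itv/= andbT => s0.
by rewrite kernelE.
Qed.

Let Phi a (v : R[i]) := cexp (a%:C * (log0 v - log0 (1 + v))).
Let phi a (v : R[i]) := Phi a v * (a%:C * (v^-1 - (1 + v)^-1)).

Let cdiff_1D t : cdiff (fun v : R[i] => 1 + v) t%:C 1.
Proof. by have := cdiffD (cdiff_cst 1 t%:C) (cdiff_id t%:C); rewrite add0r. Qed.

Let cdiff_Phi a t : 0 < t -> cdiff (Phi a) t%:C (phi a t%:C).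
Proof.
move=> t0; apply: (cdiff_comp _ (cdiff_cexp _)).
apply: cdiffZ; apply: cdiffB; first exact: cdiff_log0.
have := cdiff_comp (cdiff_1D t) (cdiff_log0 (z := 1 + t%:C) _).
by rewrite mulr1; apply; rewrite ReD/= addr_gt0.
Qed.

Let phiE a t : 0 < t ->
  phi a t%:C = (a / (t * (1 + t)) * expR (a * (ln t - ln (1 + t))))%:C.
Proof.
move=> t0; rewrite /phi /Phi -RCD !log0_real ?addr_gt0// -RCB -RCM cexpR.
rewrite mulrC -!RCV -RCB -!RCM; congr (_ * _)%:C.
by field; rewrite !gt_eqF// addr_gt0.
Qed.

(** The function (t / (1 + t)) ^ a increases from 0 to 1, and its derivative
   dominates a multiple of the Gamma kernel. *)
Let integrable_dominant a : 0 < a ->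
  mu.-integrable D (EFin \o (fun t => Re (phi a t%:C))).
Proof.
move=> a0.
apply: (@integrable_half_line _ (fun t => Re (Phi a t%:C)) (fun t => Re (phi a t%:C)) 1).
- by move=> t t0; have /is_cderive1P[] := cdiff_real (cdiff_Phi a t0).
- move=> t t0.
  have tn : (t%:C : R[i]) != 0 by exact: Re_gt0_neq0.
  have t1n : (1 + t%:C : R[i]) != 0 by apply: Re_gt0_neq0; rewrite ReD/= addr_gt0.
  have := cdiffM (cdiff_Phi a t0) (cdiffZ a%:C (cdiffB (cdiffV tn)
    (cdiff_comp (cdiff_1D t) (cdiffV t1n)))).
  by move=> /cdiff_real/is_cderive1_continuous[].
- move=> t t0; rewrite phiE// mulr_ge0 ?expR_ge0// divr_ge0 ?(ltW a0)//.
  by rewrite mulr_ge0 ?addr_ge0// ltW.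
- move=> t t0; rewrite /Phi -RCD !log0_real ?addr_gt0// -RCB -RCM cexpR.
  rewrite /= expR_ge0 expR_le1.
  by rewrite pmulr_rle0// subr_le0 ler_ln ?posrE ?addr_gt0// lerDr ler01.
Qed.

(** ln x < x at x = (1 + t) / (a + 1). *)
Let exp_bound a t : 0 < a -> 0 < t ->
  (a + 1) * ln (1 + t) <= 1 + t + (a + 1) * ln (a + 1).
Proof.
move=> a0 t0; have a10 : 0 < a + 1 by rewrite addr_gt0.
have t10 : 0 < 1 + t by rewrite addr_gt0.
have := @ln_sublinear R ((1 + t) / (a + 1)) (divr_gt0 t10 a10).
rewrite ln_div ?posrE// ltr_pdivlMr// => H; lra.
Qed.

Lemma gamma_integrable z : 0 < Re z -> cintegrable mu D (kernel z).
Proof.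
move=> z0; set a := Re z.
pose C := expR (1 + (a + 1) * ln (a + 1)) / a.
apply: (cintegrable_le _ _ _ (integrableRZ _ C (integrable_dominant z0))) => //.
- apply: subspace_continuous_measurable_fun => //.
  apply: continuous_in_subspaceT => t; rewrite inE/= in_itv/= andbT => t0.
  by have [l /is_cderive1_continuous[]] := kernel_deriv z t0.
- apply: subspace_continuous_measurable_fun => //.
  apply: continuous_in_subspaceT => t; rewrite inE/= in_itv/= andbT => t0.
  by have [l /is_cderive1_continuous[]] := kernel_deriv z t0.
move=> t tD; have t0 : 0 < t by move: tD; rewrite /= in_itv/= andbT.
rewrite kernelE// normc_cexp log0_real// phiE// ReB mulrC ReZ ReB [Re 1]/= [Re t%:C]/=.
have t10 : 0 < 1 + t by rewrite addr_gt0.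
rewrite -/a [Re _%:C]/=.
have -> : C * (a / (t * (1 + t)) * expR (a * (ln t - ln (1 + t)))) =
   expR ((1 + (a + 1) * ln (a + 1)) + (a * (ln t - ln (1 + t)) - (ln t + ln (1 + t)))).
  rewrite expRD expRB expRD !lnK ?posrE// /C; field.
  by rewrite !gt_eqF.
rewrite ler_expR; have := exp_bound z0 t0; rewrite -/a; lra.
Qed.

(** Integration by parts: t ^ z exp (- t) vanishes at both ends of the
   half-line. *)
Lemma gammaS z : 0 < Re z -> Gammac (z + 1) = z * Gammac z.
Proof.
move=> z0; apply/eqP; rewrite -subr_eq0; apply/eqP; rewrite /Gammac.
have z10 : 0 < Re (z + 1) by rewrite ReD/= addr_gt0.
have I1 := gamma_integrable z10; have I0 := gamma_integrable z0.
rewrite -/(kernel (z + 1)) -cintegralZ// -cintegralB//; last exact: cintegrableZ.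
pose F (t : R) := - cexp (z * log0 t%:C - t%:C).
have nF t : 0 < t -> normc (F t) = expR (Re z * ln t - t).
  by move=> t0; rewrite /F normcN normc_cexp log0_real// ReB mulrC ReZ mulrC.
rewrite (@cintegral_half_line _ F _ 0 0) ?subrr//.
- move=> t t0.
  have tn : (t%:C : R[i]) != 0 by exact: Re_gt0_neq0.
  have := cdiff_real (cdiffN (cdiff_kernel z t0)).
  rewrite -[X in is_cderive1 _ _ X](_ : kernel (z + 1) t - z * kernel z t = _)//.
  rewrite !kernelE// addrK (_ : (z - 1) * _ - _ = (z * log0 t%:C - t%:C) - log0 t%:C); last by ring.
  by rewrite (cexpB (z * log0 t%:C - t%:C) (log0 t%:C)) (cexp_log0 tn); ring.
- move=> t t0; have [l1 d1] := kernel_deriv (z + 1) t0; have [l0 d0] := kernel_deriv z t0.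
  exists (l1 - z * l0); apply: is_cderive1B => //.
  by apply: (@cdiff_curve _ (fun v => z * v)) d0; rewrite -[X in cdiff _ _ X]mulr1; apply: cdiffZ; exact: cdiff_id.
- by apply: cintegrableB => //; exact: cintegrableZ.
- move=> e e0; exists (expR (ln e / Re z)); first exact: expR_gt0.
  move=> t /andP[t0 te]; rewrite subr0 nF//.
  rewrite -[leRHS]lnK ?posrE// ler_expR.
  have : ln t <= ln e / Re z by rewrite -[leRHS]expRK ler_ln ?posrE ?expR_gt0.
  by rewrite ler_pdivlMr// mulrC; lra.
- move=> e e0; pose a := Re z; pose C := 1 + (a + 1) * ln (a + 1).
  exists (expR C / e) => t t0 Mt; rewrite subr0 nF//.
  have t10 : 0 < 1 + t by rewrite addr_gt0.
  apply: (@le_trans _ _ (expR (C - ln (1 + t)))).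
    rewrite ler_expR; have := exp_bound z0 t0; rewrite -/a /C.
    have : a * ln t <= a * ln (1 + t).
      by rewrite ler_wpM2l ?(ltW z0)// ler_ln ?posrE// lerDr.
    lra.
  rewrite expRB lnK ?posrE// ler_pdivrMr// mulrC -ler_pdivrMr//.
  by rewrite (le_trans Mt)// lerDr.
Qed.

Lemma gamma1 : Gammac 1 = 1 :> R[i].
Proof.
rewrite /Gammac.
rewrite (@cintegral_half_line _ (fun t => - cexp (- t%:C)) _ (- 1) 0) ?sub0r ?opprK//.
- move=> t t0; have := cdiff_real (cdiffN (cdiff_kernel 0 t0)).
  rewrite !mul0r !sub0r mulrN mulr1 opprK.
  rewrite -[X in is_cderive1 _ _ X](_ : kernel 1 t = _)//.
    by under eq_fun do rewrite mul0r sub0r.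
  by rewrite kernelE// subrr mul0r sub0r.
- by move=> t t0; exact: kernel_deriv.
- by apply: gamma_integrable; exact: ltr01.
- move=> e e0; exists e => // t /andP[t0 te].
  rewrite addrC cexpN cexpR -RCV -expRN -RCB normcR.
  rewrite ger0_norm ?subr_ge0 ?expR_le1 ?oppr_le0 ?(ltW t0)//.
  by have := expR_ge1Dx (- t); lra.
- move=> e e0; exists e^-1 => t t0 et.
  rewrite subr0 normcN normc_cexp ReN/= expRN invf_ple ?posrE ?expR_gt0//.
  by rewrite (le_trans et)// (le_trans _ (expR_ge1Dx t))// lerDr.
Qed.

End gamma_function.

(** * The logarithm of phi_star *)

Section phi_star_log.
Context {R : realType}.
Notation mu := (@lebesgue_measure R).
Variables phi f1 f2 : R[i] -> R[i].
Hypothesis bl : bernstein_like phi f1 f2.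
Implicit Types (z : R[i]) (u v a : R).

Definition phi_star_log z : R[i] := log0 z - log0 (phi z).
Definition phi_star_log1 z : R[i] := 1 / z - f1 z / phi z.
Definition phi_star_log2 z : R[i] :=
  (0 / z - (1 / z) ^+ 2) - (f2 z / phi z - (f1 z / phi z) ^+ 2).
Notation h := phi_star_log.
Notation h1 := phi_star_log1.
Notation h2 := phi_star_log2.
Notation phis := (phi_star phi).

Lemma tame_phi_star : tame h h1 h2 (8 + 8).
Proof.
exact: tameB (tame_log_bernstein (@bernstein_like_id R)) (tame_log_bernstein bl).
Qed.
Let th := tame_phi_star.

Lemma log0_phi_star z : 0 < Re z -> log0 (phis z) = h z.
Proof. by move=> z0; rewrite /phi_star log0_div// (bl_Re_gt0 bl). Qed.

Lemma cexp_phi_star_log z : 0 < Re z -> cexp (h z) = phis z.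
Proof.
move=> z0; rewrite cexpB cexp_log0 ?Re_gt0_neq0// cexp_log0//.
exact/Re_gt0_neq0/(bl_Re_gt0 bl).
Qed.

Let phi_real a : 0 < a -> phi a%:C = (Re (phi a%:C))%:C.
Proof. by move=> a0; apply: complexP => //; rewrite (bl_real bl). Qed.

Let phi_starR a : 0 < a -> phis a%:C = (a / Re (phi a%:C))%:C.
Proof. by move=> a0; rewrite /phi_star {1}phi_real// -RCV -RCM. Qed.

Lemma phi_star_real a : 0 < a -> Im (phis a%:C) = 0.
Proof. by move=> a0; rewrite phi_starR. Qed.

Lemma phi_star_gt0 a : 0 < a -> 0 < Re (phis a%:C).
Proof. by move=> a0; rewrite phi_starR// divr_gt0// (bl_gt0 bl). Qed.

(** No multiple of 2 i pi appears: h is real at v, and both log0 and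
   log0 o phi have imaginary part less than pi / 2 in absolute value. *)
Lemma log0_phi_star_quotient z v : 0 < v -> 0 < Re z ->
  log0 (phis (v%:C + z) / phis v%:C) = h (v%:C + z) - h v%:C.
Proof.
move=> v0 z0; have vz0 : 0 < Re (v%:C + z) by rewrite ReD/= addr_gt0.
have -> : phis (v%:C + z) / phis v%:C = cexp (h (v%:C + z) - h v%:C).
  by rewrite cexpB !cexp_phi_star_log.
apply: log0_cexp.
have hv : Im (h v%:C) = 0.
  by rewrite -log0_phi_star// phi_starR// log0_real// divr_gt0// (bl_gt0 bl).
rewrite ImB hv subr0 ImB.
move: (arg_pihalf vz0) (arg_pihalf (bl_Re_gt0 bl vz0)) => /andP[? ?] /andP[? ?].
have := @pi_gt0 R => ?.
by rewrite [Im (log0 _)]/= [Im (log0 (phi _))]/= (splitr pi); apply/andP; split; lra.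
Qed.

Let near_pos (u : R) (c k : R -> R[i]) : 0 < u -> (forall v, 0 < v -> c v = k v) ->
  \forall v \near u, c v = k v.
Proof.
move=> u0 ck; have uI : u \in `]0, +oo[ by rewrite in_itv/= u0.
by apply: filterS (near_in_itvoy uI) => v; rewrite in_itv/= andbT; exact: ck.
Qed.

Let cderive2E (c k l : R -> R[i]) u (m : R[i]) : 0 < u ->
  (forall v, 0 < v -> c v = k v) -> (forall v, 0 < v -> is_cderive1 k v (l v)) ->
  is_cderive1 l u m -> cderive1 (cderive1 c) u = m.
Proof.
move=> u0 ck dk dl; apply: is_cderive1_cderive1.
apply: is_cderive1_near dl; apply: near_pos => // v v0; apply/esym.
apply: is_cderive1_cderive1; apply: is_cderive1_near (dk v v0).
by apply: near_pos => // s s0; rewrite ck.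
Qed.

Let cdiff_shift (F : R[i] -> R[i]) l v z : cdiff F (v%:C + z) l ->
  cdiff (fun s => F (s + z)) v%:C l.
Proof.
move=> dF; rewrite -[l]mulr1; apply: (@cdiff_comp _ (fun s => s + z) F) => //.
by have := cdiffD (cdiff_id v%:C) (cdiff_cst z v%:C); rewrite addr0.
Qed.

(** The second derivative in the integrand of E is taken along the real axis,
   where it agrees with that of h (u + z) - h u. *)
Lemma EintegrandE z u : 0 < u -> 0 < Re z ->
  Eintegrand phis z u = tail_integrand h2 z u - tail_integrand h2 0 u.
Proof.
move=> u0 z0; rewrite /Eintegrand /tail_integrand -mulrBr addr0; congr (_ * _).
have vz v : 0 < v -> 0 < Re (v%:C + z) by move=> v0; rewrite ReD/= addr_gt0.
apply: (@cderive2E (fun v => log0 (phis (v%:C + z) / phis v%:C))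
  (fun v => h (v%:C + z) - h v%:C) (fun v => h1 (v%:C + z) - h1 v%:C)) => //.
- by move=> v v0; exact: log0_phi_star_quotient.
- move=> v v0.
  apply: (@cdiff_real _ (fun s => h (s + z) - h s)); apply: cdiffB.
    exact/cdiff_shift/(tame_cdiff th)/vz.
  exact: (tame_cdiff th).
apply: (@cdiff_real _ (fun s => h1 (s + z) - h1 s)); apply: cdiffB.
  exact/cdiff_shift/(tame_cdiff1 th)/vz.
exact: (tame_cdiff1 th).
Qed.

Lemma TintegrandE u : 0 < u -> Tintegrand phi u = - tail_integrand h2 0 u.
Proof.
move=> u0; rewrite /Tintegrand /tail_integrand addr0 -[RHS]mulrN.
cbv zeta; congr (_ * _).
have d1 v : 0 < v -> is_cderive1 (fun v : R => phi v%:C) v (f1 v%:C).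
  by move=> v0; apply: cdiff_real; exact: (bl_cdiff bl).
rewrite (is_cderive1_cderive1 (d1 u u0)).
rewrite (cderive2E u0 (k := fun v : R => phi v%:C) _ d1 (cdiff_real (bl_cdiff1 bl (z := u%:C) u0)))//.
by rewrite /phi_star_log2 mul0r div1r exprVn; ring.
Qed.

Let ray_gt0 u : `[1, +oo[%classic u -> 0 < u.
Proof. by rewrite /= in_itv/= andbT; exact: lt_le_trans. Qed.

Let cintegrable_ray z : 0 <= Re z -> cintegrable mu `[1, +oo[ (tail_integrand h2 z).
Proof. by apply: (cintegrable_tail th); exact: ltr01. Qed.

Lemma cintegrable_Eintegrand z : 0 < Re z -> cintegrable mu `[1, +oo[ (Eintegrand phis z).
Proof.
move=> z0.
have I : cintegrable mu `[1, +oo[ (fun u => tail_integrand h2 z u - tail_integrand h2 0 u).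
  by apply: cintegrableB => //; apply: cintegrable_ray => //; exact: ltW.
by apply: eq_cintegrable I => // u /ray_gt0 u0; rewrite EintegrandE.
Qed.

Lemma ElogE z : 0 < Re z -> Elog phis z = 2^-1 * (tail h2 z - tail h2 0).
Proof.
move=> z0; rewrite /Elog /tail -cintegralB//.
- congr (_ * _); apply: eq_cintegral => // u /ray_gt0 u0; exact: EintegrandE.
- by apply: cintegrable_ray; exact: ltW.
- exact: cintegrable_ray.
Qed.

Lemma cintegrable_Tintegrand : cintegrable mu `[1, +oo[ (Tintegrand phi).
Proof.
have I : cintegrable mu `[1, +oo[ (fun u => (-1) * tail_integrand h2 0 u).
  by apply: cintegrableZ => //; exact: cintegrable_ray.
by apply: eq_cintegrable I => // u /ray_gt0 u0; rewrite TintegrandE// mulN1r.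
Qed.

Lemma TlogE : Tlog phi = - (2^-1 * tail h2 0).
Proof.
rewrite /Tlog -mulrN -mulN1r /tail -(cintegralZ _ (-1) (cintegrable_ray (z := 0) (lexx _)))//.
congr (_ * _); apply: eq_cintegral => // u /ray_gt0 u0.
by rewrite TintegrandE// mulN1r.
Qed.

Lemma normc_ElogB z : 0 < Re z -> normc (Elog phis z - Tlog phi) <= 16 / Re z.
Proof.
move=> z0; rewrite ElogE// TlogE [X in normc X](_ : _ = 2^-1%:C * tail h2 z); last first.
  by rewrite RCV (rmorph_nat (real_complex R)); ring.
rewrite normcZ ?invr_ge0// mulrC ler_pdivrMr// mulrC.
apply: le_trans (normc_tail th ltr01 (ltW z0)) _.
rewrite ler_wpM2l// (_ : 8 + 8 = 16 :> R); last by ring.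
by rewrite ler_wpM2l// lef_pV2 ?posrE ?addr_gt0// lerDr.
Qed.

(** The primitive, the boundary terms and the tail are all linear in the
   logarithm. *)
Lemma stirling_exponentB z : 0 < Re z -> stirling_exponent h h2 z =
  stirling_exponent (fun z => log0 (id z)) (fun z => 0 / id z - (1 / id z) ^+ 2) z -
  stirling_exponent (fun z => log0 (phi z)) (fun z => f2 z / phi z - (f1 z / phi z) ^+ 2) z.
Proof.
move=> z0; have ti := tame_log_bernstein (@bernstein_like_id R).
have tp := tame_log_bernstein bl.
have z10 : 0 < Re (1 + z) by rewrite ReD/= addr_gt0.
have tailB s : 0 <= Re s -> tail h2 s = tail (fun z => 0 / id z - (1 / id z) ^+ 2) s -
    tail (fun z => f2 z / phi z - (f1 z / phi z) ^+ 2) s.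
  move=> s0; rewrite /tail -cintegralB//; last 2 first.
  - exact: (cintegrable_tail ti ltr01 s0).
  - exact: (cintegrable_tail tp ltr01 s0).
  by apply: eq_cintegral => u _; rewrite /tail_integrand -mulrBr.
rewrite /stirling_exponent (tailB z (ltW z0)) (tailB 0)//.
rewrite (primitiveB (fun s s0 => tame_cdiff ti s0) (fun s s0 => tame_cdiff tp s0) z10).
by rewrite /phi_star_log/=; ring.
Qed.

(** The error made by replacing the integral of the logarithm over the unit
   segment from z to z + 1 by its value at z. *)
Lemma normc_primitive_step z : 0 < Re z ->
  normc (primitive h (z + 1) - primitive h z - h z) <= 64 / Re z.
Proof.
move=> z0; have reg (s : R[i]) : Re z <= Re s -> 0 < Re s by exact: lt_le_trans.
have := half_plane_taylor (z := z) (w := 1) (a := Re z) (M := 16 / Re z)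
  (fun s zs => cdiff_primitive th (reg s zs)) (fun s zs => tame_cdiff th (reg s zs)).
rewrite mulr1 => H; apply: le_trans (H _ _ _) _ => //.
- move=> s zs; apply: le_trans (tame_bound1 th (reg s zs)) _.
  rewrite (_ : 8 + 8 = 16 :> R); last by ring.
  by rewrite ler_wpM2l// lef_pV2 ?posrE// reg.
- by rewrite ReD/= lerDl.
- by rewrite (normcR 1) normr1 expr1n mulr1 mulrA -natrM.
Qed.

End phi_star_log.

(** * The quotient of Gamma and W *)

Section gamma_ratio.
Context {R : realType}.
Variables phi f1 f2 W : R[i] -> R[i].
Hypothesis bl : bernstein_like phi f1 f2.
Hypothesis W_gamma : bernstein_gamma phi W.
Implicit Types z : R[i].

Lemma stirling_bernstein_gamma z : 0 < Re z ->
  W z * phi z * cexp (stirling_exponent (fun z => log0 (phi z))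
    (fun z => f2 z / phi z - (f1 z / phi z) ^+ 2) z) = 1.
Proof.
case: W_gamma => WS W1 [d [T [P [Y [Y0 WY]]]]] z0.
have E s : (fun t => rpowc (Y t) (s - 1) * 1%:C) = (fun t => rpowc (Y t) (s - 1)).
  by apply/funext => t; rewrite mulr1.
apply: (@stirling _ _ _ P setT Y (fun=> 1)) => //.
- by move=> s s0; rewrite E; have [] := WY s s0.
- by move=> s s0; rewrite E; have [] := WY s s0.
Qed.

Lemma stirling_gamma z : 0 < Re z ->
  Gammac z * id z * cexp (stirling_exponent (fun z => log0 (id z))
    (fun z => 0 / id z - (1 / id z) ^+ 2) z) = 1.
Proof.
apply: (@stirling _ _ _ lebesgue_measure `]0, +oo[ id (fun t => expR (- t)) id
  (fun=> 1) (fun=> 0) (@Gammac R)) => //.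
- by move=> t; rewrite /= in_itv/= andbT; exact: ltW.
- exact: bernstein_like_id.
- exact: gamma_integrable.
- exact: gammaS.
- exact: gamma1.
Qed.

Lemma gamma_ratio z : 0 < Re z -> Gammac z / W z =
  (phi_star phi z)^-1 * cexp (- stirling_exponent (phi_star_log phi) (phi_star_log2 phi f1 f2) z).
Proof.
move=> z0; have Eg := stirling_gamma z0; have Ew := stirling_bernstein_gamma z0.
have zn : z != 0 by exact: Re_gt0_neq0.
have pn : phi z != 0 by exact/Re_gt0_neq0/(bl_Re_gt0 bl).
rewrite stirling_exponentB// opprB cexpB.
set A := cexp _ in Ew *; set B := cexp _ in Eg *.
have An : A != 0 by exact: cexp_neq0.
have Bn : B != 0 by exact: cexp_neq0.
have -> : Gammac z = (z * B)^-1.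
  have n0 := mulf_neq0 zn Bn; apply: (mulIf n0).
  by rewrite (mulVf n0) mulrA.
have -> : W z = (phi z * A)^-1.
  have n0 := mulf_neq0 pn An; apply: (mulIf n0).
  by rewrite (mulVf n0) mulrA.
by rewrite /phi_star; field; rewrite zn Bn pn An.
Qed.

End gamma_ratio.

(** * Uniform limits and the representation of Gamma / W *)

Section asymptotics.
Context {R : realType}.
Implicit Types (F : R[i] -> R[i]) (z l : R[i]).

Lemma cvg_unif_ImP F l (C : R) : 0 < C ->
  (forall z, 0 < Re z -> normc (F z - l) <= C / Re z) -> cvg_unif_Im F l.
Proof.
move=> C0 HF e e0; near=> x => y.
have x0 : 0 < x by near: x; exact: nbhs_pinfty_gt.
have xe : C / e < x by near: x; apply: nbhs_pinfty_gt; exact: num_real.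
apply: le_lt_trans (HF (x +i* y) x0) _ => /=.
by rewrite ltr_pdivrMr// mulrC -ltr_pdivrMr.
Unshelve. all: by end_near. Qed.

Lemma cvg_unif_Im_cexp F : cvg_unif_Im F 0 ->
  cvg_unif_Im (fun z => cexp (F z) - 1) 0.
Proof.
move=> F0 e e0; pose d := Num.min 1 (e / (4 * expR 1)).
have E0 : 0 < 4 * expR 1 :> R by rewrite mulr_gt0// expR_gt0.
have d0 : 0 < d by rewrite lt_min ltr01 divr_gt0.
apply: filterS (F0 d d0) => x Fx y; rewrite subr0.
have := Fx y; rewrite subr0 lt_min => /andP[/ltW n1 n2].
apply: le_lt_trans (normc_cexpB1 _) _.
move: n2; rewrite ltr_pdivlMr// => n2.
have e1 : expR (normc (F (x +i* y))) <= expR 1 by rewrite ler_expR.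
have n0 := normc_ge0 (F (x +i* y)).
have : normc (F (x +i* y)) * expR (normc (F (x +i* y))) <= normc (F (x +i* y)) * expR 1.
  by rewrite ler_wpM2l.
have := expR_gt0 (1 : R); nra.
Qed.

End asymptotics.

Theorem lemma5p1 (R : realType) (phi W : R[i] -> R[i])
    (phi_bernstein : bernstein phi)
    (phi_neq0 : exists2 z : R[i], 0 <= complex.Re z & phi z != 0)
    (W_gamma : bernstein_gamma phi W) :
  let phis := phi_star phi in
  (forall z : R[i], 0 < complex.Re z ->
    cintegrable lebesgue_measure `[1, +oo[ (Eintegrand phis z) /\
    Gammac z / W z =
      csqrt (phis 1) / (phis z * csqrt (phis (z + 1)))
      * cexp (Llog phis z) * cexp (- Elog phis z)) /\
  (forall z : R[i], 0 < complex.Re z ->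
    [/\ contour (log_analytic phis) 1 z (via_Re z),
        (forall g, contour (log_analytic phis) 1 z g ->
          contour_integral (fun w => log0 (phis w)) g = Llog phis (z - 1)),
        Llog phis (z - 1) =
          contour_integral (fun w => log0 (phis w)) (via_Re z) &
        contour_integral (fun w => log0 (phis w)) (via_Re z) =
          (Glog phis (complex.Re z) - Alog phis z) +i* Ulog phis z]) /\
  (cintegrable lebesgue_measure `[1, +oo[ (Tintegrand phi) /\
   cvg_unif_Im (Elog phis) (Tlog phi)) /\
  (exists o : R[i] -> R[i],
    cvg_unif_Im o 0 /\
    forall z : R[i], 0 < complex.Re z ->
      Gammac z / W z =
        (1 + o z) * (csqrt (phis 1) / csqrt (phis (z + 1)))
        * cexp (Llog phis (z - 1)) * cexp (- Tlog phi)).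
Proof.
have [f1 [f2 bl]] : exists f1 f2, bernstein_like phi f1 f2.
  case: phi_bernstein => q [d [mu [q0 d0 mu_fin phiE]]].
  exact: bernstein_like_bernstein phiE phi_neq0.
move=> phis.
pose h := phi_star_log phi; pose h2 := phi_star_log2 phi f1 f2.
pose G := primitive h.
have th := tame_phi_star bl.
have fh := log0_phi_star bl.
have f_real := phi_star_real bl.
have f_gt0 := phi_star_gt0 bl.
have S1 (z : R[i]) : 0 < Re z -> 0 < Re (z + 1) by move=> z0; rewrite ReD/= addr_gt0.
have LE (z : R[i]) : 0 < Re z -> Llog phis z = G (z + 1).
  by move=> z0; apply: (LlogE th fh); exact: S1.
have LE' (z : R[i]) : 0 < Re z -> Llog phis (z - 1) = G z.
  by move=> z0; rewrite (LlogE th fh) subrK.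
have sqrtE (z : R[i]) : 0 < Re z -> csqrt (phis z) = cexp (h z / 2).
  by move=> z0; rewrite /csqrt fh.
have ratioE (z : R[i]) : 0 < Re z -> Gammac z / W z =
    csqrt (phis 1) / (phis z * csqrt (phis (z + 1))) * cexp (G (z + 1)) *
    cexp (- Elog phis z).
  move=> z0; rewrite (gamma_ratio bl W_gamma z0) (ElogE bl z0).
  rewrite (sqrtE 1) ?ltr01// (sqrtE (z + 1)) ?S1// [(phis z * _)^-1]invfM -(cexpN (h (z + 1) / 2)).
  rewrite (_ : forall a b c d e : R[i], a * (b * c) * d * e = b * (a * c * d * e)) -?cexpD; last by move=> *; ring.
  by congr (_ * cexp _); rewrite /stirling_exponent [1 + z]addrC -/h -/h2 -/G; field.
split=> [z z0|]; first by rewrite LE//; split; [exact: (cintegrable_Eintegrand bl)|exact: ratioE].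
split=> [z z0|].
  have L g : contour (log_analytic phis) 1 z g ->
      contour_integral (fun w => log0 (phis w)) g = Llog phis (z - 1).
    by move=> cg; rewrite LE'// (contour_integral_primitive th fh cg) primitive1 subr0.
  have cz := contour_via_Re th fh z0.
  split=> //; first by rewrite L.
  rewrite (L _ cz) LE'// (GlogE th fh f_real f_gt0 z0).
  have [-> ->] := AUlogE th fh f_real f_gt0 z0.
  by rewrite subKr -/h -/G; case: (G z).
have ET : cvg_unif_Im (Elog phis) (Tlog phi).
  by apply: (@cvg_unif_ImP _ _ _ 16) => // z z0; exact: (normc_ElogB bl z0).
split; first by split=> //; exact: (cintegrable_Tintegrand bl).
(* The factor 1 / phis z of the exact formula is exp (- h z), which nearly cancels
   the integral of h from z to z + 1. *)
pose d z := G (z + 1) - G z - h z - (Elog phis z - Tlog phi).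
exists (fun z => cexp (d z) - 1); split.
  apply: cvg_unif_Im_cexp; apply: (@cvg_unif_ImP _ _ _ 80) => // z z0.
  rewrite subr0 /d (le_trans (le_normcD _ _))// normcN.
  rewrite (_ : 80 = 64 + 16); last by rewrite -natrD.
  rewrite mulrDl.
  by rewrite lerD ?(normc_primitive_step bl z0) ?(normc_ElogB bl z0).
move=> z z0.
have E : cexp (d z) * cexp (G z) * cexp (- Tlog phi) =
    cexp (- h z) * cexp (G (z + 1)) * cexp (- Elog phis z).
  by rewrite -!cexpD; congr cexp; rewrite /d; ring.
rewrite ratioE// LE'// subrKC.
transitivity (csqrt (phis 1) / csqrt (phis (z + 1)) *
  (cexp (d z) * cexp (G z) * cexp (- Tlog phi))); last by ring.
rewrite E (cexpN (h z)) (cexp_phi_star_log bl)// -/phis invfM; ring.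
Qed.
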